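(* Given an unrooted tree $T=(V,A)$ with $n$ vertices, a function $t:V\to\mathbb{R}$, and a Lipschitz constant $\gamma\ge 0$, the $\gamma$-Lipschitz unimodal regression of $t$ on $T$ can be found in $O(n\log^3 n)$ time.
   Context: For $r\in V$, let $T^{(r)}$ be $T$ rooted at $r$ with every edge directed from child to parent, and let $s^{(r)}$ be the $\gamma$-Lipschitz isotonic regression of $t$ on $T^{(r)}$, i.e. the function $s:V\to\mathbb{R}$ minimizing $\sum_{v\in V}(s(v)-t(v))^2$ subject to $s(u)\le s(v)\le s(u)+\gamma$ whenever $u$ is a child of $v$ in $T^{(r)}$. Let $\xi^{(r)}=\sum_{v\in V}(s^{(r)}(v)-t(v))^2$ and $r^*=\arg\min_{r\in V}\xi^{(r)}$. The $\gamma$-Lipschitz unimodal regression of $t$ on $T$ is $s^{(r^* )}$. *)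

(* Defs.v *)
From HB Require Import structures.
From mathcomp Require Import all_boot all_order all_algebra.
From mathcomp Require Import all_classical all_reals all_analysis.

Set Implicit Arguments.
Unset Strict Implicit.
Unset Printing Implicit Defensive.

Import Order.TTheory GRing.Theory Num.Theory.

Local Open Scope ring_scope.

(** * Trees and regressions *)

Section Trees.
Variables (V : finType) (e : rel V).

Definition is_tree : Prop :=
  [/\ (0 < #|V|)%N,
      symmetric e /\ irreflexive e,
      forall u v, connect e u v &
      forall c : seq V, (2 < size c)%N -> ~~ ucycleb e c].

(** In the tree rooted at [r], the parent [v] of [u] is the vertex that follows
    [u] on the simple path from [u] to [r]. *)
Definition child (r u v : V) : Prop :=
  exists p : seq V,
    [/\ path e u (v :: p), uniq (u :: v :: p) & last v p = r].

(** [A] lists every edge exactly once, in one of its two orientations. *)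
Definition edge_list (A : seq (V * V)) : Prop :=
  [/\ forall u v, e u v = ((u, v) \in A) || ((v, u) \in A),
      uniq A &
      forall u v, (u, v) \in A -> (v, u) \notin A].

Section Regression.
Variables (R : realType) (gamma : R) (t : V -> R).

Definition sqerr (s : V -> R) : R := \sum_(v : V) (s v - t v) ^+ 2.

Definition lipschitz_isotonic (r : V) (s : V -> R) : Prop :=
  forall u v, child r u v -> s u <= s v /\ s v <= s u + gamma.

Definition lipschitz_isotonic_regression (r : V) (s : V -> R) : Prop :=
  lipschitz_isotonic r s /\
  forall s' : V -> R, lipschitz_isotonic r s' -> sqerr s <= sqerr s'.

(** [S r] is the regression for the root [r]; when several roots minimize the
    error, any of them may be taken as [rstar]. *)
Definition lipschitz_unimodal_regression (s : V -> R) : Prop :=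
  exists (S : V -> V -> R) (rstar : V),
    [/\ forall r, lipschitz_isotonic_regression r (S r),
        forall r, sqerr (S rstar) <= sqerr (S r) &
        forall v, s v = S rstar v].

End Regression.
End Trees.

(** * A real RAM

    The memory consists of arrays of natural numbers (words) and arrays of real
    numbers, each array being named by a constant of the program; a scalar
    variable is the cell of index 0 of an array.  Every operator, memory access,
    test and assignment costs 1.  Reals are exact and support the field
    operations and comparisons only: nothing converts a real to a word. *)

Inductive wexp : Type :=
| WConst of nat
| WGet of nat & wexp
| WAdd of wexp & wexp
| WSub of wexp & wexp
| WMul of wexp & wexp
| WDiv of wexp & wexp.

Inductive rexp : Type :=
| ROfW of wexp
| RGet of nat & wexp
| RAdd of rexp & rexp
| RSub of rexp & rexp
| RMul of rexp & rexp
| RDiv of rexp & rexp.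

Inductive test : Type :=
| WEq of wexp & wexp
| WLt of wexp & wexp
| REq of rexp & rexp
| RLt of rexp & rexp
| TNot of test
| TAnd of test & test.

Inductive cmd : Type :=
| Skip
| WSet of nat & wexp & wexp
| RSet of nat & wexp & rexp
| Seq of cmd & cmd
| If of test & cmd & cmd
| While of test & cmd.

Fixpoint wcost (x : wexp) : nat :=
  match x with
  | WConst _ => 1
  | WGet _ i => (wcost i).+1
  | WAdd x y | WSub x y | WMul x y | WDiv x y => (wcost x + wcost y).+1
  end%N.

Fixpoint rcost (x : rexp) : nat :=
  match x with
  | ROfW x => (wcost x).+1
  | RGet _ i => (wcost i).+1
  | RAdd x y | RSub x y | RMul x y | RDiv x y => (rcost x + rcost y).+1
  end%N.

Fixpoint tcost (b : test) : nat :=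
  match b with
  | WEq x y | WLt x y => (wcost x + wcost y).+1
  | REq x y | RLt x y => (rcost x + rcost y).+1
  | TNot b => (tcost b).+1
  | TAnd b c => (tcost b + tcost c).+1
  end%N.

Section Semantics.
Variable R : realType.

Record state : Type := State {
  words : nat -> nat -> nat;
  reals : nat -> nat -> R
}.

Definition upd (T : Type) (m : nat -> nat -> T) (a i : nat) (x : T) :
    nat -> nat -> T :=
  fun b j => if (b == a) && (j == i) then x else m b j.

(** Words, and therefore addresses, must stay below [B]; an evaluation that
    produces a larger word is stuck. *)
Variable B : nat.

Definition word (x : nat) : option nat := if (x < B)%N then Some x else None.

Definition lift2 (S T U : Type) (f : S -> T -> U) (x : option S)
    (y : option T) : option U :=
  obind (fun a => omap (f a) y) x.

Fixpoint weval (st : state) (x : wexp) : option nat :=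
  match x with
  | WConst k => word k
  | WGet a i => obind (fun j => word (words st a j)) (weval st i)
  | WAdd x y => obind word (lift2 addn (weval st x) (weval st y))
  | WSub x y => obind word (lift2 subn (weval st x) (weval st y))
  | WMul x y => obind word (lift2 muln (weval st x) (weval st y))
  | WDiv x y => obind word (lift2 divn (weval st x) (weval st y))
  end.

(** As in the field [R], [x / 0 = 0]. *)
Fixpoint reval (st : state) (x : rexp) : option R :=
  match x with
  | ROfW x => omap (fun k => k%:R) (weval st x)
  | RGet a i => omap (reals st a) (weval st i)
  | RAdd x y => lift2 (fun a b => a + b) (reval st x) (reval st y)
  | RSub x y => lift2 (fun a b => a - b) (reval st x) (reval st y)
  | RMul x y => lift2 (fun a b => a * b) (reval st x) (reval st y)
  | RDiv x y => lift2 (fun a b => a / b) (reval st x) (reval st y)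
  end.

Fixpoint teval (st : state) (b : test) : option bool :=
  match b with
  | WEq x y => lift2 (fun a b => a == b) (weval st x) (weval st y)
  | WLt x y => lift2 ltn (weval st x) (weval st y)
  | REq x y => lift2 (fun a b => a == b) (reval st x) (reval st y)
  | RLt x y => lift2 (fun a b => a < b) (reval st x) (reval st y)
  | TNot b => omap negb (teval st b)
  | TAnd b c => lift2 andb (teval st b) (teval st c)
  end.

(** [exec st c k st']: run from [st], [c] halts in [st'] at cost [k]. *)
Inductive exec : state -> cmd -> nat -> state -> Prop :=
| exec_skip st : exec st Skip 1 st
| exec_wset st a i x j y :
    weval st i = Some j -> weval st x = Some y ->
    exec st (WSet a i x) (wcost i + wcost x).+1
         (State (upd (words st) a j y) (reals st))
| exec_rset st a i x j y :
    weval st i = Some j -> reval st x = Some y ->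
    exec st (RSet a i x) (wcost i + rcost x).+1
         (State (words st) (upd (reals st) a j y))
| exec_seq st st1 st2 c d k l :
    exec st c k st1 -> exec st1 d l st2 -> exec st (Seq c d) (k + l) st2
| exec_if st st' b c d v k :
    teval st b = Some v -> exec st (if v then c else d) k st' ->
    exec st (If b c d) (tcost b + k).+1 st'
| exec_while_false st b c :
    teval st b = Some false -> exec st (While b c) (tcost b).+1 st
| exec_while_true st st1 st2 b c k l :
    teval st b = Some true -> exec st c k st1 ->
    exec st1 (While b c) l st2 ->
    exec st (While b c) (tcost b + k + l).+1 st2.

End Semantics.

(** * Input and output conventions *)

(** Word array 0 holds [n] at index 0; the [j]-th edge is the pair of the
    [j]-th entries of word arrays 1 and 2.  Real array 0 holds [gamma] at
    index 0, real array 1 holds [t].  All other cells are 0. *)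
Definition input (R : realType) (n : nat) (A : seq ('I_n * 'I_n)) (gamma : R)
    (t : 'I_n -> R) : state R :=
  State
    (fun a j => match a with
       | 0 => if j == 0 then n else 0
       | 1 => nth 0 [seq val p.1 | p <- A] j
       | 2 => nth 0 [seq val p.2 | p <- A] j
       | _ => 0
       end%N)
    (fun a j => match a with
       | 0%N => if j == 0%N then gamma else 0
       | 1%N => if insub j is Some v then t v else 0
       | _ => 0
       end).

(** The result is read in real array 2. *)
Definition output (R : realType) (n : nat) (st : state R) : 'I_n -> R :=
  fun v => reals st 2 v.

(** [c] finds the regression within [T n] steps on every instance with [n]
    vertices, using words of O(log n) bits: they are less than [(n + 2) ^ w]
    for a fixed [w]. *)
Definition finds_lipschitz_unimodal_regression (R : realType) (c : cmd)
    (T : nat -> nat) : Prop :=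
  exists w : nat,
  forall (n : nat) (e : rel 'I_n) (A : seq ('I_n * 'I_n)) (t : 'I_n -> R)
    (gamma : R),
    is_tree e -> edge_list e A -> 0 <= gamma ->
    exists (k : nat) (st : state R),
      [/\ exec (n.+2 ^ w)%N (input A gamma t) c k st,
          (k <= T n)%N &
          lipschitz_unimodal_regression e gamma t (output st)].

(* Main.v *)
(** Rooted anywhere, the best cost of the branch hanging from [v], as a function
    of the value [x] at the parent of [v], is convex and piecewise quadratic; it
    arises from the sum of the costs of the children of [v] and [(x - t v)^2] by
    replacing [x] by the point of [[x - gamma, x]] closest to the minimizer [m].
    Half the derivative [g] of that sum is increasing and piecewise linear; on
    [g] the step adds two breakpoints and translates by [gamma] those above [m].
    A message is stored as the quadratic valid left of all breakpoints and a list
    of balanced trees of breakpoints with lazy shifts.  The zero of [g] over a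
    list of [O(log n)] trees takes [O(log n)] rounds, each evaluating [g] at a
    weighted median of the tree roots, a root weighing 2 to the height of its
    tree: [O(log^3 n)] in all.

    A first pass computes the messages towards vertex 0, inserting smaller lists
    of breakpoints into larger ones.  A second pass computes the costs of all
    other roots, moving the root from [u] to a child [v]: [v] needs the message
    of [u] without [v].  If [v] is not the largest child of [u], it is obtained by
    cancelling the breakpoints of [v] in those of [u], next to the list coming
    from above, which grows by one tree; this happens [O(log n)] times on a path,
    as the subtree at least halves.  For the largest child, the breakpoints of
    its siblings are inserted into the list from above instead.  Finally the tree
    is rebuilt at the best root and the values are assigned from the root down.

    The algorithm is written in a small functional language whose cost counts
    calls, compiled to a stack machine that a loop of the RAM interprets. *)

Require Import Defs.
From mathcomp Require Import all_boot all_order all_algebra.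
From mathcomp Require Import all_classical all_reals all_analysis.
Import Order.TTheory GRing.Theory Num.Theory.
From mathcomp Require Import zify ring lra.
From Stdlib Require Import Btauto.

Set Implicit Arguments.
Unset Strict Implicit.
Unset Printing Implicit Defensive.

(** * Messages *)

(** A message is a signed sum: a base quadratic plus [c * (x - p)^2] on [x > p] for each event
    [(p, c)]. Such sums can be added and subtracted freely, so a branch is removed by inserting its
    events negated; nothing has to be located for deletion, and a single tree need not describe a
    convex function. Only the total half derivative increases, and the search uses nothing but its
    sign. Clamping acts where the half derivative vanishes, so it changes slopes without creating a
    jump and leaves the base alone. The moments summed during a search also give the cost of the
    root.

    The second pass needs branches as they were before their parents absorbed them. Data that are
    never overwritten provide this, hence the functional language; its memory grows with its time,
    so addresses stay polynomial in [n]. Two potentials carry the time bound: [x * log x] pays for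
    the insertions of both passes, and the logarithm of the subtree size pays for the growth of the
    list. Negated events accumulate, but the trees stay of size [O(n^2)], which costs only a
    constant factor in the heights. *)

Section Messages.
Import numFieldNormedType.Exports.
Variables (R : realType) (gamma : R).
Hypothesis gamma_ge0 : (0 <= gamma)%R.
Local Open Scope ring_scope.

(** The point of [[x - gamma, x]] closest to [m]. *)
Definition clamp (m x : R) : R := Num.max (x - gamma) (Num.min m x).

Variant clamp_spec (m x : R) : R -> Prop :=
| ClampR of x <= m : clamp_spec m x x
| ClampM of m <= x & x <= m + gamma : clamp_spec m x m
| ClampL of m + gamma <= x : clamp_spec m x (x - gamma).

Lemma clampP m x : clamp_spec m x (clamp m x).
Proof.
have g0 := gamma_ge0; rewrite /clamp; case: (lerP x m) => h1.
  by rewrite max_r ?gerBl //; constructor.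
case: (lerP (x - gamma) m) => h2; constructor; lra.
Qed.

Lemma clamp_itv m x : x - gamma <= clamp m x <= x.
Proof. have g0 := gamma_ge0; case: clampP => *; apply/andP; split; lra. Qed.

(** [g] is half the derivative of the convex function [f]. *)
Record message (f g : R -> R) : Prop := Message {
  tangent : forall x y, f x + 2 * g x * (y - x) <= f y;
  lipschitz : exists L, forall x y, x <= y -> g y - g x <= L * (y - x) }.

Lemma message0 : message (fun _ => 0) (fun _ => 0).
Proof.
split; first by move=> x y; rewrite mulr0 mul0r addr0.
by exists 0 => x y _; rewrite subrr mul0r.
Qed.

Lemma messageD f g f' g' : message f g -> message f' g' ->
  message (fun x => f x + f' x) (fun x => g x + g' x).
Proof.
move=> [T [L HL]] [T' [L' HL']]; split.
  by move=> x y; have := T x y; have := T' x y; lra.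
by exists (L + L') => x y xy; have := HL _ _ xy; have := HL' _ _ xy; lra.
Qed.

(** Adding the tangent inequalities at [x] and at [y] gives [0 <= (g y - g x) * (y - x)]. *)
Lemma message_mono f g x y : message f g -> x <= y -> g x <= g y.
Proof.
move=> [T _]; rewrite le_eqVlt => /predU1P[->//|xy].
have := T x y; have := T y x; have xy' : 0 < y - x by lra.
move=> h1 h2.
have : 0 <= (g y - g x) * (y - x) by lra.
by rewrite pmulr_lge0 //; lra.
Qed.

Definition node (t : R) (s : (R -> R) * (R -> R)) : (R -> R) * (R -> R) :=
  (fun x => (x - t) ^+ 2 + s.1 x, fun x => (x - t) + s.2 x).

Lemma message_square t : message (fun x => (x - t) ^+ 2) (fun x => x - t).
Proof.
split; first by move=> x y; have := sqr_ge0 (x - y); lra.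
by exists 1 => x y _; lra.
Qed.

Lemma message_node t s : message s.1 s.2 -> message (node t s).1 (node t s).2.
Proof. exact: messageD (message_square t). Qed.

Lemma node_incr t s x y : message s.1 s.2 -> x <= y ->
  y - x <= (node t s).2 y - (node t s).2 x.
Proof. by move=> H xy; have := message_mono H xy; rewrite /node /=; lra. Qed.

(** The square makes the half derivative grow at rate at least 1, so it changes sign between
    [- |g 0|] and [|g 0|]; the Lipschitz bound supplies the continuity for the intermediate value
    theorem. *)
Lemma node_zero t s : message s.1 s.2 -> exists m, (node t s).2 m = 0.
Proof.
move=> H; set g := (node t s).2.
have [T [L HL]] := message_node t H.
have inc x y : x <= y -> y - x <= g y - g x by exact: node_incr.
have gc : continuous g.
  move=> x; apply/cvgrPdist_lt => e e0.
  have L0 : 0 < `|L| + 1 by have := normr_ge0 L; lra.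
  near=> y.
  have yx : `|x - y| < e / (`|L| + 1).
    by near: y; exists (e / (`|L| + 1)) => //=; exact: divr_gt0.
  have b u v : u <= v -> `|g u - g v| <= (`|L| + 1) * `|u - v|.
    move=> uv; have := HL _ _ uv; rewrite -/g => h; have h' := inc _ _ uv.
    have -> : `|g u - g v| = - (g u - g v) by rewrite ler0_norm //; lra.
    have -> : `|u - v| = - (u - v) by rewrite ler0_norm //; lra.
    have : L * (v - u) <= (`|L| + 1) * (v - u).
      by apply: ler_wpM2r; [lra|have := ler_norm L; lra].
    by lra.
  have bb : `|g x - g y| <= (`|L| + 1) * `|x - y|.
    have [xy|/ltW yx'] := leP x y; first exact: b.
    by rewrite distrC (distrC x); exact: b.
  by apply: le_lt_trans bb _; rewrite mulrC -ltr_pdivlMr.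
pose a := - `|g 0|; pose b := `|g 0|.
have n0 := normr_ge0 (g 0).
have ab : a <= b by rewrite /a /b; lra.
have ga : g a <= 0.
  have := inc a 0; rewrite /a; have := ler_norm (g 0); lra.
have gb : 0 <= g b.
  have := inc 0 b; rewrite /b; have := ler_norm (- g 0); rewrite normrN; lra.
have [||c _ gc0] := @IVT R g a b 0 ab.
- exact: continuous_subspaceT.
- by rewrite ge_min le_max ga gb orbT.
- by exists c.
Unshelve. all: by end_near.
Qed.

Lemma message_min f g m y : message f g -> g m = 0 -> f m <= f y.
Proof. by move=> [T _] gm; have := T m y; rewrite gm; lra. Qed.

Lemma message_sign f g m x : message f g -> g m = 0 ->
  (x <= m -> g x <= 0) /\ (m <= x -> 0 <= g x).
Proof. by move=> H gm; split=> /(message_mono H); rewrite gm. Qed.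

(** Where [clamp m] moves it has slope 1, and where it is constant [g] vanishes at its value [m]; so
    composing [g] with [clamp m] gives half the derivative again, without a factor. *)
Lemma message_clamp f g m : message f g -> g m = 0 ->
  message (fun x => f (clamp m x)) (fun x => g (clamp m x)).
Proof.
have g0 := gamma_ge0; move=> H gm; have [T [L HL]] := H; split.
  move=> x y; apply: le_trans (T (clamp m x) (clamp m y)).
  suff : 0 <= g (clamp m x) * ((clamp m y - clamp m x) - (y - x)) by lra.
  have /andP[y1 y2] := clamp_itv m y.
  case: (clampP m x) => [h|h1 h2|h].
  - by apply: mulr_le0; [exact: (message_sign x H gm).1|lra].
  - by rewrite gm mul0r.
  - by apply: mulr_ge0; [apply: (message_sign _ H gm).2; lra|lra].
exists `|L| => x y xy.
have /andP[c1 c2] : 0 <= clamp m y - clamp m x <= y - x.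
  by case: (clampP m x); case: (clampP m y) => *; apply/andP; split; lra.
apply: le_trans (HL _ _ _) _; first by lra.
apply: le_trans (_ : `|L| * (clamp m y - clamp m x) <= _).
  by apply: ler_wpM2r => //; exact: ler_norm.
by apply: ler_wpM2l.
Qed.

(** [[x - gamma, x]] is the range that the constraint leaves to a child whose parent has value
    [x]. *)
Lemma clamp_min f g m x y : message f g -> g m = 0 ->
  x - gamma <= y <= x -> f (clamp m x) <= f y.
Proof.
have g0 := gamma_ge0; move=> H gm /andP[h1 h2]; have [T _] := H.
apply: le_trans (T (clamp m x) y).
suff : 0 <= g (clamp m x) * (y - clamp m x) by lra.
case: (clampP m x) => [h|h3 h4|h].
- by apply: mulr_le0; [exact: (message_sign x H gm).1|lra].
- by rewrite gm mul0r.
- by apply: mulr_ge0; [apply: (message_sign _ H gm).2; lra|lra].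
Qed.

(** A choice only in form: for a [node] the zero exists and is unique, as the half derivative is
    strictly increasing. *)
Definition root_of (g : R -> R) : R := xget 0 [set m | g m = 0].

Lemma node_root t s : message s.1 s.2 ->
  (node t s).2 (root_of (node t s).2) = 0.
Proof.
move=> /(node_zero t) [m gm].
by apply: (xgetPex 0 (P := [set m | (node t s).2 m = 0])); exists m.
Qed.

(** A forest, in first-child/next-sibling form: [FN v kids siblings]. *)
Inductive forest := FE | FN of nat & forest & forest.

Variable t : nat -> R.

(** The least cost of the trees of [F] as a function of the value at their common parent, paired
    with half its derivative; [sem_le] and [assign_ok] are the two halves of the claim about the
    cost. *)
Fixpoint sem (F : forest) : (R -> R) * (R -> R) :=
  match F with
  | FE => (fun _ => 0, fun _ => 0)
  | FN v K Z =>
      let n := node (t v) (sem K) in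
      (fun x => n.1 (clamp (root_of n.2) x) + (sem Z).1 x,
       fun x => n.2 (clamp (root_of n.2) x) + (sem Z).2 x)
  end.

Fixpoint verts (F : forest) : seq nat :=
  if F is FN v K Z then v :: verts K ++ verts Z else [::].

Fixpoint admissible (F : forest) (x : R) (s : nat -> R) : Prop :=
  if F is FN v K Z then
    [/\ s v <= x <= s v + gamma, admissible K (s v) s & admissible Z x s]
  else True.

Definition sqcost (F : forest) (s : nat -> R) : R :=
  \sum_(v <- verts F) (s v - t v) ^+ 2.

Fixpoint assign (F : forest) (x : R) : seq (nat * R) :=
  if F is FN v K Z then
    let y := clamp (root_of (node (t v) (sem K)).2) x in
    (v, y) :: assign K y ++ assign Z x
  else [::].

Lemma message_sem F : message (sem F).1 (sem F).2.
Proof.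
elim: F => [|v K IHK Z IHZ]; first exact: message0.
apply: messageD IHZ; apply: message_clamp; first exact: message_node.
exact: node_root.
Qed.

Lemma sqcost_FN v K Z s :
  sqcost (FN v K Z) s = (s v - t v) ^+ 2 + sqcost K s + sqcost Z s.
Proof. by rewrite /sqcost /= big_cons big_cat /= addrA. Qed.

Lemma sem_le F x s : admissible F x s -> (sem F).1 x <= sqcost F s.
Proof.
elim: F x => [|v K IHK Z IHZ] x; first by rewrite /sqcost big_nil.
case=> /andP[h1 h2] aK aZ; rewrite sqcost_FN.
apply: lerD (IHZ _ aZ).
apply: le_trans (_ : (node (t v) (sem K)).1 (s v) <= _).
  apply: clamp_min (message_node _ (message_sem K)) (node_root _ (message_sem K)) _.
  by apply/andP; split; lra.
by rewrite /node /= lerD2l; exact: IHK.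
Qed.

Lemma assign_ok F x s : (forall p, p \in assign F x -> s p.1 = p.2) ->
  admissible F x s /\ sqcost F s = (sem F).1 x.
Proof.
elim: F x => [|v K IHK Z IHZ] x.
  by rewrite /sqcost big_nil.
set y := clamp (root_of (node (t v) (sem K)).2) x => H.
have sv : s v = y by apply: (H (v, y)); rewrite inE eqxx.
have [|aK cK] := IHK y.
  by move=> p pK; apply: H; rewrite inE mem_cat pK orbT.
have [|aZ cZ] := IHZ x.
  by move=> p pK; apply: H; rewrite inE mem_cat pK !orbT.
split; last by rewrite sqcost_FN cK cZ sv.
split=> //; rewrite sv //.
by have /andP[h1 h2] := clamp_itv (root_of (node (t v) (sem K)).2) x;
  apply/andP; split; rewrite /y; lra.
Qed.

Lemma unzip1_assign F x : unzip1 (assign F x) = verts F.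
Proof.
elim: F x => //= v K IHK Z IHZ x.
by rewrite /unzip1 map_cat -!/(unzip1 _) IHK IHZ.
Qed.

Definition rnode r K := node (t r) (sem K).
(** No constraint acts on the root from above, so it takes the minimizer itself, unclamped. *)
Definition ropt r K : R := root_of (rnode r K).2.
Definition rval r K : R := (rnode r K).1 (ropt r K).

Lemma ropt_zero r K : (rnode r K).2 (ropt r K) = 0.
Proof. exact: node_root (message_sem K). Qed.

Lemma rval_le r K s : admissible K (s r) s ->
  rval r K <= (s r - t r) ^+ 2 + sqcost K s.
Proof.
move=> aK; apply: le_trans (_ : (rnode r K).1 (s r) <= _).
  apply: message_min (ropt_zero _ _); exact: message_node (message_sem K).
by rewrite /rnode /node /= lerD2l sem_le.
Qed.

Definition rassign r K := (r, ropt r K) :: assign K (ropt r K).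

Lemma rassign_ok r K s : (forall p, p \in rassign r K -> s p.1 = p.2) ->
  admissible K (s r) s /\ (s r - t r) ^+ 2 + sqcost K s = rval r K.
Proof.
move=> H; have sr : s r = ropt r K by apply: (H (r, _)); rewrite inE eqxx.
have [|aK cK] := @assign_ok K (ropt r K) s.
  by move=> p pK; apply: H; rewrite inE pK orbT.
by rewrite sr cK.
Qed.

End Messages.

(** * Rooted trees as forests *)

Fixpoint links (F : forest) (p : nat) : seq (nat * nat) :=
  if F is FN v K Z then (v, p) :: links K v ++ links Z p else [::].

Fixpoint fcat (F G : forest) : forest :=
  if F is FN v K Z then FN v K (fcat Z G) else G.

Lemma unzip1_links F p : unzip1 (links F p) = verts F.
Proof.
elim: F p => //= v K IHK Z IHZ p.
by rewrite /unzip1 map_cat -!/(unzip1 _) IHK IHZ.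
Qed.

Lemma verts_fcat F G : verts (fcat F G) = verts F ++ verts G.
Proof. by elim: F => //= v K _ Z ->; rewrite catA. Qed.

Lemma links_fcat F G p : links (fcat F G) p = links F p ++ links G p.
Proof. by elim: F => //= v K _ Z ->; rewrite catA. Qed.

Lemma links_parent F p u v : (u, v) \in links F p -> v \in p :: verts F.
Proof.
elim: F p => //= w K IHK Z IHZ p.
rewrite inE mem_cat => /or3P[/eqP[_ ->]|/IHK|/IHZ]; rewrite !inE ?eqxx //.
  by rewrite mem_cat => /orP[->|->]; rewrite ?orbT.
by rewrite mem_cat => /orP[->|->]; rewrite ?orbT.
Qed.

Lemma unzip1_inj (A B : eqType) (s : seq (A * B)) u v w : uniq (unzip1 s) ->
  (u, v) \in s -> (u, w) \in s -> v = w.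
Proof.
elim: s => //= -[a b] s IH /andP[/= na us].
rewrite !inE => /predU1P[e1|h1] /predU1P[e2|h2].
- by case: e1 e2 => -> -> [->].
- by case: e1 => e1 _; move/(map_f fst): h2; rewrite /= e1 (negPf na).
- by case: e2 => e2 _; move/(map_f fst): h1; rewrite /= e2 (negPf na).
- exact: IH.
Qed.

(** * Rooting an acyclic connected graph *)

Section Graph.
Variables (n : nat) (en : rel nat).
Hypothesis en_lt : forall u v, en u v -> u < n /\ v < n.
Hypothesis en_sym : symmetric en.
Hypothesis en_irr : irreflexive en.
Hypothesis en_acyclic :
  forall c : seq nat, 2 < size c -> cycle en c -> uniq c -> False.
Hypothesis en_connected : forall u v, u < n -> v < n ->
  exists2 q, path en u q & uniq (u :: q) /\ last u q = v.

Lemma first_in (T : Type) (a : pred T) (s : seq T) : has a s ->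
  exists s1 y s2, [/\ s = s1 ++ y :: s2, a y & ~~ has a s1].
Proof.
elim: s => //= x s IH; case ax : (a x) => /=.
  by move=> _; exists [::], x, s.
by case/IH => s1 [y [s2 [-> ay ns]]]; exists (x :: s1), y, s2; rewrite /= ax.
Qed.

(** Otherwise the first path up to its first vertex [y] on the second path, and the second path back
    from [y], close a cycle through [v]. *)
Lemma no_fork v w p w' q :
    path en v (w :: p) -> uniq (v :: w :: p) ->
    path en v (w' :: q) -> uniq (v :: w' :: q) ->
    last w p = last w' q -> w = w'.
Proof.
move=> Pp Up Pq Uq El; apply/eqP; apply: contraT => ne.
have : has (mem (w' :: q)) (w :: p).
  by apply/hasP; exists (last w p); [exact: mem_last|rewrite /= El mem_last].
case/first_in => s1 [y [s2 [E1 yq n1]]].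
have /splitPr : y \in w' :: q by [].
case E2 : _ / => [q1 q2].
exfalso; apply: (@en_acyclic (v :: s1 ++ y :: rev q1)).
- case: s1 E1 n1 => [|a s1] E1 n1 /=; last by rewrite size_cat /= addnS.
  case: q1 E2 => [|b q1] E2 /=; last by rewrite size_rev.
  by move: E1 E2 => [e1 _] [e2 _]; rewrite e1 e2 eqxx in ne.
- move: Pp Pq; rewrite E1 E2 /= !cat_path /= => /and3P[a1 a2 _] /and3P[b1 b2 _].
  rewrite rcons_cat /= cat_path /= a1 a2 /=.
  have : path en v (rcons q1 y) by rewrite rcons_path b1 b2.
  have := rev_path en v (rcons q1 y).
  rewrite last_rcons belast_rcons rev_cons => -> h.
  by rewrite (@eq_path _ _ en) // => x z; exact: en_sym.
- move: Up Uq; rewrite E1 E2 /= !cat_uniq /= mem_cat !inE.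
  case/and4P; rewrite negb_or => /andP[v1 /norP[vy _]] u1 /norP[y1 _] _.
  rewrite mem_cat => /andP[/norP[v2 _]] /and3P[u2 /norP[y2 _] _].
  rewrite mem_cat !inE mem_rev !negb_or v1 vy v2 u1 rev_uniq u2 mem_rev y1 y2.
  rewrite /= andbT; apply/hasPn => x; rewrite mem_rev => xq.
  apply/negP => x1; move/hasPn: n1 => /(_ x x1); rewrite /= E2 mem_cat xq.
  by [].
Qed.

(** [tau] is the path from [v] up to the root and [head v tau] the parent. Any other neighbour on
    that path would close a cycle. *)
Lemma step_fresh v tau w : path en v tau -> uniq (v :: tau) -> en v w ->
  w != head v tau -> w \notin v :: tau.
Proof.
move=> P U vw ng; rewrite inE negb_or.
have -> /= : w != v by apply: contraL vw => /eqP ->; rewrite en_irr.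
apply/negP => /splitPr; case E : _ / => [t1 t2].
move: P ng; rewrite {1 2}E cat_path /= => /and3P[p1 p2 _] ng; rewrite E in U.
apply: (@en_acyclic (v :: rcons t1 w)).
- by case: t1 E ng {p1 p2 U} => [|a t1] E /=; rewrite ?eqxx // size_rcons.
- by rewrite /= !rcons_path p1 p2 last_rcons en_sym.
- move: U; rewrite -cat_rcons -cat_cons cat_uniq.
  by case/andP.
Qed.

Variable adj : nat -> seq nat.
Hypothesis adjP : forall u v, (v \in adj u) = en u v.
Hypothesis adj_uniq : forall u, uniq (adj u).

(** [F] lists the subtrees hanging from [v] through its neighbours in [ns],
    its own parent [g] excepted. *)
Inductive built : seq nat -> nat -> nat -> forest -> Prop :=
| built_nil v g : built [::] v g FE
| built_skip ns v g F : built ns v g F -> built (g :: ns) v g F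
| built_node w ns v g K Z :
    w != g -> built (adj w) w v K -> built ns v g Z ->
    built (w :: ns) v g (FN w K Z).

(** The ancestors [tau] form a simple path, so [n - size tau] decreases. The root counts as its own
    parent, which excludes no neighbour because the graph has no loops. *)
Lemma built_ex v tau : v < n -> path en v tau -> uniq (v :: tau) ->
  exists K, built (adj v) v (head v tau) K.
Proof.
have szle v' t : v' < n -> path en v' t -> uniq (v' :: t) -> size (v' :: t) <= n.
  move=> vn P U; rewrite -(size_iota 0 n); apply: uniq_leq_size => // x.
  rewrite mem_iota inE => /predU1P[->//|].
  elim: t v' vn P {U} => //= a t IH v' _ /andP[/en_lt[_ an] P].
  by rewrite inE => /predU1P[->//|]; exact: IH an P.
have [m] := ubnP (n - size tau); elim: m v tau => // m IH v tau lm vn P U.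
have : {subset adj v <= adj v} by [].
elim: {1 3}(adj v) => [|w ns IHns] sub; first by exists FE; constructor.
have [|Z bZ] := IHns; first by move=> x xn; apply: sub; rewrite inE xn orbT.
have [->|ng] := eqVneq w (head v tau); first by exists Z; constructor.
have vw : en v w by rewrite -adjP sub // inE eqxx.
have fr := step_fresh P U vw ng.
have [_ wn] := en_lt vw.
have P' : path en w (v :: tau) by rewrite /= en_sym vw.
have U' : uniq [:: w, v & tau] by rewrite cons_uniq fr.
have [|K bK] := IH w (v :: tau) _ wn P' U'.
  by have := szle _ _ wn P' U'; rewrite /= in lm *; lia.
by exists (FN w K Z); constructor.
Qed.

Lemma built_path ns v g F tau : built ns v g F -> {subset ns <= adj v} ->
    path en v tau -> uniq (v :: tau) -> g = head v tau ->
  forall u, u \in verts F -> exists w q,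
    [/\ w \in ns, path en v (w :: q), uniq ((w :: q) ++ v :: tau)
      & last w q = u].
Proof.
move=> b; elim: b tau => {ns v g F}
  [//|ns v g F b IH|w ns v g K Z ng bK IHK bZ IHZ] tau sub P U gE u.
  move=> uF; have [|w [q [wn Pw Uw Ew]]] := IH tau _ P U gE u uF.
    by move=> x xn; apply: sub; rewrite inE xn orbT.
  by exists w, q; rewrite inE wn orbT.
have vw : en v w by rewrite -adjP sub // inE eqxx.
have fr : w \notin v :: tau by apply: step_fresh => //; rewrite -gE.
rewrite /= inE mem_cat => /or3P[/eqP ->|uK|uZ].
- exists w, [::]; rewrite inE eqxx /= vw; split=> //.
  by rewrite fr; exact: U.
- have [||||w' [q [wn Pw Uw Ew]]] := IHK (v :: tau) _ _ _ _ u uK.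
  + by [].
  + by rewrite /= en_sym vw.
  + by rewrite cons_uniq fr.
  + by [].
  exists w, (w' :: q); split=> //; [by rewrite inE eqxx|by rewrite /= vw|].
  have E2 : uniq ((w :: w' :: q) ++ v :: tau) =
            uniq ((w' :: q) ++ [:: w, v & tau]).
    by apply: perm_uniq; rewrite perm_sym -[w :: v :: tau]cat1s perm_catCA.
  by rewrite -E2 in Uw; exact: Uw.
- have [|w' [q [wn Pw Uw Ew]]] := IHZ tau _ P U gE u uZ.
    by move=> x xn; apply: sub; rewrite inE xn orbT.
  by exists w', q; rewrite inE wn orbT.
Qed.

(** [built_path] reaches each occurrence of a vertex by a simple path whose first step is the branch
    it lies in; [no_fork] then forbids occurrences in two branches. *)
Lemma built_uniq ns v g F tau : built ns v g F -> {subset ns <= adj v} ->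
    uniq ns -> path en v tau -> uniq (v :: tau) -> g = head v tau ->
  uniq (verts F) /\ v \notin verts F.
Proof.
move=> b sub un P U gE; split; last first.
  apply/negP => /(built_path b sub P U gE) [w [q [_ _]]].
  rewrite cat_uniq => /and3P[_ /hasPn h _] E.
  by have /negP := h v (mem_head _ _); apply; rewrite -E; exact: mem_last.
elim: b tau sub un P U gE => {ns v g F}
  [//|ns v g F b IH|w ns v g K Z ng bK IHK bZ IHZ] tau sub /= /andP[nn un] P U gE.
  by apply: IH P U gE => // x xn; apply: sub; rewrite inE xn orbT.
have sub' : {subset ns <= adj v}.
  by move=> x xn; apply: sub; rewrite inE xn orbT.
have vw : en v w by rewrite -adjP sub // inE eqxx.
have fr : w \notin v :: tau by apply: step_fresh => //; rewrite -gE.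
have P' : path en w (v :: tau) by rewrite /= en_sym vw.
have U' : uniq [:: w, v & tau] by rewrite cons_uniq fr.
have UK : uniq (verts K) by exact: IHK P' U' _.
have UZ : uniq (verts Z) by exact: IHZ P U gE.
have pK := built_path bK (fun _ h => h) P' U' erefl.
have pZ := built_path bZ sub' P U gE.
have uZ x w' q : uniq ((w' :: q) ++ x :: tau) -> uniq (x :: w' :: q).
  rewrite cat_uniq /= => /and3P[/andP[h1 h2] /norP[h3 _] _].
  by rewrite h3 h1 h2.
have wK : w \notin verts K.
  apply/negP => /pK [w' [q [_ _]]]; rewrite cat_uniq => /and3P[_ /hasPn h _] E.
  by have /negP := h w (mem_head _ _); apply; rewrite -E; exact: mem_last.
have wZ : w \notin verts Z.
  apply/negP => /pZ [w' [q [w'n Pq Uq E]]].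
  suff e : w = w' by rewrite e w'n in nn.
  apply: (@no_fork v w [::] w' q) => //=; first by rewrite vw.
    by move: fr; rewrite !inE negb_or eq_sym andbT => /andP[].
  exact: uZ Uq.
rewrite mem_cat negb_or wK wZ cat_uniq UK UZ /= andbT.
apply/hasPn => x xZ; apply/negP => xK.
have [w1 [q1 [_ P1 U1 E1]]] := pK x xK.
have [w2 [q2 [w2n P2 U2 E2]]] := pZ x xZ.
suff e : w = w2 by rewrite e w2n in nn.
apply: (@no_fork v w (w1 :: q1) w2 q2) => //.
- by rewrite /= vw.
- have -> : uniq [:: v, w, w1 & q1] = uniq ([:: w; v] ++ w1 :: q1).
    by apply: perm_uniq; apply/permPl; have := perm_catCA [:: v] [:: w] (w1 :: q1).
  rewrite uniq_catC; move: U1.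
  by rewrite -[[:: w, v & tau]]/([:: w; v] ++ tau) catA cat_uniq => /and3P[].
- exact: uZ U2.
- by rewrite /= E1 E2.
Qed.

Lemma built_sub ns v g F w : built ns v g F -> w \in ns -> w != g ->
  exists K, [/\ built (adj w) w v K, {subset w :: verts K <= verts F},
    (w, v) \in links F v & {subset links K w <= links F v}].
Proof.
elim=> {ns v g F} [//|ns v g F b IH|w0 ns v g K Z ng bK _ bZ IHZ].
  by rewrite inE => /predU1P[->|//]; rewrite eqxx.
rewrite inE => /predU1P[->|wn] ng'.
  exists K; split=> //= [x||x]; rewrite ?inE ?eqxx //.
    by rewrite mem_cat orbA => ->.
  by rewrite mem_cat => ->; rewrite orbT.
have [K' [bK' s1 l s2]] := IHZ wn ng'.
exists K'; split=> //= [x /s1 xZ||x /s2 xZ]; rewrite ?inE mem_cat.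
- by rewrite xZ !orbT.
- by rewrite l !orbT.
- by rewrite xZ !orbT.
Qed.

(** A simple path from [v] that avoids the parent can only descend. *)
Lemma built_cover v g K q : built (adj v) v g K -> path en v q ->
  uniq (v :: q) -> g \notin q -> last v q \in v :: verts K.
Proof.
elim: q v g K => [|w q IH] v g K b; first by rewrite mem_head.
rewrite [path _ _ _]/= => /andP[vw P] U; rewrite inE negb_or => /andP[gw gq].
have wa : w \in adj v by rewrite adjP.
have [|K' [b' s _ _]] := built_sub b wa; first by rewrite eq_sym.
rewrite /= inE; apply/orP; right; apply: s; apply: IH b' P _ _.
  by move: U => /= /andP[].
by move: U; rewrite /= inE negb_or => /andP[/andP[]].
Qed.

Lemma built_at ns v g F u : built ns v g F -> u \in verts F ->
  exists h K, [/\ built (adj u) u h K, (u, h) \in links F v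
                & {subset links K u <= links F v}].
Proof.
elim=> {ns v g F} [//|//|w ns v g K Z ng bK IHK bZ IHZ].
rewrite /= inE mem_cat => /or3P[/eqP ->|/IHK|/IHZ].
- exists v, K; rewrite inE eqxx; split=> // x xK.
  by rewrite inE mem_cat xK orbT.
- move=> [h [K' [b l s]]]; exists h, K'; split=> // [|x /s xK].
    by rewrite inE mem_cat l orbT.
  by rewrite inE mem_cat xK orbT.
- move=> [h [K' [b l s]]]; exists h, K'; split=> // [|x /s xK].
    by rewrite inE mem_cat l !orbT.
  by rewrite inE mem_cat xK !orbT.
Qed.

Definition rooted (r : nat) (K : forest) : Prop :=
  perm_eq (r :: verts K) (iota 0 n) /\
  forall u v, en u v = ((u, v) \in links K r) || ((v, u) \in links K r).

Lemma links_en ns v g F x : built ns v g F -> {subset ns <= adj v} ->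
  x \in links F v -> en x.1 x.2.
Proof.
elim=> {ns v g F} [//|ns v g F b IH|w ns v g K Z ng bK IHK bZ IHZ] sub.
  by apply: IH => y yn; apply: sub; rewrite inE yn orbT.
rewrite /= inE mem_cat => /or3P[/eqP ->|xK|xZ].
- by rewrite en_sym -adjP sub // inE eqxx.
- exact: IHK.
- by apply: IHZ => // y yn; apply: sub; rewrite inE yn orbT.
Qed.

Lemma built_rooted r K : r < n -> built (adj r) r r K -> rooted r K.
Proof.
move=> rn b.
have [U rK] := built_uniq b (fun _ h => h) (adj_uniq r) (isT : path en r [::])
  isT erefl.
have cov u : u < n -> u \in r :: verts K.
  move=> un; have [q P [Uq <-]] := en_connected rn un.
  by apply: (built_cover b P Uq); case/andP: Uq.
have lt u : u \in r :: verts K -> u < n.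
  rewrite inE => /predU1P[->//|/(built_at b) [h [K' [_ /(links_en b)]]]].
  by move=> /(_ (fun _ h => h)) /en_lt [].
split.
  apply: uniq_perm; [by rewrite /= rK|exact: iota_uniq|].
  move=> u; rewrite mem_iota /=; apply/idP/idP; [exact: lt|exact: cov].
move=> u v; apply/idP/idP; last first.
  by case/orP => /(links_en b (fun _ h => h)) //=; rewrite en_sym.
move=> uv; have [un _] := en_lt uv.
have va : v \in adj u by rewrite adjP.
have := cov u un; rewrite inE => /predU1P[e|].
  rewrite e in uv va.
  have [|K' [_ _ l _]] := built_sub b va; last by rewrite e l orbT.
  by apply: contraL uv => /eqP ->; rewrite en_irr.
move=> /(built_at b) [h [K' [b' l s]]].
have [->|vh] := eqVneq v h; first by rewrite l.
by have [K2 [_ _ /s l2 _]] := built_sub b' va vh; rewrite l2 orbT.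
Qed.

Lemma rooted_ex r : r < n -> exists2 K, built (adj r) r r K & rooted r K.
Proof.
move=> rn; have [K b] := @built_ex r [::] rn isT isT.
by exists K => //; exact: built_rooted.
Qed.

End Graph.

(** * Rooted forests: moving the root, and paths *)

Section Rooted.
Variables (n : nat) (en : rel nat).
Hypothesis en_irr : irreflexive en.

(** [pre] and [Z] are the siblings of [v], and [C] hangs at [u] on the side of the former root; all
    of this becomes one new subtree of [v], with [u] on top. *)
Lemma reroot u pre v K Z C :
    rooted n en u (fcat pre (fcat (FN v K Z) C)) ->
  rooted n en v (fcat K (FN u (fcat pre (fcat Z C)) FE)).
Proof.
rewrite /rooted !verts_fcat /= !verts_fcat => -[Pv E]; split.
  apply: perm_trans Pv; apply/permP => a.
  by rewrite /= !(count_cat, verts_fcat) /= !(count_cat, verts_fcat) /=; lia.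
move=> x y; rewrite E !links_fcat /= !links_fcat !(mem_cat, inE) !xpair_eqE.
by btauto.
Qed.

Lemma rooted_uniq r K : rooted n en r K -> uniq (r :: verts K).
Proof. by case=> /perm_uniq ->; rewrite iota_uniq. Qed.

Lemma rooted_lt r K v : rooted n en r K -> v \in r :: verts K -> v < n.
Proof. by case=> /perm_mem -> _; rewrite mem_iota. Qed.

Lemma ancestor_path F p u v : uniq (p :: verts F) -> (u, v) \in links F p ->
  exists q, [/\ path (fun x y => (x, y) \in links F p) u (v :: q),
    uniq (u :: v :: q), last v q = p & {subset u :: v :: q <= p :: verts F}].
Proof.
elim: F p u v => // w K IHK Z IHZ p u v U.
have [UK UZ] : uniq (w :: verts K) /\ uniq (p :: verts Z).
  move: U => /= /andP[]; rewrite inE mem_cat !negb_or => /and3P[_ _ ->].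
  by rewrite cat_uniq mem_cat negb_or => /and4P[/andP[-> _] -> _ ->].
rewrite [links _ _]/= inE mem_cat => /or3P[/eqP[-> ->]|uK|uZ].
- exists [::]; split=> //=.
  + by rewrite inE eqxx.
  + by move: U => /= /andP[]; rewrite inE eq_sym !inE negb_or => /andP[->].
  + by move=> x; rewrite !inE => /orP[->|->]; rewrite ?orbT.
- have [q [P Uq L s]] := IHK w u v UK uK.
  have pK : p \notin w :: verts K.
    move: U => /= /andP[]; rewrite !inE mem_cat !negb_or.
    by move=> /and3P[-> -> _].
  exists (rcons q p); split.
  + rewrite -rcons_cons rcons_path; apply/andP; split.
      by apply: sub_path P => x y xy; rewrite inE mem_cat xy orbT.
    by rewrite /= L inE eqxx.
  + rewrite -!rcons_cons rcons_uniq Uq andbT.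
    by apply: contra pK => /s.
  + by rewrite last_rcons.
  + move=> x; rewrite -!rcons_cons mem_rcons inE => /predU1P[->|/s].
      by rewrite inE eqxx.
    by rewrite !inE mem_cat => /orP[->|->]; rewrite ?orbT.
- have [q [P Uq L s]] := IHZ p u v UZ uZ; exists q; split=> //.
    by apply: sub_path P => x y xy; rewrite inE mem_cat xy !orbT.
  by move=> x /s; rewrite !inE mem_cat => /orP[->|->]; rewrite ?orbT.
Qed.

Lemma links_fst F p u v : (u, v) \in links F p -> u \in verts F.
Proof. by move/(map_f fst); rewrite -/(unzip1 _) unzip1_links. Qed.

(** After a step from parent to child, the only step up leads back to the vertex just left, so a
    simple path keeps descending and never ends at the root. *)
Lemma no_return r K u v p : rooted n en r K -> path en u (v :: p) ->
  uniq (u :: v :: p) -> (v, u) \in links K r -> last v p != r.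
Proof.
move=> rK; have U := rooted_uniq rK.
elim: p u v => [|w p IH] u v.
  move=> _ _ /links_fst vK; apply: contraTneq U => <-.
  by rewrite /= vK.
rewrite [path _ _ _]/= => /and3P[uv vw P] Uq vu.
have := vw; rewrite rK.2 => /orP[vw'|wv].
  have e : u = w.
    by apply: unzip1_inj vu vw'; rewrite unzip1_links; case/andP: U.
  by move: Uq; rewrite e /= !inE eqxx orbT.
by apply: IH wv; rewrite ?[path _ _ _]/= ?vw //; case/andP: Uq.
Qed.

(** Sending an edge to its lower endpoint is injective. The input does not state the number of
    edges; by this bound the first [n] slots of the edge arrays contain them all. *)
Lemma size_edges (A : seq (nat * nat)) r K : rooted n en r K -> uniq A ->
    (forall u v, (u, v) \in A -> (v, u) \notin A) ->
    (forall u v, (u, v) \in A -> en u v) -> size A <= n.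
Proof.
move=> rK UA asymA Aen; have U := rooted_uniq rK.
pose f (x : nat * nat) := if x \in links K r then x.1 else x.2.
have UL : uniq (unzip1 (links K r)) by rewrite unzip1_links; case/andP: U.
have fL x : x \in A -> (f x, if x \in links K r then x.2 else x.1) \in links K r.
  case: x => a b xA; have := Aen a b xA; rewrite rK.2 /f.
  by case: ifP => //= _ ->.
have fi : {in A &, injective f}.
  move=> [a b] [c d] xA yA E; have h1 := fL _ xA; have h2 := fL _ yA.
  rewrite -E in h2; have := unzip1_inj UL h1 h2.
  move: E; rewrite /f; case: ifP => _; case: ifP => _ /= E e; subst.
  - by [].
  - by have := asymA _ _ xA; rewrite yA.
  - by have := asymA _ _ xA; rewrite yA.
  - by [].
have -> : n = size (r :: verts K) by rewrite (perm_size rK.1) size_iota.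
rewrite -(size_map f); apply: uniq_leq_size; first by rewrite map_inj_in_uniq.
move=> _ /mapP[x /fL/links_fst h ->].
by rewrite inE h orbT.
Qed.

End Rooted.

Section Admissible.
Variables (R : realType) (gamma : R).
Local Open Scope ring_scope.

Lemma admissibleP F p (s : nat -> R) : admissible gamma F (s p) s <->
  forall u v, (u, v) \in links F p -> s u <= s v <= s u + gamma.
Proof.
elim: F p => // v K IHK Z IHZ p /=; split.
  case=> h /IHK hK /IHZ hZ u w.
  by rewrite inE mem_cat => /or3P[/eqP[-> ->]|/hK|/hZ].
move=> H; split.
- by apply: H; rewrite inE eqxx.
- by apply/IHK => u w h; apply: H; rewrite inE mem_cat h orbT.
- by apply/IHZ => u w h; apply: H; rewrite inE mem_cat h !orbT.
Qed.

Lemma sem_fcat1 (t : nat -> R) F G x :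
  (sem gamma t (fcat F G)).1 x = (sem gamma t F).1 x + (sem gamma t G).1 x.
Proof. by elim: F => /= [|v K _ Z ->]; rewrite ?add0r ?addrA. Qed.

Lemma sem_fcat2 (t : nat -> R) F G x :
  (sem gamma t (fcat F G)).2 x = (sem gamma t F).2 x + (sem gamma t G).2 x.
Proof. by elim: F => /= [|v K _ Z ->]; rewrite ?add0r ?addrA. Qed.

End Admissible.

Lemma alist_fun (B : eqType) (b0 : B) (l : seq (nat * B)) : uniq (unzip1 l) ->
  exists s : nat -> B, forall p, p \in l -> s p.1 = p.2.
Proof.
elim: l => [|[i y] l IH] /=; first by exists (fun=> b0).
case/andP => ni /IH [s Hs].
exists (fun j => if j == i then y else s j) => p.
rewrite inE => /predU1P[->|pl]; first by rewrite eqxx.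
case: eqVneq => [e|_]; last exact: Hs.
by move: ni; rewrite -e map_f.
Qed.

(** * Transfer of the given tree to natural numbers, and of the regression to forests *)

Section Tree.
Variables (n : nat) (e : rel 'I_n) (A : seq ('I_n * 'I_n)).
Hypotheses (eT : is_tree e) (eA : edge_list e A).

Definition natA : seq (nat * nat) := [seq (val x.1, val x.2) | x <- A].
Definition enA (u v : nat) : bool := ((u, v) \in natA) || ((v, u) \in natA).

Lemma mem_natA u v : ((val u, val v) \in natA) = ((u, v) \in A).
Proof.
apply/mapP/idP => [[[a b] ab [/val_inj -> /val_inj ->]] //|uv].
by exists (u, v).
Qed.

Lemma enAE (u v : 'I_n) : enA u v = e u v.
Proof. by rewrite /enA !mem_natA; case: eA => ->. Qed.

Lemma enA_lt u v : enA u v -> u < n /\ v < n.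
Proof.
by case/orP => /mapP[[a b] _ [-> ->]] /=; split; exact: ltn_ord.
Qed.

Lemma enA_sym : symmetric enA.
Proof. by move=> u v; rewrite /enA orbC. Qed.

Lemma enA_ord u v : enA u v ->
  exists (a b : 'I_n), [/\ u = a, v = b & e a b].
Proof.
move=> uv; have [un vn] := enA_lt uv.
by exists (Ordinal un), (Ordinal vn); rewrite -enAE.
Qed.

Lemma enA_irr : irreflexive enA.
Proof.
move=> u; apply/negP => /enA_ord [a [b [-> /val_inj ->]]].
by case: eT => _ [_ ->].
Qed.

Lemma ord_seq (q : seq nat) : all (fun x => x < n) q ->
  exists q' : seq 'I_n, q = map val q'.
Proof.
elim: q => [|x q IH] /=; first by exists [::].
by case/andP => xn /IH [q' ->]; exists (Ordinal xn :: q').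
Qed.

Lemma path_lt x q : path enA x q -> all (fun y => y < n) q.
Proof.
elim: q x => //= y q IH x /andP[/enA_lt[_ ->]].
exact: IH.
Qed.

Lemma path_val (u : 'I_n) (q : seq 'I_n) : path enA u (map val q) = path e u q.
Proof. by rewrite path_map; apply: eq_path => x y; exact: enAE. Qed.

Lemma enA_acyclic (c : seq nat) : 2 < size c -> cycle enA c -> uniq c -> False.
Proof.
case: c => // u c lt C U.
have un : u < n.
  by move/path_lt: C; rewrite all_rcons => /andP[].
have [c' E] : exists q' : seq 'I_n, u :: c = map val q'.
  apply: ord_seq; rewrite /= un /=.
  by move/path_lt: C; rewrite all_rcons => /andP[].
case: c' E => // v c' [E1 E2].
have lt' : 2 < size (v :: c') by move: lt; rewrite E2 /= size_map.
case: eT => _ _ _ /(_ _ lt') /negP; apply.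
move: C U; rewrite E1 E2 => C U; rewrite /ucycleb; apply/andP; split.
  by move: C; rewrite [cycle _ _]/= -map_rcons path_val.
by rewrite -(map_inj_uniq val_inj).
Qed.

Lemma enA_connected u v : u < n -> v < n ->
  exists2 q, path enA u q & uniq (u :: q) /\ last u q = v.
Proof.
move=> un vn; case: eT => _ _ /(_ (Ordinal un) (Ordinal vn)) C _.
case/connectP: C => q P E; case/shortenP: P E => q' P' U' _ E.
exists (map val q').
  by have := path_val (Ordinal un) q' => /= ->.
rewrite -[u]/(val (Ordinal un)) last_map -E -map_cons.
by rewrite (map_inj_uniq val_inj).
Qed.

(** [no_return] rules out that a path from [u] to the root starts downwards; conversely
    [ancestor_path] provides the path to the root. *)
Lemma child_links r K (u v : 'I_n) (r' : 'I_n) : rooted n enA r K -> r = r' ->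
  child e r' u v <-> ((val u, val v) \in links K r).
Proof.
move=> rK Er; split.
  case=> p [P U L]; have := P; rewrite /= => /andP[].
  rewrite -enAE rK.2 => /orP[//|vu] _.
  have := @no_return n enA r K u v (map val p) rK.
  rewrite -map_cons path_val P -map_cons (map_inj_uniq val_inj) U.
  by rewrite last_map L Er eqxx => /(_ isT isT); rewrite -Er => /(_ vu).
move=> uv; have U := rooted_uniq rK.
have [q [P Uq L s]] := ancestor_path U uv.
have [q' E] : exists q' : seq 'I_n, q = map val q'.
  apply: ord_seq; apply/allP => x xq; apply: (rooted_lt rK); apply: s.
  by rewrite !inE xq !orbT.
exists q'; split.
- rewrite -path_val /= -E; apply: sub_path P => x y xy.
  by rewrite rK.2 xy.
- by rewrite -(map_inj_uniq val_inj) /= -E.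
- by apply: val_inj; rewrite -last_map -E L.
Qed.

Section Regression.
Variables (R : realType) (gamma : R).
Hypothesis gamma_ge0 : (0 <= gamma)%R.
Local Open Scope ring_scope.

(** The default 0 agrees with [input], so that [extend t] is real array 1 of the initial memory by
    computation. *)
Definition extend (s : 'I_n -> R) (i : nat) : R :=
  if insub i is Some v then s v else 0.

Lemma extendE s (i : 'I_n) : extend s i = s i.
Proof. by rewrite /extend valK. Qed.

Variable t : 'I_n -> R.
Local Notation t' := (extend t).

Lemma isotonic_admissible r K (r' : 'I_n) (s : nat -> R) :
    rooted n enA r K -> r = r' ->
  lipschitz_isotonic e gamma r' (fun v => s v) <-> admissible gamma K (s r) s.
Proof.
move=> rK Er; rewrite admissibleP; split.
  move=> H u v uv; have un : (u < n)%N.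
    by apply: (rooted_lt rK); rewrite inE (links_fst uv) orbT.
  have vn : (v < n)%N by apply: (rooted_lt rK); exact: links_parent uv.
  have /(child_links _ _ rK Er) C : (val (Ordinal un), val (Ordinal vn)) \in links K r.
    by [].
  by have [h1 h2] := H _ _ C; apply/andP.
move=> H u v /(child_links _ _ rK Er) /H /andP[h1 h2].
by split.
Qed.

Lemma sqerr_sqcost r K (s : nat -> R) : rooted n enA r K ->
  sqerr t (fun v => s v) = (s r - t' r) ^+ 2 + sqcost t' K s.
Proof.
case=> P _; rewrite /sqerr /sqcost.
rewrite (eq_bigr (fun v : 'I_n => (s v - t' v) ^+ 2)); last first.
  by move=> v _; rewrite extendE.
rewrite -(big_mkord xpredT (fun v => (s v - t' v) ^+ 2)) /index_iota subn0.
by rewrite -(perm_big _ P) /= big_cons.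
Qed.

Lemma rassign_regression r K (r' : 'I_n) (s : nat -> R) :
    rooted n enA r K -> r = r' ->
    (forall p, p \in rassign gamma t' r K -> s p.1 = p.2) ->
  lipschitz_isotonic_regression e gamma t r' (fun v => s v) /\
  sqerr t (fun v => s v) = rval gamma t' r K.
Proof.
move=> rK Er /(rassign_ok gamma_ge0) [aK cK].
split; last by rewrite (sqerr_sqcost _ rK).
split; first exact/(isotonic_admissible _ rK Er).
move=> s' H.
have Es : (fun v : 'I_n => extend s' v) = s' by apply/funext => v; rewrite extendE.
have aK' : admissible gamma K (extend s' r) (extend s').
  by apply/(isotonic_admissible _ rK Er); rewrite Es.
rewrite -Es !(sqerr_sqcost _ rK) cK.
exact: rval_le.
Qed.

Lemma rassign_fun r K : rooted n enA r K ->
  exists s : nat -> R, forall p, p \in rassign gamma t' r K -> s p.1 = p.2.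
Proof.
move=> /rooted_uniq; rewrite -(unzip1_assign gamma t' K (ropt gamma t' r K)).
exact: (@alist_fun R 0 (rassign gamma t' r K)).
Qed.

(** Both sides are the least error for the root [r]. Hence [rval] depends on the root only, not on
    the forest that represents the tree. *)
Lemma rval_regression r K (r' : 'I_n) (s : 'I_n -> R) :
    rooted n enA r K -> r = r' ->
    lipschitz_isotonic_regression e gamma t r' s ->
  rval gamma t' r K = sqerr t s.
Proof.
move=> rK Er [H1 H2].
have [s1 Hs1] := rassign_fun rK.
have [J1 J2] := rassign_regression rK Er Hs1; rewrite -J2.
by case: J1 => J1 J1'; apply/le_anti; rewrite J1' // H2.
Qed.

(** The minimizer comes from the forest recursion. The definition of the unimodal regression asks
    for one at every root, not only at the best one. *)
Lemma regression_ex (r : 'I_n) :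
  exists s, lipschitz_isotonic_regression e gamma t r s.
Proof.
pose adj u := [seq v <- iota 0 n | enA u v].
have adjP u v : (v \in adj u) = enA u v.
  rewrite mem_filter mem_iota /=; apply: andb_idr => /enA_lt[_].
  by [].
have [K _ rK] := rooted_ex enA_lt enA_sym enA_irr enA_acyclic enA_connected
  adjP (fun u => filter_uniq _ (iota_uniq 0 n)) (ltn_ord r).
have [s1 Hs1] := rassign_fun rK.
have [J _] := rassign_regression rK erefl Hs1.
by exists (fun v : 'I_n => s1 v).
Qed.

Lemma rassign_unimodal (r0 : nat) K (s : nat -> R) :
    rooted n enA r0 K ->
    (forall p, p \in rassign gamma t' r0 K -> s p.1 = p.2) ->
    (forall r, (r < n)%N ->
       exists2 K', rooted n enA r K' & rval gamma t' r0 K <= rval gamma t' r K') ->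
  lipschitz_unimodal_regression e gamma t (fun v => s v).
Proof.
move=> rK Hs Hmin.
have r0n : (r0 < n)%N by apply: (rooted_lt rK); rewrite inE eqxx.
have [S HS] := boolp.choice regression_ex.
have [J1 J2] := @rassign_regression r0 K (Ordinal r0n) s rK erefl Hs.
exists (fun r => if r == Ordinal r0n then (fun v : 'I_n => s v) else S r).
exists (Ordinal r0n); rewrite eqxx; split=> // r.
  by case: eqVneq => [->|_]; [exact: J1|exact: HS].
case: eqVneq => // _; rewrite J2.
have [K' rK' le] := Hmin r (ltn_ord r).
by rewrite -(rval_regression rK' erefl (HS r)).
Qed.

End Regression.
End Tree.

(** * The functional language *)

Inductive op1 := Fst | Snd | ToR | Half | GetW of nat | GetR of nat.
Inductive op2 := Pair | SubW | EqW | AddR | SubR | MulR | DivR | LtR.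

(** Variables are de Bruijn indices; in [ERec b a] the body [b], whose only
    variable is the argument, is called on [a], and [ESelf] calls the innermost
    enclosing body. *)
Inductive ex :=
| EVar of nat
| EConst of nat
| EOp1 of op1 & ex
| EOp2 of op2 & ex & ex
| EIf of ex & ex & ex
| ELet of ex & ex
| ERec of ex & ex
| ESelf of ex.

(** Counts what evaluation executes apart from the bodies entered by [ESelf]: such a call adds the
    push of the return address, the jump and the final return. *)
Fixpoint esz (e : ex) : nat :=
  match e with
  | EVar _ | EConst _ => 1
  | EOp1 _ a => (esz a).+1
  | EOp2 _ a b | ELet a b => (esz a + esz b).+1
  | EIf c a b => (esz c + esz a + esz b).+2
  | ERec b a => (esz a + esz b).+2
  | ESelf a => (esz a).+3
  end.

Section Language.
Variable R : realType.

Inductive val := W of nat | X of R | P of val & val.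

Variables (iw : nat -> nat -> nat) (ir : nat -> nat -> R).

(** Only the input arrays can be read; the others belong to the machine and to the output. *)
Definition sem1 (o : op1) (v : val) : option val :=
  match o, v with
  | Fst, P a _ => Some a
  | Snd, P _ b => Some b
  | ToR, W n => Some (X n%:R)
  | Half, W n => Some (W (n %/ 2))
  | GetW a, W i => if a < 3 then Some (W (iw a i)) else None
  | GetR a, W i => if a < 2 then Some (X (ir a i)) else None
  | _, _ => None
  end.

Definition sem2 (o : op2) (v w : val) : option val :=
  match o, v, w with
  | Pair, _, _ => Some (P v w)
  | SubW, W m, W n => Some (W (m - n))
  | EqW, W m, W n => Some (W (m == n))
  | AddR, X a, X b => Some (X (a + b)%R)
  | SubR, X a, X b => Some (X (a - b)%R)
  | MulR, X a, X b => Some (X (a * b)%R)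
  | DivR, X a, X b => Some (X (a / b)%R)
  | LtR, X a, X b => Some (W (a < b)%R)
  | _, _, _ => None
  end.

(** Lets [W 0] serve as the empty list and the empty tree: pairs always test true. *)
Definition truthy (v : val) : bool := if v is W n then n != 0 else true.

(** The last argument counts calls only: between two calls at most [esz]
    operations are executed. *)
Inductive ev : ex -> seq val -> ex -> val -> nat -> Prop :=
| ev_var self env i v :
    onth env i = Some v -> ev self env (EVar i) v 0
| ev_const self env k : ev self env (EConst k) (W k) 0
| ev_op1 self env o a v w k :
    ev self env a v k -> sem1 o v = Some w -> ev self env (EOp1 o a) w k
| ev_op2 self env o a b v w r k l :
    ev self env a v k -> ev self env b w l -> sem2 o v w = Some r ->
    ev self env (EOp2 o a b) r (k + l)
| ev_if self env c a b v w k l :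
    ev self env c v k -> ev self env (if truthy v then a else b) w l ->
    ev self env (EIf c a b) w (k + l)
| ev_let self env a b v w k l :
    ev self env a v k -> ev self (v :: env) b w l ->
    ev self env (ELet a b) w (k + l)
| ev_rec self env b a v w k l :
    ev self env a v k -> ev b [:: v] b w l ->
    ev self env (ERec b a) w (k + l).+1
| ev_self self env a v w k l :
    ev self env a v k -> ev self [:: v] self w l ->
    ev self env (ESelf a) w (k + l).+1.

Definition runs (b : ex) (v w : val) (k : nat) : Prop :=
  exists2 k', k' <= k & ev b [:: v] b w k'.

(** Weakest precondition: a proof about a program computes this term, and each call leaves in it an
    obligation [runs], discharged by a lemma or an induction hypothesis on the callee. *)
Fixpoint wp (self : ex) (env : seq val) (e : ex) (Q : val -> nat -> Prop) :
    Prop :=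
  match e with
  | EVar i => if onth env i is Some v then Q v 0 else False
  | EConst k => Q (W k) 0
  | EOp1 o a =>
      wp self env a (fun v k => if sem1 o v is Some r then Q r k else False)
  | EOp2 o a b =>
      wp self env a (fun v k => wp self env b (fun w l =>
        if sem2 o v w is Some r then Q r (k + l) else False))
  | EIf c a b =>
      wp self env c (fun v k =>
        if truthy v then wp self env a (fun w l => Q w (k + l))
        else wp self env b (fun w l => Q w (k + l)))
  | ELet a b =>
      wp self env a (fun v k => wp self (v :: env) b (fun w l => Q w (k + l)))
  | ERec b a =>
      wp self env a (fun v k =>
        exists w l, runs b v w l /\ Q w (k + l).+1)
  | ESelf a =>
      wp self env a (fun v k =>
        exists w l, runs self v w l /\ Q w (k + l).+1)
  end.

Lemma wp_sound self env e Q :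
    wp self env e Q ->
  exists v k k', [/\ ev self env e v k', k' <= k & Q v k].
Proof.
elim: e env Q => [i|k|o a IHa|o a IHa b IHb|c IHc a IHa b IHb|a IHa b IHb
  |b _ a IHa|a IHa] env Q /=.
- by case E: (onth env i) => [v|//] Qv; exists v, 0, 0; split=> //; constructor.
- by move=> Qk; exists (W k), 0, 0; split=> //; constructor.
- case/IHa => v [k [k' [ev' le]]]; case E: (sem1 o v) => [r|//] Qr.
  by exists r, k, k'; split=> //; apply: ev_op1 E.
- case/IHa => v [k [k' [eva le]]] /IHb [w [l [l' [evb le']]]].
  case E: (sem2 o v w) => [r|//] Qr.
  exists r, (k + l), (k' + l'); split=> //; last exact: leq_add.
  exact: ev_op2 E.
- case/IHc => v [k [k' [evc le]]]; case E: (truthy v).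
    case/IHa => w [l [l' [eva le' Qw]]]; exists w, (k + l), (k' + l').
    by split=> //; [apply: ev_if evc _; rewrite E|exact: leq_add].
  case/IHb => w [l [l' [eva le' Qw]]]; exists w, (k + l), (k' + l').
  by split=> //; [apply: ev_if evc _; rewrite E|exact: leq_add].
- case/IHa => v [k [k' [eva le]]] /IHb [w [l [l' [evb le' Qw]]]].
  exists w, (k + l), (k' + l'); split=> //; last exact: leq_add.
  exact: ev_let eva evb.
- case/IHa => v [k [k' [eva le]]] [w [l [[l' le' evb] Qw]]].
  exists w, (k + l).+1, (k' + l').+1; split=> //; last by rewrite ltnS leq_add.
  exact: ev_rec eva evb.
- case/IHa => v [k [k' [eva le]]] [w [l [[l' le' evb] Qw]]].
  exists w, (k + l).+1, (k' + l').+1; split=> //; last by rewrite ltnS leq_add.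
  exact: ev_self eva evb.
Qed.

Lemma runsI b v w k :
  wp b [:: v] b (fun w' k' => w' = w /\ k' <= k) -> runs b v w k.
Proof.
case/wp_sound => w' [l [l' [ev' le [<- le']]]].
by exists l' => //; apply: leq_trans le'.
Qed.

Lemma runsW b v w k l : k <= l -> runs b v w k -> runs b v w l.
Proof. by move=> le [k' le' ev']; exists k' => //; apply: leq_trans le. Qed.

End Language.

Arguments W {R}.

(** * The stack machine *)

Inductive instr :=
| IConst of nat | IDup of nat | IOp1 of op1 | IOp2 of op2
| IJz of nat | IJmp of nat | ISlide | IRet.

(** [comp ps rho h pc e]: code at address [pc] pushing the value of [e];
    [ps] is the address of the enclosing function body, [h] the current height
    of its frame, [rho] the heights of the variables in the frame, whose two
    lowest cells are the return address (below height 0) and the argument. *)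
Fixpoint comp (ps : nat) (rho : seq nat) (h pc : nat) (e : ex) : seq instr :=
  match e with
  | EVar i => [:: IDup (h - (nth 0 rho i).+1)]
  | EConst k => [:: IConst k]
  | EOp1 o a => comp ps rho h pc a ++ [:: IOp1 o]
  | EOp2 o a b =>
      let ca := comp ps rho h pc a in
      ca ++ comp ps rho h.+1 (pc + size ca) b ++ [:: IOp2 o]
  | EIf c a b =>
      let cc := comp ps rho h pc c in
      let pa := (pc + size cc).+1 in
      let ca := comp ps rho h pa a in
      let pb := (pa + size ca).+1 in
      let cb := comp ps rho h pb b in
      cc ++ IJz pb :: ca ++ IJmp (pb + size cb) :: cb
  | ELet a b =>
      let ca := comp ps rho h pc a in
      ca ++ comp ps (h :: rho) h.+1 (pc + size ca) b ++ [:: ISlide]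
  | ERec b a =>
      let ca := comp ps rho h.+1 pc.+1 a in
      let pb := pc.+1 + size ca in
      let cb := comp pb [:: 0] 1 pb b in
      IConst (pb + size cb).+1 :: ca ++ cb ++ [:: IRet]
  | ESelf a =>
      let ca := comp ps rho h.+1 pc.+1 a in
      IConst (pc.+1 + size ca).+1 :: ca ++ [:: IJmp ps]
  end.

Section Bytecode.
Variable R : realType.
Variables (iw : nat -> nat -> nat) (ir : nat -> nat -> R).
Local Notation val := (val R).
Local Notation sem1 := (sem1 iw ir).
Local Notation ev := (ev iw ir).

Definition bstep (i : instr) (pc : nat) (s : seq val) :
    option (nat * seq val) :=
  match i, s with
  | IConst k, _ => Some (pc.+1, W k :: s)
  | IDup i, _ => omap (fun v => (pc.+1, v :: s)) (onth s i)
  | IOp1 o, v :: s' => omap (fun w => (pc.+1, w :: s')) (sem1 o v)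
  | IOp2 o, w :: v :: s' => omap (fun r => (pc.+1, r :: s')) (sem2 o v w)
  | IJz l, v :: s' => Some (if truthy v then pc.+1 else l, s')
  | IJmp l, _ => Some (l, s)
  | ISlide, v :: _ :: s' => Some (pc.+1, v :: s')
  | IRet, v :: _ :: W r :: s' => Some (r, v :: s')
  | _, _ => None
  end.

Inductive bsteps (code : seq instr) :
    nat -> nat * seq val -> nat * seq val -> Prop :=
| bsteps0 x : bsteps code 0 x x
| bstepsS n pc s i y z :
    onth code pc = Some i -> bstep i pc s = Some y -> bsteps code n y z ->
    bsteps code n.+1 (pc, s) z.

Lemma bsteps_trans code m n x y z :
  bsteps code m x y -> bsteps code n y z -> bsteps code (m + n) x z.
Proof. by elim=> // *; rewrite addSn; apply: bstepsS; eauto. Qed.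

Lemma bsteps_rcons code m x pc s i y :
    bsteps code m x (pc, s) -> onth code pc = Some i -> bstep i pc s = Some y ->
  bsteps code m.+1 x y.
Proof.
move=> h1 h2 h3; rewrite -addn1; apply: bsteps_trans h1 _.
by apply: bstepsS h2 h3 _; constructor.
Qed.

Definition code_at (code : seq instr) (pc : nat) (c : seq instr) : Prop :=
  exists pre post, code = pre ++ c ++ post /\ size pre = pc.

Lemma code_atL code pc a b : code_at code pc (a ++ b) -> code_at code pc a.
Proof. by case=> pre [post [-> <-]]; exists pre, (b ++ post); rewrite -!catA. Qed.

Lemma code_atR code pc a b :
  code_at code pc (a ++ b) -> code_at code (pc + size a) b.
Proof.
case=> pre [post [-> <-]]; exists (pre ++ a), post.
by rewrite size_cat -!catA.
Qed.

Lemma code_at_hd code pc i c : code_at code pc (i :: c) -> onth code pc = Some i.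
Proof.
case=> pre [post [-> <-]].
by elim: pre.
Qed.

Lemma code_at_tl code pc i c : code_at code pc (i :: c) -> code_at code pc.+1 c.
Proof. by move=> h; have := @code_atR code pc [:: i] c h; rewrite addn1. Qed.

Definition env_at (rho : seq nat) (h : nat) (env s : seq val) : Prop :=
  forall i v, onth env i = Some v ->
    nth 0 rho i < h /\ onth s (h - (nth 0 rho i).+1) = Some v.

Lemma env_at_push rho h env s v :
  env_at rho h env s -> env_at rho h.+1 env (v :: s).
Proof.
move=> H i w /H [lt eq]; split; first by lia.
by have -> : h.+1 - (nth 0 rho i).+1 = (h - (nth 0 rho i).+1).+1 by lia.
Qed.

Lemma env_at_let rho h env s v :
  env_at rho h env s -> env_at (h :: rho) h.+1 (v :: env) (v :: s).
Proof.
move=> H [|i] w /=; first by rewrite subnn.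
by move/(env_at_push v H).
Qed.

Definition body_at code ps self :=
  code_at code ps (comp ps [:: 0] 1 ps self ++ [:: IRet]).

(** Each call is charged [S], which covers the body it enters; so [S] has to bound both the
    expression and the enclosing body. *)
Lemma comp_correct S code self env e v k ps rho h pc s :
    ev self env e v k -> esz e <= S -> esz self <= S ->
    body_at code ps self -> code_at code pc (comp ps rho h pc e) ->
    env_at rho h env s ->
  exists2 n, n <= esz e + S * k &
    bsteps code n (pc, s) (pc + size (comp ps rho h pc e), v :: s).
Proof.
move=> E; elim: E ps rho h pc s => {self env e v k}.
- move=> self env i v Ev ps rho h pc s _ _ _ /code_at_hd C /(_ _ _ Ev) [lt N].
  exists 1; first by rewrite /=; lia.
  by apply: bstepsS C _ (bsteps0 _ _); rewrite /= N addn1.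
- move=> self env i ps rho h pc s _ _ _ /code_at_hd C _.
  by exists 1; [rewrite /=; lia|apply: bstepsS C _ (bsteps0 _ _); rewrite /= addn1].
- move=> self env o a v w k _ IH sem ps rho h pc s /= l1 l2 B C M.
  have [|n ln Bn] := IH ps rho h pc s _ l2 B (code_atL C) M; first by lia.
  exists n.+1; first by lia.
  apply: bsteps_rcons Bn (code_at_hd (code_atR C)) _.
  by rewrite /= sem /= size_cat addn1 addnS.
- move=> self env o a b v w r k l _ IHa _ IHb sem ps rho h pc s /= l1 l2 B C M.
  have [|n ln Bn] := IHa ps rho h pc s _ l2 B (code_atL C) M; first by lia.
  have C' := code_atR C.
  have [|m lm Bm] := IHb ps rho h.+1 _ (v :: s) _ l2 B (code_atL C')
    (env_at_push v M); first by lia.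
  exists (n + m).+1; first by lia.
  apply: bsteps_rcons (bsteps_trans Bn Bm) (code_at_hd (code_atR C')) _.
  by rewrite /= sem /= !size_cat /=; congr (Some (_, _)); lia.
- move=> self env c a b v w k l _ IHc _ IHab ps rho h pc s /= l1 l2 B C M.
  have [|n ln Bn] := IHc ps rho h pc s _ l2 B (code_atL C) M; first by lia.
  have C1 := code_atR C; have C2 := code_at_tl C1.
  have C3 := code_at_tl (code_atR C2).
  move: IHab; case T: (truthy v) => IH.
    have [|m lm Bm] := IH ps rho h _ s _ l2 B (code_atL C2) M; first by lia.
    exists (n + m.+1).+1; first by lia.
    rewrite -addnS; apply: bsteps_trans Bn _.
    apply: (bstepsS (code_at_hd C1)); first by rewrite /= T.
    apply: bsteps_rcons Bm (code_at_hd (code_atR C2)) _.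
    by rewrite /= !size_cat /= size_cat /=; congr (Some (_, _)); lia.
  have [|m lm Bm] := IH ps rho h _ s _ l2 B C3 M; first by lia.
  exists (n + m.+1); first by lia.
  apply: bsteps_trans Bn _.
  apply: (bstepsS (code_at_hd C1)); first by rewrite /= T.
  set q := (X in bsteps _ _ _ (X, _)); move: Bm.
  set q' := (X in bsteps _ _ _ (X, _)); suff -> : q = q' by [].
  by rewrite /q /q' !size_cat /= size_cat /=; lia.
- move=> self env a b v w k l _ IHa _ IHb ps rho h pc s /= l1 l2 B C M.
  have [|n ln Bn] := IHa ps rho h pc s _ l2 B (code_atL C) M; first by lia.
  have C' := code_atR C.
  have [|m lm Bm] := IHb ps (h :: rho) h.+1 _ (v :: s) _ l2 B (code_atL C')
    (env_at_let M); first by lia.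
  exists (n + m).+1; first by lia.
  apply: bsteps_rcons (bsteps_trans Bn Bm) (code_at_hd (code_atR C')) _.
  by rewrite /= !size_cat /=; congr (Some (_, _)); lia.
- move=> self env b a v w k l _ IHa _ IHb ps rho h pc s /= l1 l2 B C M.
  set ret := (_ + size (comp _ [:: 0] 1 _ b)).+1 in C *.
  have C1 := code_at_tl C.
  have [|n ln Bn] := IHa ps rho h.+1 pc.+1 (W ret :: s) _ l2 B (code_atL C1)
    (env_at_push _ M); first by lia.
  have C2 := code_atR C1.
  have [|||m lm Bm] := IHb _ [:: 0] 1 _ (v :: W ret :: s) _ _ C2 (code_atL C2).
  - by lia.
  - by lia.
  - by case=> [|i] u //=; case: i.
  exists (n + m.+1).+1; first by lia.
  apply: (bstepsS (code_at_hd C)) => //.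
  apply: bsteps_trans Bn _.
  apply: bsteps_rcons Bm (code_at_hd (code_atR C2)) _.
  by rewrite /= /ret !size_cat /=; congr (Some (_, _)); lia.
- move=> self env a v w k l _ IHa _ IHb ps rho h pc s /= l1 l2 B C M.
  set ret := (_ + size _).+1 in C *.
  have C1 := code_at_tl C.
  have [|n ln Bn] := IHa ps rho h.+1 pc.+1 (W ret :: s) _ l2 B (code_atL C1)
    (env_at_push _ M); first by lia.
  have C2 := code_atR C1.
  have [|||m lm Bm] := IHb _ [:: 0] 1 _ (v :: W ret :: s) _ _ B (code_atL B).
  - by lia.
  - by lia.
  - by case=> [|i] u //=; case: i.
  exists (n + (m.+2)).+1; first by lia.
  apply: (bstepsS (code_at_hd C)) => //.
  apply: bsteps_trans Bn _.
  apply: (bstepsS (code_at_hd C2)) => //.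
  apply: bsteps_rcons Bm (code_at_hd (code_atR B)) _.
  by rewrite /= /ret !size_cat /=; congr (Some (_, _)); lia.
Qed.

(** The initial return address is the length of the program, so the last return leaves the code and
    ends the interpretation. *)
Definition program (e : ex) : seq instr :=
  let c := comp 2 [:: 0] 1 2 e in
  IConst (size c).+3 :: IConst 0 :: c ++ [:: IRet].

Lemma program_correct e v k :
    runs iw ir e (W 0) v k ->
  exists2 n, n <= (esz e).+3 * k.+1 &
    bsteps (program e) n (0, [::]) (size (program e), [:: v]).
Proof.
case=> k' le E.
set code := program e.
have B : body_at code 2 e.
  exists [:: IConst (size (comp 2 [:: 0] 1 2 e)).+3; IConst 0], [::].
  by rewrite cats0.
have M : env_at [:: 0] 1 [:: W 0] [:: W 0; W (size (comp 2 [:: 0] 1 2 e)).+3].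
  by case=> [|i] u //=; case: i.
have [n ln Bn] :=
  @comp_correct (esz e) _ _ _ _ _ _ _ _ _ _ _ E (leqnn _) (leqnn _) B (code_atL B) M.
exists n.+3.
  have : esz e * k' <= esz e * k by rewrite leq_mul2l le orbT.
  by rewrite mulnS mulSn mulSn mulSn; lia.
apply: bstepsS => //; apply: bstepsS => //.
apply: bsteps_rcons Bn (code_at_hd (code_atR B)) _.
by rewrite /= /code /program /= size_cat /= addn1.
Qed.

End Bytecode.

(** * Simulation by the RAM *)

Section Simulation.
Variables (R : realType) (B : nat) (st0 : state R).
Local Notation val := (val R).
Local Notation state := (state R).
Local Notation exec := (@exec R B).
Local Notation weval := (@weval R B).
Local Notation reval := (@reval R B).
Local Notation teval := (@teval R B).
Hypothesis input_lt : forall a i, a < 3 -> words st0 a i < B.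

(** Word array 5 holds the program counter, the stack and the first free cell at
    indices 0, 1 and 2.  A pair at address [w] has its components in word arrays
    3 and 4, a real its value in real array 3; nothing is ever overwritten, so
    copying a value copies one word. *)
Fixpoint rep (f : nat) (m : nat -> nat -> nat) (q : nat -> nat -> R)
    (v : val) (w : nat) : Prop :=
  match v with
  | W n => w = n /\ n < B
  | X r => 0 < w < f /\ q 3 w = r
  | P a b => [/\ 0 < w < f, rep f m q a (m 3 w) & rep f m q b (m 4 w)]
  end.

Definition rp (st : state) := rep (words st 5 2) (words st) (reals st).

Definition stk (s : seq val) : val := foldr (@P R) (W 0) s.

Record inv (st : state) (f : nat) : Prop := Inv {
  invW : forall a i, a < 3 -> words st a i = words st0 a i;
  invR : forall a i, a < 2 -> reals st a i = reals st0 a i;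
  invF : words st 5 2 = f;
  inv0 : 0 < f;
  invB : f + 4 < B }.

Definition good st f pc s :=
  [/\ inv st f, rp st (stk s) (words st 5 1) & words st 5 0 = pc].

Definition ext (st st' : state) :=
  [/\ words st 5 2 <= words st' 5 2,
      forall a i, a < 5 -> i < words st 5 2 -> words st' a i = words st a i &
      forall i, i < words st 5 2 -> reals st' 3 i = reals st 3 i].

(** A represented value refers only to cells below the free pointer, and these are never written
    again. *)
Lemma rp_ext st st' v w : ext st st' -> rp st v w -> rp st' v w.
Proof.
case=> le ew er; rewrite /rp; elim: v w => [n|r|a IHa b IHb] w //=.
  by case=> /andP[w0 wf] <-; split; [lia|exact: er].
case=> /andP[w0 wf] ra rb; split; first by lia.
  by rewrite (ew 3 w) //; exact: IHa ra.
by rewrite (ew 4 w) //; exact: IHb rb.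
Qed.

Lemma rp_lt st f v w : inv st f -> rp st v w -> w < B.
Proof.
case=> _ _ Ef _ fB; rewrite /rp Ef; case: v => [n|r|a b] /=.
- by case=> ->.
- by case=> /andP[_ lt] _; lia.
- by case=> /andP[_ lt] _ _; lia.
Qed.

Definition RegPC := WGet 5 (WConst 0).
Definition RegS := WGet 5 (WConst 1).
Definition RegF := WGet 5 (WConst 2).
Definition tls j := iter j (WGet 4) RegS.
Definition hd j := WGet 3 (tls j).
Definition incF := WSet 5 (WConst 2) (WAdd RegF (WConst 1)).
(** The stack is itself a linked list of pairs: dropping [j] entries and pushing one allocates a
    single pair whose tail is the [j]-th tail. *)
Definition push x j :=
  Seq (WSet 3 RegF x) (Seq (WSet 4 RegF (tls j))
    (Seq (WSet 5 (WConst 1) RegF) incF)).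
Definition newreal r := Seq (RSet 3 RegF r) incF.
Definition last_cell := WSub RegF (WConst 1).
Definition goto l := WSet 5 (WConst 0) (WConst l).

Lemma weval_const st k : k < B -> weval st (WConst k) = Some k.
Proof. by rewrite /= /word => ->. Qed.

Lemma weval_get st a x j :
  weval st x = Some j -> words st a j < B ->
  weval st (WGet a x) = Some (words st a j).
Proof. by move=> /= -> /=; rewrite /word => ->. Qed.

Lemma weval_add st x y a b :
  weval st x = Some a -> weval st y = Some b -> a + b < B ->
  weval st (WAdd x y) = Some (a + b).
Proof. by move=> /= -> -> /=; rewrite /word => ->. Qed.

Lemma weval_sub st x y a b :
  weval st x = Some a -> weval st y = Some b -> a < B ->
  weval st (WSub x y) = Some (a - b).
Proof.
move=> /= -> -> lt /=; rewrite /word.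
by have -> : a - b < B by lia.
Qed.

Lemma weval_div st x y a b :
  weval st x = Some a -> weval st y = Some b -> a < B ->
  weval st (WDiv x y) = Some (a %/ b).
Proof.
move=> /= -> -> lt /=; rewrite /word.
by rewrite (leq_ltn_trans (leq_div _ _) lt).
Qed.

Lemma weval_regF st f : inv st f -> weval st RegF = Some f.
Proof.
case=> _ _ Ef _ fB; rewrite /RegF (@weval_get _ _ _ 2) ?Ef //; last by lia.
by apply: weval_const; lia.
Qed.

Lemma weval_last st f : inv st f -> weval st last_cell = Some f.-1.
Proof.
move=> H; have fB := invB H; rewrite -subn1.
apply: weval_sub (weval_regF H) _ _; last by lia.
by apply: weval_const; lia.
Qed.

Lemma tl_ok st f pc s j : good st f pc s -> j <= size s ->
  exists2 w, weval st (tls j) = Some w & rp st (stk (drop j s)) w.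
Proof.
case=> H rs _; elim: j => [|j IH] lt.
  rewrite drop0; exists (words st 5 1) => //; apply: weval_get.
    by apply: weval_const; have := invB H; lia.
  exact: rp_lt H rs.
have [|w ew] := IH; first by lia.
rewrite (drop_nth (W 0)) //= => -[_ _ r].
by exists (words st 4 w) => //; apply: weval_get ew (rp_lt H r).
Qed.

Lemma drop_onth (T : Type) (s : seq T) j v :
  onth s j = Some v -> drop j s = v :: drop j.+1 s.
Proof.
by elim: s j => [|x s IH] [|j] //= => [[->]|/IH]; rewrite ?drop0.
Qed.

Lemma hd_ok st f pc s j v : good st f pc s -> onth s j = Some v ->
  exists2 w, weval st (hd j) = Some w & rp st v w.
Proof.
move=> G; have [H rs _] := G.
move=> E; have lt : j < size s by rewrite -onthTE E.
have [|w ew] := tl_ok G (j := j); first exact: ltnW.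
rewrite (drop_onth E) => -[_ r _].
by exists (words st 3 w) => //; apply: weval_get ew (rp_lt H r).
Qed.

Lemma ext_cell st f a x : inv st f -> 2 < a < 5 ->
  ext st (State (upd (words st) a f x) (reals st)).
Proof.
move=> [_ _ Ef _ _] lt; split=> //=; rewrite /upd Ef.
  by have -> : (5 == a) = false by lia.
move=> b i _ lti; have -> : (i == f) = false by lia.
by rewrite andbF.
Qed.

Lemma good_cell st f pc s a x : good st f pc s -> 2 < a < 5 ->
  good (State (upd (words st) a f x) (reals st)) f pc s.
Proof.
move=> [H rs E] lt; have X := ext_cell x H lt.
have n5 : (5 == a) = false by lia.
split; rewrite /= /upd ?n5 //=.
  case: H => HW HR Ef f0 fB; split=> //=; rewrite /upd ?n5 //.
  move=> b i lb.
  have -> : (b == a) = false by lia.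
  by exact: HW.
exact: rp_ext X rs.
Qed.

Lemma ext_real st f x : inv st f ->
  ext st (State (words st) (upd (reals st) 3 f x)).
Proof.
case=> _ _ Ef _ _; split=> //=; rewrite Ef => i lt; rewrite /upd.
by have -> : (i == f) = false by lia.
Qed.

Lemma good_real st f pc s x : good st f pc s ->
  good (State (words st) (upd (reals st) 3 f x)) f pc s.
Proof.
move=> [H rs E]; have X := ext_real x H.
split=> //=; last exact: rp_ext X rs.
case: H => HW HR Ef f0 fB; split=> //= a i lt; rewrite /upd.
have -> : (a == 3) = false by lia.
by exact: HR.
Qed.

Lemma ext_reg st i x : (i == 2) ==> (words st 5 2 <= x) ->
  ext st (State (upd (words st) 5 i x) (reals st)).
Proof.
move=> le; split=> //=; rewrite /upd /=.
  by case: eqP => [e|//]; move: le; rewrite -e eqxx.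
move=> a j lt _.
by have -> : (a == 5) = false by lia.
Qed.

Lemma inv_reg st f i x : inv st f -> i < 2 ->
  inv (State (upd (words st) 5 i x) (reals st)) f.
Proof.
case=> HW HR Ef f0 fB lt; split=> //=; rewrite /upd /=.
  move=> a j la.
  have -> : (a == 5) = false by lia.
  by exact: HW.
by have -> : (2 == i) = false by lia.
Qed.

Lemma incF_ok st f pc s : good st f pc s -> f.+1 + 4 < B ->
  exists k st', [/\ exec st incF k st', good st' f.+1 pc s, ext st st'
    & reals st' = reals st /\
      forall a i, a < 5 -> words st' a i = words st a i].
Proof.
move=> [H rs E] lt.
exists (1 + wcost (WAdd RegF (WConst 1))).+1.
exists (State (upd (words st) 5 2 f.+1) (reals st)).
have X : ext st (State (upd (words st) 5 2 f.+1) (reals st)).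
  by apply: ext_reg; rewrite /= (invF H).
split=> //.
- apply: exec_wset; first by apply: weval_const; lia.
  rewrite -(addn1 f); apply: weval_add (weval_regF H) _ _; last by lia.
  by apply: weval_const; lia.
- split; last by [].
    case: H => HW HR Ef f0 fB; split=> //=.
    move=> a i la; rewrite /upd.
    have -> : (a == 5) = false by lia.
    by exact: HW.
  by have /= := rp_ext X rs.
- by split=> // a i la; rewrite /= /upd; case: eqP la => // ->.
Qed.

Lemma push_ok st f pc s j x w v :
    good st f pc s -> f.+1 + 4 < B -> weval st x = Some w -> rp st v w ->
    j <= size s ->
  exists k st', exec st (push x j) k st' /\ good st' f.+1 pc (v :: drop j s).
Proof.
move=> G lt ew rv ls; have [H rs E] := G.
have W1 : weval st RegF = Some f by exact: weval_regF H.
have G1 := good_cell w G (isT : 2 < 3 < 5).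
have X1 := ext_cell w H (isT : 2 < 3 < 5).
set st1 := State _ _ in G1 X1.
have rv1 := rp_ext X1 rv.
have [H1 rs1 E1] := G1.
have [y ey ry] := tl_ok G1 ls.
have G2 := good_cell y G1 (isT : 2 < 4 < 5).
have X2 := ext_cell y H1 (isT : 2 < 4 < 5).
set st2 := State _ _ in G2 X2.
have [H2 rs2 E2] := G2.
have rv2 := rp_ext X2 rv1; have ry2 := rp_ext X2 ry.
pose st3 := State (upd (words st2) 5 1 f) (reals st2).
have X3 : ext st2 st3 by exact: ext_reg.
have H3 : inv st3 f by exact: inv_reg.
have X4 : ext st3 (State (upd (words st3) 5 2 f.+1) (reals st3)).
  by apply: ext_reg; apply/implyP => _; rewrite (invF H3).
have e1 : exec st (WSet 3 RegF x) (wcost RegF + wcost x).+1 st1.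
  exact: exec_wset.
have e2 : exec st1 (WSet 4 RegF (tls j)) (wcost RegF + wcost (tls j)).+1 st2.
  by apply: exec_wset => //; exact: weval_regF.
have e3 : exec st2 (WSet 5 (WConst 1) RegF) (1 + wcost RegF).+1 st3.
  by apply: exec_wset; [apply: weval_const; lia|exact: weval_regF].
pose st4 := State (upd (words st3) 5 2 f.+1) (reals st3).
have e4 : exec st3 incF (1 + wcost (WAdd RegF (WConst 1))).+1 st4.
  apply: exec_wset; first by apply: weval_const; lia.
  rewrite -(addn1 f); apply: weval_add (weval_regF H3) _ _; last by lia.
  by apply: weval_const; lia.
do 2 eexists; split.
  exact: exec_seq e1 (exec_seq e2 (exec_seq e3 e4)).
split.
- case: H3 => HW HR Ef f0 fB; split=> // a i la.
  have n5 : (a == 5) = false by lia.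
  by have := HW a i la; rewrite /= /upd n5.
- have w1 : words st4 5 1 = f by [].
  have wF : words st4 5 2 = f.+1 by [].
  have w3 : words st4 3 f = w by rewrite /= /upd /= eqxx.
  have w4 : words st4 4 f = y by rewrite /= /upd /= eqxx.
  have r1 := rp_ext X4 (rp_ext X3 rv2); have r2 := rp_ext X4 (rp_ext X3 ry2).
  rewrite -/st4 /rp wF in r1 r2.
  rewrite /rp w1 wF; cbn [stk foldr rep]; rewrite w3 w4; split=> //.
  by have := inv0 H; lia.
- by rewrite /= /upd /= E.
Qed.

Lemma newreal_ok st f pc s r x :
    good st f pc s -> f.+1 + 4 < B -> reval st r = Some x ->
  exists k st', [/\ exec st (newreal r) k st', good st' f.+1 pc s
                  & rp st' (X x) f].
Proof.
move=> G lt ex; have [H rs E] := G.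
have e1 : exec st (RSet 3 RegF r) (wcost RegF + rcost r).+1
    (State (words st) (upd (reals st) 3 f x)).
  by apply: exec_rset => //; exact: weval_regF.
have [k [st' [e2 G2 _ X2]]] := incF_ok (good_real x G) lt.
do 2 eexists; split; [exact: exec_seq e1 e2|exact: G2|].
case: G2 => H2 _ _; have f0 := inv0 H.
rewrite /rp (invF H2); cbn [rep]; split; first by lia.
by rewrite X2.1 /= /upd !eqxx.
Qed.

Lemma goto_ok st f pc s l : good st f pc s -> l < B ->
  exists k st', exec st (goto l) k st' /\ good st' f l s.
Proof.
move=> [H rs E] lt; do 2 eexists; split.
  by apply: exec_wset; apply: weval_const => //; have := invB H; lia.
split; [exact: inv_reg| |by []].
by apply: rp_ext rs; exact: ext_reg.
Qed.

Local Arguments Defs.weval : simpl never.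
Local Arguments rep : simpl never.

Lemma lift2_some (S T U : Type) (h : S -> T -> U) x y a b :
  x = Some a -> y = Some b -> lift2 h x y = Some (h a b).
Proof. by move=> -> ->. Qed.

Lemma reval_ofW st x n :
  weval st x = Some n -> reval st (ROfW x) = Some n%:R%R.
Proof. by move=> ew; rewrite /= ew. Qed.

Lemma reval_get st a x n :
  weval st x = Some n -> reval st (RGet a x) = Some (reals st a n).
Proof. by move=> ew; rewrite /= ew. Qed.

Definition icmd (i : instr) (pc : nat) : cmd :=
  let next c := Seq c (goto pc.+1) in
  let unop r := next (Seq (newreal r) (push last_cell 1)) in
  let binop r :=
    next (Seq (newreal (r (RGet 3 (hd 1)) (RGet 3 (hd 0)))) (push last_cell 2)) in
  match i with
  | IConst k => next (push (WConst k) 0)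
  | IDup i => next (push (hd i) 0)
  | IOp1 Fst => next (push (WGet 3 (hd 0)) 1)
  | IOp1 Snd => next (push (WGet 4 (hd 0)) 1)
  | IOp1 ToR => unop (ROfW (hd 0))
  | IOp1 Half => next (push (WDiv (hd 0) (WConst 2)) 1)
  | IOp1 (GetW a) => next (push (WGet a (hd 0)) 1)
  | IOp1 (GetR a) => unop (RGet a (hd 0))
  | IOp2 Pair =>
      next (Seq (Seq (WSet 3 RegF (hd 1)) (Seq (WSet 4 RegF (hd 0)) incF))
                (push last_cell 2))
  | IOp2 SubW => next (push (WSub (hd 1) (hd 0)) 2)
  | IOp2 EqW =>
      next (If (WEq (hd 1) (hd 0)) (push (WConst 1) 2) (push (WConst 0) 2))
  | IOp2 AddR => binop RAdd
  | IOp2 SubR => binop RSub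
  | IOp2 MulR => binop RMul
  | IOp2 DivR => binop RDiv
  | IOp2 LtR =>
      next (If (RLt (RGet 3 (hd 1)) (RGet 3 (hd 0)))
              (push (WConst 1) 2) (push (WConst 0) 2))
  | IJz l =>
      Seq (If (WEq (hd 0) (WConst 0)) (goto l) (goto pc.+1))
          (WSet 5 (WConst 1) (tls 1))
  | IJmp l => goto l
  | ISlide => next (push (hd 0) 2)
  | IRet => Seq (WSet 5 (WConst 0) (hd 2)) (push (hd 0) 3)
  end.

Definition imax (i : instr) : nat :=
  match i with IConst k | IJz k | IJmp k => k | _ => 0 end.

Lemma next_ok st f pc s c l : l < B ->
    (exists k st', exec st c k st' /\ good st' f pc s) ->
  exists k st', exec st (Seq c (goto l)) k st' /\ good st' f l s.
Proof.
move=> lt [k [st1 [e1 G1]]]; have [l' [st2 [e2 G2]]] := goto_ok G1 lt.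
by exists (k + l'), st2; split=> //; exact: exec_seq e1 e2.
Qed.

Lemma real_push_ok st f pc s r x j :
    good st f pc s -> f.+2 + 4 < B -> reval st r = Some x -> j <= size s ->
  exists k st', exec st (Seq (newreal r) (push last_cell j)) k st' /\
    good st' f.+2 pc (X x :: drop j s).
Proof.
move=> G lt er ls; have [|k [st1 [e1 G1 r1]]] := newreal_ok G _ er; first by lia.
have [H1 _ _] := G1.
have [l [st2 [e2 G2]]] := push_ok G1 lt (weval_last H1) r1 ls.
by exists (k + l), st2; split=> //; exact: exec_seq e1 e2.
Qed.

(** An instruction allocates at most two cells, one for a result and one for its stack entry; memory
    is thus linear in the number of steps. *)
Lemma icmd_ok st f pc s i pc' s' :
    good st f pc s -> f + 6 < B -> pc.+1 < B -> imax i < B ->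
    bstep (words st0) (reals st0) i pc s = Some (pc', s') ->
  exists k st' f',
    [/\ exec st (icmd i pc) k st', good st' f' pc' s' & f' <= f.+2].
Proof.
move=> G fB pB iB; have [H rs E] := G.
have W1 f' c (s1 : seq val) : f' <= f.+2 ->
    (exists k st', exec st c k st' /\ good st' f' pc s1) ->
    Some (pc.+1, s1) = Some (pc', s') ->
  exists k st' f'', [/\ exec st (Seq c (goto pc.+1)) k st', good st' f'' pc' s'
    & f'' <= f.+2].
  move=> le /(next_ok pB) [k [st' [e G']]] [<- <-].
  by exists k, st', f'.
have W0 n : n < B -> rp st (W n) n by [].
case: i iB => [k|i|o|o|l|l||] iB /=.
- apply: (W1 f.+1) => //; have -> : W k :: s = W k :: drop 0 s by rewrite drop0.
  by apply: push_ok G _ _ (W0 _ iB) _ => //; [lia|exact: weval_const].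
- case Ei: (onth s i) => [v|//] /=.
  apply: (W1 f.+1) => //; have -> : v :: s = v :: drop 0 s by rewrite drop0.
  by have [w ew rw] := hd_ok G Ei; apply: push_ok G _ ew rw _ => //; lia.
- move: iB => _; case: s rs E G W1 => [|v s1] //= _ E G W1.
  have [w ew rw] := hd_ok G (erefl : onth (v :: s1) 0 = Some v).
  have wB := rp_lt H rw.
  have PU f' c v' : f' <= f.+2 ->
      (exists k st', exec st c k st' /\ good st' f' pc (v' :: drop 1 (v :: s1))) ->
      Some (pc.+1, v' :: s1) = Some (pc', s') ->
    exists k st' f'', [/\ exec st (Seq c (goto pc.+1)) k st', good st' f'' pc' s'
      & f'' <= f.+2].
    by move=> le e; apply: W1 le _; move: e; rewrite /= drop0.
  case: o v rw ew E G PU => [|||| a|a] [n|r|a1 a2] //= rw ew E G PU.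
  + case: rw => w0 r1 r2; apply: PU (leqnSn _) _.
    by apply: push_ok G _ (weval_get ew (rp_lt H r1)) r1 _ => //; lia.
  + case: rw => w0 r1 r2; apply: PU (leqnSn _) _.
    apply: push_ok G _ (weval_get ew (rp_lt H r2)) r2 _ => //; lia.
  + case: rw => rw _; rewrite rw in ew; apply: PU (leqnn _) _.
    by apply: real_push_ok G _ (reval_ofW ew) _ => //; lia.
  + case: rw => rw _; rewrite rw in ew wB; apply: PU (leqnSn _) _.
    have lt : n %/ 2 < B by apply: leq_ltn_trans wB; exact: leq_div.
    apply: push_ok G _ _ (W0 _ lt) _ => //; first by lia.
    by apply: weval_div ew _ wB; apply: weval_const; lia.
  + case: ifP => // la; case: rw => rw _; rewrite rw in ew.
    apply: PU (leqnSn _) _.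
    have lt : words st a n < B by rewrite (invW H) // input_lt.
    rewrite -(invW H) //.
    apply: push_ok G _ (weval_get ew lt) (W0 _ lt) _ => //; lia.
  + case: ifP => // la; case: rw => rw _; rewrite rw in ew.
    apply: PU (leqnn _) _; rewrite -(invR H) //.
    by apply: real_push_ok G _ (reval_get a ew) _ => //; lia.
- move: iB => _; case: s rs E G W1 => [|v2 [|v1 s1]] //= _ E G W1.
  have [w1 e1 r1] := hd_ok G (erefl : onth [:: v2, v1 & s1] 1 = Some v1).
  have [w2 e2 r2] := hd_ok G (erefl : onth [:: v2, v1 & s1] 0 = Some v2).
  have PU f' c v' : f' <= f.+2 ->
      (exists k st', exec st c k st' /\
         good st' f' pc (v' :: drop 2 [:: v2, v1 & s1])) ->
      Some (pc.+1, v' :: s1) = Some (pc', s') ->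
    exists k st' f'', [/\ exec st (Seq c (goto pc.+1)) k st', good st' f'' pc' s'
      & f'' <= f.+2].
    by move=> le e; apply: W1 le _; move: e; rewrite /= drop0.
  have test b (t : test) : teval st t = Some b ->
      exists k st', exec st (If t (push (WConst 1) 2) (push (WConst 0) 2)) k st' /\
         good st' f.+1 pc (W b :: drop 2 [:: v2, v1 & s1]).
    move=> et.
    have [||||k [st' [e G']]] := push_ok G (j := 2) (x := WConst b) (v := W b) (w := b).
    - by lia.
    - by apply: weval_const; case: (b); lia.
    - by apply: W0; case: (b); lia.
    - by [].
    by do 2 eexists; split; [apply: exec_if et _; case: (b) e => e; exact: e|exact: G'].
  have RG j u r : weval st (hd j) = Some u -> rp st (X r) u ->
      reval st (RGet 3 (hd j)) = Some r.
    by move=> eu [_ <-]; exact: reval_get.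
  case: o.
  + move=> e; move: e; apply: PU (leqnn _) _.
    have G1 := good_cell w1 G (isT : 2 < 3 < 5).
    have X1 := ext_cell w1 H (isT : 2 < 3 < 5).
    set st1 := State _ _ in G1 X1.
    have [H1 _ _] := G1.
    have [y ey ry] := hd_ok G1 (erefl : onth [:: v2, v1 & s1] 0 = Some v2).
    have G2 := good_cell y G1 (isT : 2 < 4 < 5).
    have X2 := ext_cell y H1 (isT : 2 < 4 < 5).
    set st2 := State _ _ in G2 X2.
    have [|k [st3 [x3 G3 X3 U3]]] := incF_ok G2; first by lia.
    have [H3 _ _] := G3.
    have x1 : exec st (WSet 3 RegF (hd 1)) (wcost RegF + wcost (hd 1)).+1 st1.
      by apply: exec_wset => //; exact: weval_regF.
    have x2 : exec st1 (WSet 4 RegF (hd 0)) (wcost RegF + wcost (hd 0)).+1 st2.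
      by apply: exec_wset => //; exact: weval_regF.
    have rP : rp st3 (P v1 v2) f.
      have m3 : words st3 3 f = w1 by rewrite U3.2 //= /upd /= eqxx.
      have m4 : words st3 4 f = y by rewrite U3.2 //= /upd /= eqxx.
      have q1 := rp_ext X3 (rp_ext X2 (rp_ext X1 r1)).
      have q2 := rp_ext X3 (rp_ext X2 ry).
      rewrite /rp (invF H3) in q1 q2.
      rewrite /rp (invF H3); split; [|by rewrite m3|by rewrite m4].
      by have := inv0 H; lia.
    have [||l [st4 [x4 G4]]] := push_ok G3 (j := 2) _ (weval_last H3) rP.
    - by lia.
    - by [].
    by do 2 eexists; split; [exact: exec_seq (exec_seq x1 (exec_seq x2 x3)) x4|].
  + case: v1 r1 G test PU => [n1|x1|a1 a2] //= r1 G test PU.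
    case: v2 r2 G test PU => [n2|x2|a1 a2] //= r2 G test PU.
    case: r1 => r1 lt1; case: r2 => r2 _; rewrite r1 in e1; rewrite r2 in e2.
    apply: PU (leqnSn _) _.
    have lt : n1 - n2 < B by lia.
    by apply: push_ok G _ (weval_sub e1 e2 lt1) (W0 _ lt) _ => //; lia.
  + case: v1 r1 G test PU => [n1|x1|a1 a2] //= r1 G test PU.
    case: v2 r2 G test PU => [n2|x2|a1 a2] //= r2 G test PU.
    case: r1 => r1 lt1; case: r2 => r2 _; rewrite r1 in e1; rewrite r2 in e2.
    apply: PU (leqnSn _) _; apply: test.
    by rewrite /= e1 e2.
  + case: v1 r1 RG G test PU => [n1|x1|a1 a2] //= r1 RG G test PU.
    case: v2 r2 RG G test PU => [n2|x2|a1 a2] //= r2 RG G test PU.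
    apply: PU (leqnn _) _; apply: real_push_ok G _ _ _ => //; first by lia.
    by apply: lift2_some (RG _ _ _ e1 r1) (RG _ _ _ e2 r2).
  + case: v1 r1 RG G test PU => [n1|x1|a1 a2] //= r1 RG G test PU.
    case: v2 r2 RG G test PU => [n2|x2|a1 a2] //= r2 RG G test PU.
    apply: PU (leqnn _) _; apply: real_push_ok G _ _ _ => //; first by lia.
    by apply: lift2_some (RG _ _ _ e1 r1) (RG _ _ _ e2 r2).
  + case: v1 r1 RG G test PU => [n1|x1|a1 a2] //= r1 RG G test PU.
    case: v2 r2 RG G test PU => [n2|x2|a1 a2] //= r2 RG G test PU.
    apply: PU (leqnn _) _; apply: real_push_ok G _ _ _ => //; first by lia.
    by apply: lift2_some (RG _ _ _ e1 r1) (RG _ _ _ e2 r2).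
  + case: v1 r1 RG G test PU => [n1|x1|a1 a2] //= r1 RG G test PU.
    case: v2 r2 RG G test PU => [n2|x2|a1 a2] //= r2 RG G test PU.
    apply: PU (leqnn _) _; apply: real_push_ok G _ _ _ => //; first by lia.
    by apply: lift2_some (RG _ _ _ e1 r1) (RG _ _ _ e2 r2).
  + case: v1 r1 RG G test PU => [n1|x1|a1 a2] //= r1 RG G test PU.
    case: v2 r2 RG G test PU => [n2|x2|a1 a2] //= r2 RG G test PU.
    apply: PU (leqnSn _) _; apply: test.
    by apply: lift2_some (RG _ _ _ e1 r1) (RG _ _ _ e2 r2).
- move=> {W1}; case: s rs E G => [|v s1] //= rs E G [<- <-].
  have [w ew rw] := hd_ok G (erefl : onth (v :: s1) 0 = Some v).
  (* Addresses are positive, so comparing the word with 0 decides [truthy] without a type tag. *)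
  have tz : teval st (WEq (hd 0) (WConst 0)) = Some (~~ truthy v).
    rewrite /= ew weval_const; last by lia.
    rewrite /=; case: v rw {G rs ew} => [n|x|a1 a2] /=.
    + by case=> -> _; rewrite negbK.
    + by case=> /andP[w0 _] _; rewrite eqn0Ngt w0.
    + by case=> /andP[w0 _] _ _; rewrite eqn0Ngt w0.
  pose l' := if truthy v then pc.+1 else l.
  have l'B : l' < B by rewrite /l'; case: ifP.
  have [k [st1 [x1 G1]]] := goto_ok G l'B.
  have [H1 rs1 E1] := G1.
  have [y ey ry] := tl_ok G1 (isT : 1 <= size (v :: s1)).
  exists ((tcost (WEq (hd 0) (WConst 0)) + k).+1 + (1 + wcost (tls 1)).+1).
  exists (State (upd (words st1) 5 1 y) (reals st1)), f; split; last by lia.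
    apply: exec_seq.
      apply: exec_if tz _.
      by move: x1; rewrite /l'; case: (truthy v) => x1; exact: x1.
    by apply: exec_wset => //; apply: weval_const; lia.
  split; [exact: inv_reg| |by []].
  rewrite /= drop0 in ry.
  by apply: rp_ext ry; exact: ext_reg.
- case=> <- <-; have [k [st1 [x1 G1]]] := goto_ok G iB.
  by exists k, st1, f; split=> //; lia.
- case: s rs E G W1 => [|v [|u s1]] //= _ E G W1.
  have [w ew rw] := hd_ok G (erefl : onth [:: v, u & s1] 0 = Some v).
  move=> e; apply: (W1 f.+1 _ (v :: drop 2 [:: v, u & s1])) => //.
    by apply: push_ok G _ ew rw _ => //; lia.
  by rewrite /= drop0.
- move=> {W1}; case: s rs E G => [|v [|u [|[r|x|a1 a2] s1]]] //= _ E G [<- <-].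
  have [w ew rw] := hd_ok G (erefl : onth [:: v, u, W r & s1] 2 = Some (W r)).
  case: rw => rw rB; rewrite rw in ew.
  have G1 : good (State (upd (words st) 5 0 r) (reals st)) f r
      [:: v, u, W r & s1].
    case: G => H' rs' _; split; [exact: inv_reg| |by []].
    by apply: rp_ext rs'; exact: ext_reg.
  have [y ey ry] := hd_ok G1 (erefl : onth [:: v, u, W r & s1] 0 = Some v).
  have [|k [st2 [x2 G2]]] := push_ok G1 _ ey ry (isT : 3 <= size [:: v, u, W r & s1]).
    by lia.
  exists ((wcost (WConst 0) + wcost (hd 2)).+1 + k), st2, f.+1; split.
  + apply: exec_seq x2; apply: exec_wset => //.
    by apply: weval_const; lia.
  + by rewrite /= drop0 in G2.
  + by [].
Qed.

End Simulation.

(** * The interpreter loop and the output loop *)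

Fixpoint ccost (c : cmd) : nat :=
  match c with
  | Skip => 1
  | WSet _ i x => (wcost i + wcost x).+1
  | RSet _ i x => (wcost i + rcost x).+1
  | Seq c d => ccost c + ccost d
  | If b c d => (tcost b + (ccost c + ccost d)).+1
  | While _ _ => 0
  end.

Fixpoint loop_free (c : cmd) : bool :=
  match c with
  | Seq c d | If _ c d => loop_free c && loop_free d
  | While _ _ => false
  | _ => true
  end.

(** Without loops a command costs at most its size, whatever the state; so every round of the
    interpreter has the same constant bound. *)
Lemma exec_cost (R : realType) B (st st' : state R) c k :
  exec B st c k st' -> loop_free c -> k <= ccost c.
Proof.
elim=> {st c k st'} //=.
- by move=> st st1 st2 c d k l _ IH1 _ IH2 /andP[/IH1 h1 /IH2 h2]; lia.
- move=> st st' b c d v k _ _ IH /andP[l1 l2].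
  by case: v IH => IH; [have := IH l1|have := IH l2]; lia.
Qed.

(** The instruction is found by comparing the program counter with each address in turn; the program
    is fixed, so the search takes constant time. *)
Fixpoint disp (pc : nat) (code : seq instr) : cmd :=
  if code is i :: c then
    If (WEq RegPC (WConst pc)) (icmd i pc) (disp pc.+1 c)
  else Skip.

Definition main_loop (code : seq instr) : cmd :=
  While (WLt RegPC (WConst (size code))) (disp 0 code).

Definition out_loop : cmd :=
  While (WLt (WConst 0) RegS)
    (Seq (RSet 2 (WGet 3 (WGet 3 RegS)) (RGet 3 (WGet 4 (WGet 3 RegS))))
         (WSet 5 (WConst 1) (WGet 4 RegS))).

Definition ram (e : ex) : cmd :=
  Seq (WSet 5 (WConst 2) (WConst 1))
    (Seq (main_loop (program e))
      (Seq (WSet 5 (WConst 1) (WGet 3 RegS)) out_loop)).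

Lemma loop_free_disp pc c : loop_free (disp pc c).
Proof.
elim: c pc => //= i c IH pc; rewrite IH andbT.
by case: i => //; [case|case].
Qed.

Section Ram.
Variables (R : realType) (B : nat) (st0 : state R).
Local Notation val := (val R).
Local Notation exec := (@exec R B).
Hypothesis input_lt : forall a i, a < 3 -> words st0 a i < B.
Local Notation good := (@good R B st0).

Fixpoint out_val (l : seq (nat * R)) : val :=
  if l is p :: l' then P (P (W p.1) (X p.2)) (out_val l') else W 0.

Lemma teval_weq st x y a b :
  weval B st x = Some a -> weval B st y = Some b ->
  teval B (R := R) st (WEq x y) = Some (a == b).
Proof. exact: lift2_some. Qed.

Lemma teval_wlt st x y a b :
  weval B st x = Some a -> weval B st y = Some b ->
  teval B (R := R) st (WLt x y) = Some (a < b).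
Proof. exact: lift2_some. Qed.

Lemma weval_regPC st f pc s : good st f pc s -> pc < B ->
  weval B st RegPC = Some pc.
Proof.
case=> H _ E lt; rewrite /RegPC (@weval_get _ _ _ _ _ 0) ?E //.
by apply: weval_const; have := invB H; lia.
Qed.

Lemma disp_ok st f p j c s i pc' s' :
    good st f (p + j) s -> f + 6 < B -> p + size c < B ->
    all (fun i => imax i < B) c ->
    onth c j = Some i ->
    bstep (words st0) (reals st0) i (p + j) s = Some (pc', s') ->
  exists k st' f', [/\ exec st (disp p c) k st', good st' f' pc' s' & f' <= f.+2].
Proof.
elim: c p j => [|i0 c IH] p [|j] //= G fB pB /andP[iB cB].
  case=> e; rewrite e in iB *.
  rewrite !addn0 in G *; move=> bs.
  have [|k [st' [f' [x G' le]]]] := icmd_ok input_lt G fB _ iB bs; first by lia.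
  do 3 eexists; split; [apply: (exec_if (v := true)) x|exact: G'|exact: le].
  rewrite (teval_weq (weval_regPC G _) (weval_const _ _)) ?eqxx //; lia.
move=> ei bs; rewrite -!addSnnS in G bs *.
have [|k [st' [f' [x G' le]]]] := IH p.+1 j G fB _ cB ei bs; first by lia.
do 3 eexists; split; [apply: (exec_if (v := false)) x|exact: G'|exact: le].
have jc : j < size c by rewrite -onthTE ei.
rewrite (teval_weq (weval_regPC G _) (weval_const _ _)); [|lia|lia].
by congr Some; lia.
Qed.

Lemma main_loop_ok code st f n pc s s' :
    all (fun i => imax i < B) code -> size code < B ->
    good st f pc s -> f + 2 * n + 6 < B ->
    bsteps (words st0) (reals st0) code n (pc, s) (size code, s') ->
  exists k st' f',
    [/\ exec st (main_loop code) k st', good st' f' (size code) s',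
        f' <= f + 2 * n & k <= n.+1 * (ccost (disp 0 code) + 5)].
Proof.
move=> cB sB; elim: n st f pc s => [|n IH] st f pc s G fB bs.
  inversion bs; subst; exists (tcost (WLt RegPC (WConst (size code)))).+1, st, f.
  split=> //; [|by rewrite addn0|by rewrite /=; lia].
  apply: exec_while_false.
  by rewrite (teval_wlt (weval_regPC G _) (weval_const _ _)) ?ltnn.
inversion bs as [|? ? ? i [pc1 s1] ? ei si rest]; subst.
have lt : pc < size code by rewrite -onthTE ei.
have [|k [st1 [f1 [x1 G1 le1]]]] :=
  @disp_ok st f 0 pc code s i pc1 s1 G _ sB cB ei si; first by lia.
have [|l [st2 [f2 [x2 G2 le2 lel]]]] := IH st1 f1 pc1 s1 G1 _ rest; first by lia.
have kc := exec_cost x1 (loop_free_disp _ _).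
exists (tcost (WLt RegPC (WConst (size code))) + k + l).+1, st2, f2; split=> //.
- apply: exec_while_true x1 x2.
  by rewrite (teval_wlt (weval_regPC G _) (weval_const _ _)) ?lt //; lia.
- by lia.
- by rewrite mulSn /=; lia.
Qed.

Lemma out_loop_ok l st f : inv B st0 st f ->
    rp B st (out_val l) (words st 5 1) -> uniq (unzip1 l) ->
  exists k st', [/\ exec st out_loop k st', k <= (size l).+1 * 20,
    forall p, p \in l -> reals st' 2 p.1 = p.2 &
    forall i, i \notin unzip1 l -> reals st' 2 i = reals st 2 i].
Proof.
elim: l st => [|[i y] l IH] st H rl.
  move=> _; exists (tcost (WLt (WConst 0) RegS)).+1, st; split=> //.
  apply: exec_while_false; case: rl => rl _.
  have fB := invB H.
  have zB : 0 < B by lia.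
  have eS : weval B st RegS = Some (words st 5 1).
    by apply: weval_get; [apply: weval_const; lia|rewrite rl].
  by rewrite (teval_wlt (weval_const st zB) eS) rl.
case: (rl) => w0 [a0 [ri iB] [b0 ry]] rl' /= /andP[ni ul].
have fB := invB H.
have eS : weval B st RegS = Some (words st 5 1).
  by apply: weval_get; [apply: weval_const; lia|exact: rp_lt H rl].
have eP : weval B st (WGet 3 RegS) = Some (words st 3 (words st 5 1)).
  by apply: weval_get eS _; case: H => _ _ Ef _ _; rewrite Ef in a0; lia.
have eI : weval B st (WGet 3 (WGet 3 RegS)) = Some i.
  by rewrite (weval_get eP) ri.
have eX : weval B st (WGet 4 (WGet 3 RegS)) =
    Some (words st 4 (words st 3 (words st 5 1))).
  by apply: weval_get eP _; case: H => _ _ Ef _ _; rewrite Ef in b0; lia.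
pose st1 := State (words st) (upd (reals st) 2 i y).
pose st2 := State (upd (words st1) 5 1 (words st 4 (words st 5 1))) (reals st1).
have x1 : exec st (RSet 2 (WGet 3 (WGet 3 RegS)) (RGet 3 (WGet 4 (WGet 3 RegS))))
    (wcost (WGet 3 (WGet 3 RegS)) + rcost (RGet 3 (WGet 4 (WGet 3 RegS)))).+1 st1.
  by apply: exec_rset eI _; rewrite (reval_get _ eX) ry.
have H1 : inv B st0 st1 f.
  case: H => HW HR Ef f0 _; split=> // a j la; rewrite /st1 /= /upd.
  by case: eqP la => [->|_] //= la; exact: HR.
have X1 : ext st st1.
  by split=> // j _; rewrite /st1 /= /upd.
have rl1 := rp_ext X1 rl'.
have H2 : inv B st0 st2 f by exact: inv_reg.
have X2 : ext st1 st2 by exact: ext_reg.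
have rl2 : rp B st2 (out_val l) (words st2 5 1) by exact: rp_ext X2 rl1.
have x2 : exec st1 (WSet 5 (WConst 1) (WGet 4 RegS))
    (wcost (WConst 1) + wcost (WGet 4 RegS)).+1 st2.
  apply: exec_wset; first by apply: weval_const; lia.
  apply: (@weval_get _ _ st1 4 RegS (words st 5 1)); last exact: rp_lt H1 rl1.
  by apply: (@weval_get _ _ st1 5 _ 1); [apply: weval_const; lia|exact: rp_lt H rl].
have [k [st' [x le o1 o2]]] := IH st2 H2 rl2 ul.
exists (tcost (WLt (WConst 0) RegS) + ((wcost (WGet 3 (WGet 3 RegS)) +
  rcost (RGet 3 (WGet 4 (WGet 3 RegS)))).+1 +
  (wcost (WConst 1) + wcost (WGet 4 RegS)).+1) + k).+1, st'; split.
- apply: exec_while_true (exec_seq x1 x2) x.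
  have zB : 0 < B by lia.
  rewrite (teval_wlt (weval_const st zB) eS).
  by congr Some; case/andP: w0.
- by rewrite mulSn /=; lia.
- move=> p; rewrite inE => /orP[/eqP ->|/o1 //].
  by rewrite o2 // /st2 /= /upd !eqxx.
- move=> j; rewrite inE negb_or => /andP[nj /o2 ->].
  by rewrite /st2 /= /upd (negPf nj).
Qed.

Lemma ram_correct e k l :
    (forall i, words st0 5 i = 0) ->
    all (fun i => imax i < B) (program e) -> size (program e) < B ->
    2 * ((esz e).+3 * k.+1) + 7 < B ->
    runs (words st0) (reals st0) e (W 0) (out_val l) k -> uniq (unzip1 l) ->
  exists k' st', [/\ exec st0 (ram e) k' st',
    k' <= ((esz e).+3 * k.+1).+1 * (ccost (disp 0 (program e)) + 5) +
          20 * (size l) + 30 &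
    forall p, p \in l -> reals st' 2 p.1 = p.2].
Proof.
move=> z5 cB sB kB /program_correct [n ln bs] ul.
pose st1 := State (upd (words st0) 5 2 1) (reals st0).
have G1 : good st1 1 0 [::].
  split; [split=> //|split=> //|]; rewrite /st1 /= /upd /=; try by [].
  - by move=> a i la; case: eqP la => // ->.
  - by lia.
  - by lia.
have x1 : exec st0 (WSet 5 (WConst 2) (WConst 1)) 3 st1.
  by apply: (@exec_wset _ _ st0 5 (WConst 2) (WConst 1)); apply: weval_const; lia.
have [|k2 [st2 [f2 [x2 G2 le2 lk2]]]] := main_loop_ok cB sB G1 _ bs; first by lia.
have [w ew rw] := hd_ok G2 (erefl : onth [:: out_val l] 0 = Some (out_val l)).
have [H2 _ _] := G2.
pose st3 := State (upd (words st2) 5 1 w) (reals st2).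
have x3 : exec st2 (WSet 5 (WConst 1) (WGet 3 RegS))
    (wcost (WConst 1) + wcost (WGet 3 RegS)).+1 st3.
  by apply: exec_wset ew; apply: weval_const; lia.
have H3 : inv B st0 st3 f2 by exact: inv_reg.
have X3 : ext st2 st3 by exact: ext_reg.
have r3 : rp B st3 (out_val l) (words st3 5 1) by exact: rp_ext X3 rw.
have [k4 [st4 [x4 lk4 o4 _]]] := out_loop_ok H3 r3 ul.
do 2 eexists; split; [|idtac|exact: o4].
  exact: exec_seq x1 (exec_seq x2 (exec_seq x3 x4)).
have : n.+1 * (ccost (disp 0 (program e)) + 5) <=
  ((esz e).+3 * k.+1).+1 * (ccost (disp 0 (program e)) + 5).
  by rewrite leq_mul2r ltnS ln orbT.
have -> : (wcost (WConst 1) + wcost (WGet 3 RegS)).+1 = 5 by [].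
by move: lk2 lk4; rewrite mulnC; lia.
Qed.

End Ram.

(** * Trees of breakpoints *)

(** Builders take the number of variables in scope, so that the bound variables
    of the host language can stand for de Bruijn indices. *)
Definition bex := nat -> ex.
Definition lv (l : nat) : bex := fun d => EVar (Nat.sub d (S l)).
Definition cst (k : nat) : bex := fun _ => EConst k.
Definition ap1 (o : op1) (a : bex) : bex := fun d => EOp1 o (a d).
Definition ap2 (o : op2) (a b : bex) : bex := fun d => EOp2 o (a d) (b d).
Definition ite (c a b : bex) : bex := fun d => EIf (c d) (a d) (b d).
Definition letb (a : bex) (f : bex -> bex) : bex :=
  fun d => ELet (a d) (f (lv d) (S d)).
Definition call (b : ex) (a : bex) : bex := fun d => ERec b (a d).
Definition self (a : bex) : bex := fun d => ESelf (a d).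
Definition fn (f : bex -> bex) : ex := f (lv 0) 1.

Declare Scope bex_scope.
Delimit Scope bex_scope with bex.
Bind Scope bex_scope with bex.
Notation "'LET' x := a 'IN' b" := (letb a%bex (fun x => b%bex))
  (at level 200, x name, right associativity) : bex_scope.
Notation "'IF' c 'THEN' a 'ELSE' b" := (ite c%bex a%bex b%bex)
  (at level 200, right associativity) : bex_scope.
Notation "x [+] y" := (ap2 AddR x y) (at level 50, left associativity) : bex_scope.
Notation "x [-] y" := (ap2 SubR x y) (at level 50, left associativity) : bex_scope.
Notation "x [*] y" := (ap2 MulR x y) (at level 40, left associativity) : bex_scope.
Notation "x [/] y" := (ap2 DivR x y) (at level 40, left associativity) : bex_scope.
Notation "x [<] y" := (ap2 LtR x y) (at level 70) : bex_scope.
Notation "x [=] y" := (ap2 EqW x y) (at level 70) : bex_scope.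
Notation "<< x , .. , y , z >>" :=
  (ap2 Pair x .. (ap2 Pair y z) ..)
  (at level 0, x at level 199, y at level 199, z at level 199) : bex_scope.
Notation "x .f" := (ap1 Fst x) (at level 1, left associativity, format "x .f") : bex_scope.
Notation "x .s" := (ap1 Snd x) (at level 1, left associativity, format "x .s") : bex_scope.
Notation "# k" := (ap1 ToR (cst k)) (at level 1, format "# k") : bex_scope.

Ltac code_of t :=
  let t' := eval cbv [fn lv cst ap1 ap2 ite letb call self Nat.sub] in t in
  exact t'.

Lemma truthyE : (forall b : bool, (nat_of_bool b != 0) = b) * ((0 != 0) = false).
Proof. by split=> // -[]. Qed.

Ltac wps := cbn [wp onth sem1 sem2 truthy]; rewrite ?truthyE; cbn iota.
Lemma call_intro (R : realType) iw ir b (v w : val R) l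
    (Q : val R -> nat -> Prop) :
  runs iw ir b v w l -> Q w l -> exists w l, runs iw ir b v w l /\ Q w l.
Proof. by move=> h q; exists w, l. Qed.

Ltac fin := split; [reflexivity|lia].
Ltac wpcall H := apply: (call_intro H); wps.

Section Trees.
Variable R : realType.
Local Open Scope ring_scope.
Variables (iw : nat -> nat -> nat) (ir : nat -> nat -> R).
Local Notation val := (val R).
Local Notation runs := (runs iw ir).

(** [(N, T, Q)] stands for the polynomial [N x^2 - 2 T x + Q]. *)
Definition mom : Type := R * R * R.

Definition encm (a : mom) : val := P (X a.1.1) (P (X a.1.2) (X a.2)).

(** [c * (x - k)^2] in this encoding; [msh d] below substitutes [x - d] for [x]. *)
Definition point (k c : R) : mom := (c, c * k, c * k * k).
Definition msh (d : R) (a : mom) : mom :=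
  (a.1.1, a.1.2 + d * a.1.1, a.2 + 2 * d * a.1.2 + d * d * a.1.1).
Definition mg (a : mom) (x : R) : R := a.1.1 * x - a.1.2.
Definition mf (a : mom) (x : R) : R := a.1.1 * x * x - 2 * a.1.2 * x + a.2.

(** A search tree of events [(key, slope)]; the pending shift [o] applies to
    both children, [a] is the sum of the points, [w] is 2 to the height. *)
Inductive tr := Lf | Nd of R & mom & R & R & R & tr & tr.

Fixpoint enct (t : tr) : val :=
  match t with
  | Lf => W 0
  | Nd w a o k c l r =>
      P (X w) (P (encm a) (P (X o) (P (X k) (P (X c) (P (enct l) (enct r))))))
  end.

Definition wt (t : tr) : R := if t is Nd w _ _ _ _ _ _ then w else 1.
Definition tot (t : tr) : mom := if t is Nd _ a _ _ _ _ _ then a else (0, 0, 0).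
(** The key and the sum at the root are updated at once while the children lag behind by [o], so
    roots can be compared and summed without descending. *)
Definition sh (d : R) (t : tr) : tr :=
  if t is Nd w a o k c l r then Nd w (msh d a) (o + d) (k + d) c l r else Lf.
Definition madd (a b : mom) : mom := (a.1.1 + b.1.1, a.1.2 + b.1.2, a.2 + b.2).
Definition mk (l : tr) (k c : R) (r : tr) : tr :=
  Nd (2 * (if wt l < wt r then wt r else wt l))
     (madd (tot l) (madd (point k c) (tot r))) 0 k c l r.

Definition msh_b : ex := ltac:(code_of (fn (fun x =>
  LET d := x.f IN LET a := x.s IN
  << a.f, (a.s.f [+] (d [*] a.f)),
     ((a.s.s [+] (#2 [*] d [*] a.s.f)) [+] (d [*] d [*] a.f)) >>)%bex)).

Definition madd_b : ex := ltac:(code_of (fn (fun x =>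
  LET a := x.f IN LET b := x.s IN
  << (a.f [+] b.f), (a.s.f [+] b.s.f), (a.s.s [+] b.s.s) >>)%bex)).

Definition point_b : ex := ltac:(code_of (fn (fun x =>
  << x.s, (x.s [*] x.f), (x.s [*] x.f [*] x.f) >>)%bex)).

Definition sh_b : ex := ltac:(code_of (fn (fun x =>
  LET d := x.f IN LET t := x.s IN
  IF t THEN
    << t.f, call msh_b << d, t.s.f >>, (t.s.s.f [+] d), (t.s.s.s.f [+] d),
       t.s.s.s.s >>
  ELSE cst 0)%bex)).

Definition tot_b : ex := ltac:(code_of (fn (fun t =>
  IF t THEN t.s.f ELSE << #0, #0, #0 >>)%bex)).

Definition wt_b : ex := ltac:(code_of (fn (fun t =>
  IF t THEN t.f ELSE #1)%bex)).

Definition max_b : ex := ltac:(code_of (fn (fun x =>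
  IF x.f [<] x.s THEN x.s ELSE x.f)%bex)).

Definition mk_b : ex := ltac:(code_of (fn (fun x =>
  LET l := x.f IN LET k := x.s.f IN LET c := x.s.s.f IN LET r := x.s.s.s IN
  << (#2 [*] call max_b << call wt_b l, call wt_b r >>),
     call madd_b << call tot_b l,
                    call madd_b << call point_b << k, c >>, call tot_b r >> >>,
     #0, k, c, l, r >>)%bex)).

Definition bal_b : ex := ltac:(code_of (fn (fun x =>
  LET l := x.f IN LET k := x.s.f IN LET c := x.s.s.f IN LET r := x.s.s.s IN
  LET wl := call wt_b l IN LET wr := call wt_b r IN
  IF #2 [*] wr [<] wl THEN
    LET o := l.s.s.f IN LET n := l.s.s.s IN
    LET a := call sh_b << o, n.s.s.f >> IN
    LET b := call sh_b << o, n.s.s.s >> IN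
    IF call wt_b a [<] call wt_b b THEN
      LET o2 := b.s.s.f IN LET n2 := b.s.s.s IN
      call mk_b << call mk_b << a, n.f, n.s.f, call sh_b << o2, n2.s.s.f >> >>,
        n2.f, n2.s.f, call mk_b << call sh_b << o2, n2.s.s.s >>, k, c, r >> >>
    ELSE call mk_b << a, n.f, n.s.f, call mk_b << b, k, c, r >> >>
  ELSE IF #2 [*] wl [<] wr THEN
    LET o := r.s.s.f IN LET n := r.s.s.s IN
    LET a := call sh_b << o, n.s.s.f >> IN
    LET b := call sh_b << o, n.s.s.s >> IN
    IF call wt_b b [<] call wt_b a THEN
      LET o2 := a.s.s.f IN LET n2 := a.s.s.s IN
      call mk_b << call mk_b << l, k, c, call sh_b << o2, n2.s.s.f >> >>,
        n2.f, n2.s.f, call mk_b << call sh_b << o2, n2.s.s.s >>, n.f, n.s.f, b >> >>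
    ELSE call mk_b << call mk_b << l, k, c, a >>, n.f, n.s.f, b >>
  ELSE call mk_b x)%bex)).

Definition ins_b : ex := ltac:(code_of (fn (fun x =>
  LET k := x.f IN LET c := x.s.f IN LET t := x.s.s IN
  IF t THEN
    LET o := t.s.s.f IN LET n := t.s.s.s IN
    IF k [<] n.f THEN
      call bal_b << call sh_b << o, self << (k [-] o), c, n.s.s.f >> >>,
        n.f, n.s.f, call sh_b << o, n.s.s.s >> >>
    ELSE
      call bal_b << call sh_b << o, n.s.s.f >>, n.f, n.s.f,
        call sh_b << o, self << (k [-] o), c, n.s.s.s >> >> >>
  ELSE call mk_b << cst 0, k, c, cst 0 >>)%bex)).

(** Translates the keys above [m] by [d]. *)
Definition sgt_b : ex := ltac:(code_of (fn (fun x =>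
  LET m := x.f IN LET d := x.s.f IN LET t := x.s.s IN
  IF t THEN
    LET o := t.s.s.f IN LET n := t.s.s.s IN
    IF m [<] n.f THEN
      call mk_b << call sh_b << o, self << (m [-] o), d, n.s.s.f >> >>,
        (n.f [+] d), n.s.f, call sh_b << (o [+] d), n.s.s.s >> >>
    ELSE
      call mk_b << call sh_b << o, n.s.s.f >>, n.f, n.s.f,
        call sh_b << o, self << (m [-] o), d, n.s.s.s >> >> >>
  ELSE cst 0)%bex)).

Definition tsum_b : ex := ltac:(code_of (fn (fun x =>
  LET y := x.f IN LET t := x.s IN
  IF t THEN
    LET o := t.s.s.f IN LET n := t.s.s.s IN
    IF y [<] n.f THEN call msh_b << o, self << (y [-] o), n.s.s.f >> >>
    ELSE call madd_b << call msh_b << o, call tot_b n.s.s.f >>,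
      call madd_b << call point_b << n.f, n.s.f >>,
        call msh_b << o, self << (y [-] o), n.s.s.s >> >> >> >>
  ELSE << #0, #0, #0 >>)%bex)).

Definition addall_b : ex := ltac:(code_of (fn (fun x =>
  LET z := x.f IN LET off := x.s.f IN LET t := x.s.s.f IN LET acc := x.s.s.s IN
  IF t THEN
    LET o := off [+] t.s.s.f IN LET n := t.s.s.s IN
    self << z, o, n.s.s.s,
      call ins_b << (n.f [+] off), (z [*] n.s.f), self << z, o, n.s.s.f, acc >> >> >>
  ELSE acc)%bex)).

(** AVL rotations. Weights are powers of two, so [2 * wt r < wt l] says that the height of [l]
    exceeds that of [r] by at least 2. The results [Lf] never occur on valid trees. *)
Definition bal (l : tr) (k c : R) (r : tr) : tr :=
  if 2 * wt r < wt l then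
    if l is Nd _ _ o k1 c1 l1 r1 then
      if wt (sh o l1) < wt (sh o r1) then
        if sh o r1 is Nd _ _ o2 k2 c2 l2 r2 then
          mk (mk (sh o l1) k1 c1 (sh o2 l2)) k2 c2 (mk (sh o2 r2) k c r)
        else Lf
      else mk (sh o l1) k1 c1 (mk (sh o r1) k c r)
    else Lf
  else if 2 * wt l < wt r then
    if r is Nd _ _ o k1 c1 l1 r1 then
      if wt (sh o r1) < wt (sh o l1) then
        if sh o l1 is Nd _ _ o2 k2 c2 l2 r2 then
          mk (mk l k c (sh o2 l2)) k2 c2 (mk (sh o2 r2) k1 c1 (sh o r1))
        else Lf
      else mk (mk l k c (sh o l1)) k1 c1 (sh o r1)
    else Lf
  else mk l k c r.

Fixpoint ins (k c : R) (t : tr) : tr :=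
  if t is Nd _ _ o k1 c1 l r then
    if k < k1 then bal (sh o (ins (k - o) c l)) k1 c1 (sh o r)
    else bal (sh o l) k1 c1 (sh o (ins (k - o) c r))
  else mk Lf k c Lf.

Fixpoint sgt (m d : R) (t : tr) : tr :=
  if t is Nd _ _ o k c l r then
    if m < k then mk (sh o (sgt (m - o) d l)) (k + d) c (sh (o + d) r)
    else mk (sh o l) k c (sh o (sgt (m - o) d r))
  else Lf.

Fixpoint tsum (x : R) (t : tr) : mom :=
  if t is Nd _ _ o k c l r then
    if x < k then msh o (tsum (x - o) l)
    else madd (msh o (tot l)) (madd (point k c) (msh o (tsum (x - o) r)))
  else (0, 0, 0).

(** [z = 1] merges and [z = -1] cancels; [off] collects the pending shifts on the way down, so that
    [t] itself is not rewritten. *)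
Fixpoint addall (z off : R) (t acc : tr) : tr :=
  if t is Nd _ _ o k c l r then
    addall z (off + o) r (ins (k + off) (z * c) (addall z (off + o) l acc))
  else acc.

Fixpoint hg (t : tr) : nat :=
  if t is Nd _ _ _ _ _ l r then (maxn (hg l) (hg r)).+1 else 0.

Fixpoint nodes (t : tr) : nat :=
  if t is Nd _ _ _ _ _ l r then (nodes l + nodes r).+1 else 0.

Lemma msh_run d a : runs msh_b (P (X d) (encm a)) (encm (msh d a)) 0.
Proof. apply: runsI; rewrite /msh_b /encm; wps; fin. Qed.

Lemma madd_run a b : runs madd_b (P (encm a) (encm b)) (encm (madd a b)) 0.
Proof. by apply: runsI; rewrite /madd_b /encm; wps; fin. Qed.

Lemma point_run k c : runs point_b (P (X k) (X c)) (encm (point k c)) 0.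
Proof. by apply: runsI; rewrite /point_b /encm; wps; fin. Qed.

Lemma tot_run t : runs tot_b (enct t) (encm (tot t)) 0.
Proof.
by apply: runsI; rewrite /tot_b; case: t => [|w a o k c l r]; cbn [enct]; wps; fin.
Qed.

Lemma sh_run d t : runs sh_b (P (X d) (enct t)) (enct (sh d t)) 1.
Proof.
apply: runsI; rewrite /sh_b; case: t => [|w a o k c l r]; cbn [enct]; wps; first by fin.
by wpcall (msh_run d a); fin.
Qed.

Lemma wt_run t : runs wt_b (enct t) (X (wt t)) 0.
Proof.
by apply: runsI; rewrite /wt_b; case: t => [|w a o k c l r]; cbn [enct]; wps; fin.
Qed.

Lemma max_run a b : runs max_b (P (X a) (X b)) (X (if a < b then b else a)) 0.
Proof. by apply: runsI; rewrite /max_b; wps; case: (a < b); fin. Qed.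

Lemma mk_run l k c r :
  runs mk_b (P (enct l) (P (X k) (P (X c) (enct r)))) (enct (mk l k c r)) 8.
Proof.
apply: runsI; rewrite /mk_b; wps.
wpcall (wt_run l); wpcall (wt_run r); wpcall (max_run (wt l) (wt r)).
wpcall (tot_run l); wpcall (point_run k c); wpcall (tot_run r).
wpcall (madd_run (point k c) (tot r)).
by wpcall (madd_run (tot l) (madd (point k c) (tot r))); fin.
Qed.

Definition shl (d : R) (s : seq (R * R)) := [seq (e.1 + d, e.2) | e <- s].

Fixpoint evs (t : tr) : seq (R * R) :=
  if t is Nd _ _ o k c l r then shl o (evs l) ++ (k, c) :: shl o (evs r)
  else [::].

Definition msum (s : seq (R * R)) : mom :=
  foldr (fun e a => madd (point e.1 e.2) a) (0, 0, 0) s.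

Lemma momP (a b : mom) :
  a.1.1 = b.1.1 -> a.1.2 = b.1.2 -> a.2 = b.2 -> a = b.
Proof. by case: a b => [[? ?] ?] [[? ?] ?] /= -> -> ->. Qed.

Lemma msum_cat s1 s2 : msum (s1 ++ s2) = madd (msum s1) (msum s2).
Proof.
by elim: s1 => [|e s IH]; apply: momP; rewrite /= ?IH /=; ring.
Qed.

Lemma msum_shl d s : msum (shl d s) = msh d (msum s).
Proof.
by elim: s => [|e s IH]; apply: momP; rewrite /= ?IH /=; ring.
Qed.

Lemma shl0 s : shl 0 s = s.
Proof. by rewrite /shl -[RHS]map_id; apply: eq_map => -[k c]; rewrite /= addr0. Qed.

Lemma evs_sh d t : evs (sh d t) = shl d (evs t).
Proof.
case: t => //= w a o k c l r.
by rewrite /shl map_cat /= -!map_comp; congr (_ ++ _ :: _);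
  apply: eq_map => e; rewrite /= addrA.
Qed.

Lemma evs_mk l k c r : evs (mk l k c r) = evs l ++ (k, c) :: evs r.
Proof. by rewrite /= !shl0. Qed.

Fixpoint ok (t : tr) : Prop :=
  if t is Nd w a o k c l r then
    [/\ w = 2 ^+ hg t, a = msum (evs t),
        (hg l <= (hg r).+1)%N && (hg r <= (hg l).+1)%N, ok l & ok r]
  else True.

Lemma wt_ok t : ok t -> wt t = 2 ^+ hg t.
Proof. by case: t => [|w a o k c l r] //= []. Qed.

Lemma tot_ok t : ok t -> tot t = msum (evs t).
Proof. by case: t => [|w a o k c l r] //= []. Qed.

Lemma hg_sh d t : hg (sh d t) = hg t.
Proof. by case: t. Qed.

Lemma ok_sh d t : ok t -> ok (sh d t).
Proof.
case: t => //= w a o k c l r [-> -> b kl kr]; split=> //.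
rewrite -msum_shl; congr msum.
exact: esym (evs_sh d (Nd (2 ^+ hg (Nd 0 (0, 0, 0) o k c l r)) (0, 0, 0) o k c l r)).
Qed.

Lemma pow2_lt (m p : nat) : (2 ^+ m < 2 ^+ p :> R) = (m < p)%N.
Proof. by rewrite ltr_eXn2l // ltr1n. Qed.

Lemma ok_mk l k c r : ok l -> ok r ->
  (hg l <= (hg r).+1)%N && (hg r <= (hg l).+1)%N -> ok (mk l k c r).
Proof.
move=> kl kr b; rewrite /mk /= !shl0; split=> //.
  rewrite !wt_ok // pow2_lt exprS; congr (_ * _).
  by case: ltnP => h; congr (_ ^+ _); lia.
by rewrite !tot_ok // msum_cat /=.
Qed.

Lemma hg_mk l k c r : hg (mk l k c r) = (maxn (hg l) (hg r)).+1.
Proof. by []. Qed.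

(** The height can only lack the extra level after a rotation, hence the imbalance in the second
    case; insertion uses this to show that it never lowers the height. *)
Variant bal_spec l k c r : tr -> Prop :=
| BalSpec t : evs t = evs l ++ (k, c) :: evs r -> ok t ->
    hg t = (maxn (hg l) (hg r)).+1 \/
      hg t = maxn (hg l) (hg r) /\
      (hg l = (hg r).+2 \/ hg r = (hg l).+2) ->
    runs bal_b (P (enct l) (P (X k) (P (X c) (enct r)))) (enct t) 60 ->
    bal_spec l k c r t.

Lemma bal_ok l k c r : ok l -> ok r ->
    (hg l <= (hg r).+2)%N -> (hg r <= (hg l).+2)%N ->
  bal_spec l k c r (bal l k c r).
Proof.
move=> kl kr h1 h2.
have E1 : (2 * wt r < wt l) = ((hg r).+1 < hg l)%N.
  by rewrite !wt_ok // -exprS pow2_lt.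
have E2 : (2 * wt l < wt r) = ((hg l).+1 < hg r)%N.
  by rewrite !wt_ok // -exprS pow2_lt.
have [g1|g1] := ltnP (hg r).+1 (hg l).
  have B1 := E1; rewrite g1 in B1.
  case: l kl h1 h2 E1 E2 g1 B1 => // wl al ol k1 c1 l1 r1 kl h1 h2 E1 E2 g1 B1.
  have [_ _ /andP[b1 b2] kl1 kr1] := kl.
  have E3 : (wt (sh ol l1) < wt (sh ol r1)) = (hg l1 < hg r1)%N.
    by rewrite !wt_ok ?pow2_lt ?hg_sh //; exact: ok_sh.
  rewrite /bal B1 E3; case: ltnP => g3.
    case Er : (sh ol r1) => [|w2 a2 o2 k2 c2 l2 r2].
      by move: g3; rewrite -(hg_sh ol r1) Er.
    have := ok_sh ol kr1; rewrite Er => -[_ _ /andP[b3 b4] kl2 kr2].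
    have hr1 : hg r1 = (maxn (hg l2) (hg r2)).+1 by rewrite -(hg_sh ol r1) Er.
    have ER : evs (sh ol r1) = shl o2 (evs l2) ++ (k2, c2) :: shl o2 (evs r2).
      by rewrite Er.
    have okA := ok_mk k1 c1 (ok_sh ol kl1) (ok_sh o2 kl2).
    have okB := ok_mk k c (ok_sh o2 kr2) kr.
    have {}okA := okA ltac:(rewrite !hg_sh /= in h1 g1 *; lia).
    have {}okB := okB ltac:(rewrite !hg_sh /= in h1 g1 *; lia).
    apply: BalSpec.
    - by rewrite !evs_mk !evs_sh /= -(evs_sh ol r1) ER -!catA /= -?catA.
    - apply: (ok_mk _ _ okA okB).
      by rewrite !hg_mk !hg_sh /= in h1 g1 *; lia.
    - by rewrite !hg_mk !hg_sh /= in h1 g1 *; lia.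
    - apply: runsI; rewrite /bal_b; cbn [enct]; wps.
      wpcall (wt_run (Nd wl al ol k1 c1 l1 r1)); wpcall (wt_run r).
      rewrite B1; wpcall (sh_run ol l1); wpcall (sh_run ol r1).
      wpcall (wt_run (sh ol l1)); wpcall (wt_run (sh ol r1)).
      rewrite E3 g3 Er; cbn [enct]; wps.
      wpcall (sh_run o2 l2); wpcall (mk_run (sh ol l1) k1 c1 (sh o2 l2)).
      wpcall (sh_run o2 r2); wpcall (mk_run (sh o2 r2) k c r).
      wpcall (mk_run (mk (sh ol l1) k1 c1 (sh o2 l2)) k2 c2 (mk (sh o2 r2) k c r)).
      fin.
  have okB := ok_mk k c (ok_sh ol kr1) kr.
  have {}okB := okB ltac:(rewrite !hg_sh /= in h1 g1 *; lia).
  apply: BalSpec.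
  - by rewrite !evs_mk !evs_sh /= -!catA.
  - apply: (ok_mk _ _ (ok_sh ol kl1) okB).
    by rewrite !hg_mk !hg_sh /= in h1 g1 *; lia.
  - by rewrite !hg_mk !hg_sh /= in h1 g1 *; lia.
  - apply: runsI; rewrite /bal_b; cbn [enct]; wps.
    wpcall (wt_run (Nd wl al ol k1 c1 l1 r1)); wpcall (wt_run r).
    rewrite B1; wpcall (sh_run ol l1); wpcall (sh_run ol r1).
    wpcall (wt_run (sh ol l1)); wpcall (wt_run (sh ol r1)).
    rewrite E3 (leq_gtF g3); wps.
    wpcall (mk_run (sh ol r1) k c r).
    wpcall (mk_run (sh ol l1) k1 c1 (mk (sh ol r1) k c r)).
    fin.
have B0 : (2 * wt r < wt l) = false by rewrite E1; lia.
have [g2|g2] := ltnP (hg l).+1 (hg r).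
  have B1 := E2; rewrite g2 in B1.
  case: r kr h1 h2 E1 E2 g1 g2 B0 B1 => // wr ar ol k1 c1 l1 r1 kr h1 h2 E1 E2 g1 g2 B0 B1.
  have [_ _ /andP[b1 b2] kl1 kr1] := kr.
  have E3 : (wt (sh ol r1) < wt (sh ol l1)) = (hg r1 < hg l1)%N.
    by rewrite !wt_ok ?pow2_lt ?hg_sh //; exact: ok_sh.
  rewrite /bal B0 B1 E3; case: ltnP => g3.
    case Er : (sh ol l1) => [|w2 a2 o2 k2 c2 l2 r2].
      by move: g3; rewrite -(hg_sh ol l1) Er.
    have := ok_sh ol kl1; rewrite Er => -[_ _ /andP[b3 b4] kl2 kr2].
    have hr1 : hg l1 = (maxn (hg l2) (hg r2)).+1 by rewrite -(hg_sh ol l1) Er.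
    have ER : evs (sh ol l1) = shl o2 (evs l2) ++ (k2, c2) :: shl o2 (evs r2).
      by rewrite Er.
    have okA := ok_mk k c kl (ok_sh o2 kl2).
    have okB := ok_mk k1 c1 (ok_sh o2 kr2) (ok_sh ol kr1).
    have {}okA := okA ltac:(rewrite !hg_sh /= in h2 g2 *; lia).
    have {}okB := okB ltac:(rewrite !hg_sh /= in h2 g2 *; lia).
    apply: BalSpec.
    - by rewrite !evs_mk !evs_sh /= -(evs_sh ol l1) ER -!catA /= -?catA.
    - apply: (ok_mk _ _ okA okB).
      by rewrite !hg_mk !hg_sh /= in h2 g2 *; lia.
    - by rewrite !hg_mk !hg_sh /= in h2 g2 *; lia.
    - apply: runsI; rewrite /bal_b; cbn [enct]; wps.
      wpcall (wt_run l); wpcall (wt_run (Nd wr ar ol k1 c1 l1 r1)).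
      rewrite B0 B1; wps; wpcall (sh_run ol l1); wpcall (sh_run ol r1).
      wpcall (wt_run (sh ol r1)); wpcall (wt_run (sh ol l1)).
      rewrite E3 g3 Er; cbn [enct]; wps.
      wpcall (sh_run o2 l2); wpcall (mk_run l k c (sh o2 l2)).
      wpcall (sh_run o2 r2); wpcall (mk_run (sh o2 r2) k1 c1 (sh ol r1)).
      wpcall (mk_run (mk l k c (sh o2 l2)) k2 c2 (mk (sh o2 r2) k1 c1 (sh ol r1))).
      fin.
  have okA := ok_mk k c kl (ok_sh ol kl1).
  have {}okA := okA ltac:(rewrite !hg_sh /= in h2 g2 *; lia).
  apply: BalSpec.
  - by rewrite !evs_mk !evs_sh /= -!catA.
  - apply: (ok_mk _ _ okA (ok_sh ol kr1)).
    by rewrite !hg_mk !hg_sh /= in h2 g2 *; lia.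
  - by rewrite !hg_mk !hg_sh /= in h2 g2 *; lia.
  - apply: runsI; rewrite /bal_b; cbn [enct]; wps.
    wpcall (wt_run l); wpcall (wt_run (Nd wr ar ol k1 c1 l1 r1)).
    rewrite B0 B1; wps; wpcall (sh_run ol l1); wpcall (sh_run ol r1).
    wpcall (wt_run (sh ol r1)); wpcall (wt_run (sh ol l1)).
    rewrite E3 (leq_gtF g3); wps.
    wpcall (mk_run l k c (sh ol l1)).
    wpcall (mk_run (mk l k c (sh ol l1)) k1 c1 (sh ol r1)).
    fin.
have B1 : (2 * wt l < wt r) = false by rewrite E2; lia.
rewrite /bal B0 B1; apply: BalSpec.
- exact: evs_mk.
- by apply: ok_mk => //; lia.
- by left.
- apply: runsI; rewrite /bal_b; wps.
  wpcall (wt_run l); wpcall (wt_run r); rewrite B0 B1; wps.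
  by wpcall (mk_run l k c r); fin.
Qed.

End Trees.

Arguments Lf {R}.
Arguments mk : simpl never.
Arguments bal : simpl never.
Arguments sh : simpl never.

(** * Sorted trees: insertion *)

Section Insertion.
Variable R : realType.
Local Open Scope ring_scope.
Variables (iw : nat -> nat -> nat) (ir : nat -> nat -> R).
Local Notation runs := (runs iw ir).
Local Notation sh_run := (sh_run iw ir).
Local Notation mk_run := (mk_run iw ir).

Definition lek (x y : R * R) : bool := x.1 <= y.1.
Definition srt (s : seq (R * R)) : bool := pairwise lek s.

Lemma srt_node s1 k c s2 :
  srt (s1 ++ (k, c) :: s2) =
  [&& all (fun e => e.1 <= k) s1, all (fun e => k <= e.1) s2, srt s1 & srt s2].
Proof.
rewrite /srt pairwise_cat /= allrel_consr.
have E1 : all (lek^~ (k, c)) s1 = all (fun e => e.1 <= k) s1 by [].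
have E2 : all (lek (k, c)) s2 = all (fun e => k <= e.1) s2 by [].
rewrite E1 E2; case: allP => //= h1; case: allP => //= h2; last first.
  by rewrite !andbF.
have -> : allrel lek s1 s2.
  apply/allrelP => x y /h1 xk /h2 ky; exact: le_trans xk ky.
by [].
Qed.

Lemma all_shl (p : pred (R * R)) d (s : seq (R * R)) :
  all p (shl d s) = all (fun e => p (e.1 + d, e.2)) s.
Proof. by rewrite all_map. Qed.

Lemma srt_shl d (s : seq (R * R)) : srt (shl d s) = srt s.
Proof.
by rewrite /srt pairwise_map; apply: eq_pairwise => x y; rewrite /lek /= lerD2r.
Qed.

Lemma perm_shl d (s1 s2 : seq (R * R)) : perm_eq s1 s2 -> perm_eq (shl d s1) (shl d s2).
Proof. exact: perm_map. Qed.

Lemma ins_ok k c t : ok t -> srt (evs t) ->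
  [/\ ok (ins k c t), perm_eq (evs (ins k c t)) ((k, c) :: evs t),
      srt (evs (ins k c t)), (hg t <= hg (ins k c t) <= (hg t).+1)%N &
      runs ins_b (P (X k) (P (X c) (enct t))) (enct (ins k c t))
        (70 * (hg t).+1)].
Proof.
elim: t k => [|w a o k1 c1 l IHl r IHr] k.
  move=> _ _; split=> //; first exact: ok_mk.
  apply: runsI; rewrite /ins_b; cbn [enct]; wps.
  by wpcall (mk_run Lf k c Lf); fin.
move=> okt; have [_ _ /andP[b1 b2] kl kr] := okt.
rewrite [evs _]/= srt_node !all_shl !srt_shl => /and4P[al ar sl sr].
rewrite [ins _ _ _]/=; case: (ltP k k1) => kk.
  have [okI pI sI /andP[hI1 hI2] rI] := IHl (k - o) kl sl.
  have eI : perm_eq (shl o (evs (ins (k - o) c l))) ((k, c) :: shl o (evs l)).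
    by have := perm_shl o pI; rewrite /= subrK.
  case: (@bal_ok R iw ir (sh o (ins (k - o) c l)) k1 c1 (sh o r)).
  - exact: ok_sh.
  - exact: ok_sh.
  - by rewrite !hg_sh; lia.
  - by rewrite !hg_sh; lia.
  move=> t' E okt' ht' rt'; rewrite !evs_sh !hg_sh in E ht'.
  split=> //.
  - by rewrite E /= -cat_cons perm_cat2r.
  - rewrite E srt_node srt_shl sI srt_shl sr !all_shl ar !andbT.
    by rewrite -(all_shl (fun e => e.1 <= k1)) (perm_all _ eI) /= ltW //= all_shl.
  - by rewrite /=; lia.
  - apply: runsI; rewrite /ins_b; cbn [enct]; wps.
    rewrite kk; wps.
    wpcall rI; wpcall (sh_run o (ins (k - o) c l)); wpcall (sh_run o r).
    wpcall rt'; split=> //; rewrite /=; lia.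
have [okI pI sI /andP[hI1 hI2] rI] := IHr (k - o) kr sr.
have eI : perm_eq (shl o (evs (ins (k - o) c r))) ((k, c) :: shl o (evs r)).
  by have := perm_shl o pI; rewrite /= subrK.
case: (@bal_ok R iw ir (sh o l) k1 c1 (sh o (ins (k - o) c r))).
- exact: ok_sh.
- exact: ok_sh.
- by rewrite !hg_sh; lia.
- by rewrite !hg_sh; lia.
move=> t' E okt' ht' rt'; rewrite !evs_sh !hg_sh in E ht'.
split=> //.
- rewrite E /=; apply: perm_trans (_ : perm_eq _ (shl o (evs l) ++
    [:: (k1, c1), (k, c) & shl o (evs r)])) _.
    by rewrite perm_cat2l perm_cons.
  apply/permP => p; rewrite /= !count_cat /= [(p (k1, c1) + (_ + _))%N]addnCA.
  by rewrite addnCA.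
- rewrite E srt_node srt_shl sl srt_shl sI !all_shl al !andbT.
  by rewrite -(all_shl (fun e => k1 <= e.1)) (perm_all _ eI) /= kk all_shl.
- by rewrite /=; lia.
- apply: runsI; rewrite /ins_b; cbn [enct]; wps.
  rewrite (le_gtF kk); wps.
  wpcall (sh_run o l); wpcall rI; wpcall (sh_run o (ins (k - o) c r)).
  wpcall rt'; split=> //; rewrite /=; lia.
Qed.

End Insertion.

(** * Sorted trees: translation, prefix sums and bulk insertion *)

Section Traversals.
Variable R : realType.
Local Open Scope ring_scope.
Variables (iw : nat -> nat -> nat) (ir : nat -> nat -> R).
Local Notation runs := (runs iw ir).
Local Notation tr := (tr R).
Local Notation mom := (mom R).
Local Notation ins_ok := (ins_ok iw ir).
Local Notation msh_run := (msh_run iw ir).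
Local Notation madd_run := (madd_run iw ir).
Local Notation point_run := (point_run iw ir).
Local Notation tot_run := (tot_run iw ir).
Local Notation sh_run := (sh_run iw ir).
Local Notation mk_run := (mk_run iw ir).

Definition move_gt (m d : R) (e : R * R) : R * R :=
  if m < e.1 then (e.1 + d, e.2) else e.

(** Moving everything beyond [m] by [d >= 0] preserves the order. When the root key exceeds [m], its
    right subtree moves as a whole through its pending shift, so a single path is visited. *)
Lemma sgt_ok m d t : 0 <= d -> ok t -> srt (evs t) ->
  [/\ ok (sgt m d t), evs (sgt m d t) = map (move_gt m d) (evs t),
      srt (evs (sgt m d t)), hg (sgt m d t) = hg t &
      runs sgt_b (P (X m) (P (X d) (enct t))) (enct (sgt m d t))
        (20 * (hg t).+1)].
Proof.
move=> d0; elim: t m => [|w a o k c l IHl r IHr] m.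
  by move=> _ _; split=> //; apply: runsI; rewrite /sgt_b; cbn [enct]; wps; fin.
move=> okt; have [_ _ b kl kr] := okt.
rewrite [evs _]/= srt_node !all_shl !srt_shl => /and4P[al ar sl sr].
rewrite [sgt _ _ _]/=.
have mv s : map (move_gt m d) (shl o s) = shl o (map (move_gt (m - o) d) s).
  rewrite /shl -!map_comp; apply: eq_map => e; rewrite /move_gt /= ltrBlDr.
  by case: ifP => //= _; rewrite addrAC.
have mono s : srt s -> srt (map (move_gt m d) s).
  rewrite /srt pairwise_map; apply: sub_pairwise => x y; rewrite /lek /move_gt /=.
  by case: (ltP m x.1) => h1; case: (ltP m y.1) => h2 /= h3; lra.
case: (ltP m k) => mk'.
  have [okI eI sI hI rI] := IHl (m - o) kl sl.
  have ev : evs (mk (sh o (sgt (m - o) d l)) (k + d) c (sh (o + d) r)) =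
      map (move_gt m d) (shl o (evs l) ++ (k, c) :: shl o (evs r)).
    rewrite evs_mk !evs_sh eI map_cat /= mv /move_gt /= mk'; congr (_ ++ _ :: _).
    rewrite /shl -map_comp; apply/eq_in_map => e /(allP ar) /= le.
    by rewrite (lt_le_trans mk' le) addrA.
  split=> //.
  - by apply: ok_mk; [exact: ok_sh|exact: ok_sh|rewrite !hg_sh hI].
  - rewrite ev; apply: mono.
    by rewrite srt_node !all_shl !srt_shl al ar sl sr.
  - by rewrite hg_mk !hg_sh hI.
  - apply: runsI; rewrite /sgt_b; cbn [enct]; wps; rewrite mk'; wps.
    wpcall rI; wpcall (sh_run o (sgt (m - o) d l)).
    wpcall (sh_run (o + d) r).
    wpcall (mk_run (sh o (sgt (m - o) d l)) (k + d) c (sh (o + d) r)).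
    split=> //; rewrite /=; lia.
have [okI eI sI hI rI] := IHr (m - o) kr sr.
have ev : evs (mk (sh o l) k c (sh o (sgt (m - o) d r))) =
    map (move_gt m d) (shl o (evs l) ++ (k, c) :: shl o (evs r)).
  rewrite evs_mk !evs_sh eI map_cat /= -mv /move_gt /= (le_gtF mk').
  congr (_ ++ _ :: _).
  rewrite /shl -map_comp; apply/eq_in_map => e /(allP al) /= le.
  by rewrite (le_gtF (le_trans le mk')).
split=> //.
- by apply: ok_mk; [exact: ok_sh|exact: ok_sh|rewrite !hg_sh hI].
- rewrite ev; apply: mono.
  by rewrite srt_node !all_shl !srt_shl al ar sl sr.
- by rewrite hg_mk !hg_sh hI.
- apply: runsI; rewrite /sgt_b; cbn [enct]; wps; rewrite (le_gtF mk'); wps.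
  wpcall (sh_run o l).
  wpcall rI; wpcall (sh_run o (sgt (m - o) d r)).
  wpcall (mk_run (sh o l) k c (sh o (sgt (m - o) d r))).
  split=> //; rewrite /=; lia.
Qed.

Definition upto (x : R) (s : seq (R * R)) : mom := msum [seq e <- s | e.1 <= x].

Lemma madd0 (a : mom) : madd (0, 0, 0) a = a.
Proof. by apply: momP; rewrite /= add0r. Qed.

Lemma madd0r (a : mom) : madd a (0, 0, 0) = a.
Proof. by apply: momP; rewrite /= addr0. Qed.

Lemma upto_cat x (s1 s2 : seq (R * R)) : upto x (s1 ++ s2) = madd (upto x s1) (upto x s2).
Proof. by rewrite /upto filter_cat msum_cat. Qed.

Lemma upto_cons x e s :
  upto x (e :: s) = if e.1 <= x then madd (point e.1 e.2) (upto x s) else upto x s.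
Proof. by rewrite /upto /=; case: ifP. Qed.

Lemma upto_shl x d (s : seq (R * R)) : upto x (shl d s) = msh d (upto (x - d) s).
Proof.
rewrite /upto -msum_shl; congr msum; rewrite /shl filter_map.
by congr map; apply: eq_filter => e; rewrite /= lerBrDr.
Qed.

Lemma upto_none x (s : seq (R * R)) : all (fun e => x < e.1) s -> upto x s = (0, 0, 0).
Proof.
move=> h; rewrite /upto; suff -> : [seq e <- s | e.1 <= x] = [::] by [].
apply/eqP; rewrite -[_ == _]negbK -has_filter; apply/hasPn => e /(allP h).
by rewrite ltNge.
Qed.

Lemma upto_all x (s : seq (R * R)) : all (fun e => e.1 <= x) s -> upto x s = msum s.
Proof. by move=> /all_filterP h; rewrite /upto h. Qed.

Lemma tsum_ok x t : ok t -> srt (evs t) ->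
  tsum x t = upto x (evs t) /\
  runs tsum_b (P (X x) (enct t)) (encm (tsum x t)) (10 * (hg t).+1).
Proof.
elim: t x => [|w a o k c l IHl r IHr] x.
  by move=> _ _; split=> //; apply: runsI; rewrite /tsum_b; cbn [enct]; wps; fin.
move=> okt; have [_ _ b kl kr] := okt.
rewrite [evs _]/= srt_node !all_shl !srt_shl => /and4P[al ar sl sr].
rewrite [tsum _ _]/=; case: (ltP x k) => xk.
  have [E rn] := IHl (x - o) kl sl; split.
    rewrite upto_cat upto_cons /= (lt_geF xk) (upto_none (s := shl o (evs r))).
      by rewrite madd0r upto_shl E.
    by rewrite all_shl; apply: sub_all ar => e /= h; exact: lt_le_trans xk h.
  apply: runsI; rewrite /tsum_b; cbn [enct]; wps; rewrite xk; wps.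
  wpcall rn; wpcall (msh_run o (tsum (x - o) l)).
  by split=> //; rewrite /=; lia.
have [E rn] := IHr (x - o) kr sr; split.
  rewrite upto_cat upto_cons /= xk (upto_all (s := shl o (evs l))).
    by rewrite msum_shl upto_shl E tot_ok.
  by rewrite all_shl; apply: sub_all al => e /= h; exact: le_trans h xk.
apply: runsI; rewrite /tsum_b; cbn [enct]; wps; rewrite (le_gtF xk); wps.
wpcall (tot_run l); wpcall (msh_run o (tot l)).
wpcall (point_run k c).
wpcall rn; wpcall (msh_run o (tsum (x - o) r)).
wpcall (madd_run (point k c) (msh o (tsum (x - o) r))).
wpcall (madd_run (msh o (tot l))
  (madd (point k c) (msh o (tsum (x - o) r)))).
by split=> //; rewrite /=; lia.
Qed.

Definition scale (z : R) (s : seq (R * R)) := [seq (e.1, z * e.2) | e <- s].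

Lemma addall_ok z off t acc : ok acc -> srt (evs acc) ->
  [/\ ok (addall z off t acc),
      perm_eq (evs (addall z off t acc)) (shl off (scale z (evs t)) ++ evs acc),
      srt (evs (addall z off t acc)) & (hg acc <= hg (addall z off t acc))%N].
Proof.
elim: t off acc => [|w a o k c l IHl r IHr] off acc oka sa.
  by rewrite /=; split.
rewrite [addall _ _ _ _]/=.
set a1 := addall z (off + o) l acc.
set a2 := ins (k + off) (z * c) a1.
have [ok1 p1 s1 g1] := IHl (off + o) acc oka sa.
have [ok2 p2 s2 /andP[g2 _] _] := ins_ok (k + off) (z * c) ok1 s1.
have [ok3 p3 s3 g3] := IHr (off + o) a2 ok2 s2.
split=> //; last by apply: leq_trans g1 (leq_trans g2 g3).
have E s : shl off (scale z (shl o s)) = shl (off + o) (scale z s).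
  rewrite /shl /scale -!map_comp; apply: eq_map => e /=.
  by rewrite -addrA (addrC o).
have -> : shl off (scale z (evs (Nd w a o k c l r))) =
    shl (off + o) (scale z (evs l)) ++
    (k + off, z * c) :: shl (off + o) (scale z (evs r)).
  by rewrite -!E /scale [evs _]/= {1}/shl !map_cat.
apply/permP => q.
rewrite (permP p3) count_cat (permP p2) /= (permP p1) !count_cat /=.
move: (nat_of_bool (q _)) (count q _) (count q _) (count q _) => b x y v.
by lia.
Qed.

(** Insertion never lowers the height, so the final height bounds that of all intermediate trees and
    thereby the cost of each insertion. *)
Lemma addall_run z off t acc H : ok acc -> srt (evs acc) ->
    (hg (addall z off t acc) <= H)%N ->
  runs addall_b (P (X z) (P (X off) (P (enct t) (enct acc))))
        (enct (addall z off t acc)) (80 * H.+1 * nodes t).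
Proof.
elim: t off acc => [|w a o k c l IHl r IHr] off acc oka sa.
  by move=> hH; apply: runsI; rewrite /addall_b; cbn [enct]; wps; fin.
rewrite [addall _ _ _ _]/=.
set a1 := addall z (off + o) l acc.
set a2 := ins (k + off) (z * c) a1 => hH.
have [ok1 p1 s1 g1] := addall_ok z (off + o) l oka sa.
have [ok2 p2 s2 /andP[g2 _] r2] := ins_ok (k + off) (z * c) ok1 s1.
have [ok3 p3 s3 g3] := addall_ok z (off + o) r ok2 s2.
have h1 : (hg a1 <= H)%N by apply: leq_trans g2 (leq_trans g3 hH).
have r1 := IHl (off + o) acc oka sa h1.
have r3 := IHr (off + o) a2 ok2 s2 hH.
apply: runsI; rewrite /addall_b; cbn [enct]; wps.
wpcall r1; wpcall r2; wpcall r3; split=> //.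
have -> : nodes (Nd w a o k c l r) = (nodes l + nodes r).+1 by [].
rewrite [(80 * H.+1 * _.+1)%N]mulnS mulnDr -/a1.
have : (70 * (hg a1).+1 <= 70 * H.+1)%N by rewrite leq_mul2l ltnS h1.
by lia.
Qed.

Lemma size_evs (t : tr) : size (evs t) = nodes t.
Proof.
by elim: t => //= w a o k c l IHl r IHr; rewrite size_cat /= !size_map IHl IHr addnS.
Qed.

Local Open Scope nat_scope.

(** The height is at most [2 log2 (nodes + 1)]. In [key], [y] belongs to the higher subtree:
    [y <= B^2] and [y <= 2 A^2], hence [y <= 4 A B]; the first bound plus half of each of the other
    two gives [2 y <= (A + B)^2]. *)
Lemma hg_bound (t : tr) : ok t -> (2 ^ hg t <= (nodes t).+1 ^ 2)%N.
Proof.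
have key A B x y : x <= A * A -> y <= B * B -> y <= 2 * x -> 2 * y <= (A + B) * (A + B).
  move=> xA yB yx.
  have h : y * y <= (4 * (A * B)) * (4 * (A * B)).
    apply: leq_trans (_ : (2 * (A * A)) * (B * B) <= _).
      by apply: leq_mul => //; apply: leq_trans yx _; rewrite leq_mul2l xA.
    by rewrite !mulnA; nia.
  have h' : y <= 4 * (A * B) by rewrite leqNgt; apply/negP => lt; nia.
  nia.
elim: t => // w a o k c l IHl r IHr /= [_ _ b kl kr].
have := IHl kl; have := IHr kr; move: b; rewrite !expnS !expn0 !muln1.
have -> : (nodes l + nodes r).+2 = (nodes l).+1 + (nodes r).+1 by lia.
case: (leqP (hg l) (hg r)) => h /andP[b1 b2] hr hl.
  by apply: key hl hr _; rewrite -expnS leq_exp2l.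
rewrite [(nodes l).+1 + _]addnC.
by apply: key hr hl _; rewrite -expnS leq_exp2l.
Qed.

End Traversals.

(** * Representation of the messages *)

Section Events.
Variables (R : realType) (gamma : R).
Hypothesis gamma_ge0 : (0 <= gamma)%R.
Local Open Scope ring_scope.
Local Notation mom := (mom R).
Local Notation clamp := (clamp gamma).

Definition pos (x : R) : R := Num.max 0 x.

(** An event [(p, c)] adds [c] to the slope beyond [p]. *)
Definition evh (h : R -> R) (E : seq (R * R)) (x : R) : R :=
  \sum_(e <- E) e.2 * h (pos (x - e.1)).

Definition sqr (x : R) : R := x ^+ 2.

Lemma evh_cons h e E x : evh h (e :: E) x = e.2 * h (pos (x - e.1)) + evh h E x.
Proof. by rewrite /evh big_cons. Qed.

Lemma evh_cat h E1 E2 x : evh h (E1 ++ E2) x = evh h E1 x + evh h E2 x.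
Proof. by rewrite /evh big_cat. Qed.

Lemma evh_perm h E1 E2 x : perm_eq E1 E2 -> evh h E1 x = evh h E2 x.
Proof. by move=> p; rewrite /evh (perm_big _ p). Qed.

Lemma mfD (a b : mom) x : mf (madd a b) x = mf a x + mf b x.
Proof. by rewrite /mf /=; ring. Qed.

Lemma mgD (a b : mom) x : mg (madd a b) x = mg a x + mg b x.
Proof. by rewrite /mg /=; ring. Qed.

Lemma pos_ge x : 0 <= x -> pos x = x.
Proof. by move=> h; rewrite /pos max_r. Qed.

Lemma pos_le x : x <= 0 -> pos x = 0.
Proof. by move=> h; rewrite /pos max_l. Qed.

Lemma mf_upto E x : mf (upto x E) x = evh sqr E x.
Proof.
elim: E => [|e E IH]; first by rewrite /evh big_nil /mf /=; ring.
rewrite upto_cons evh_cons -IH; case: leP => h.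
  by rewrite mfD pos_ge ?subr_ge0 // /mf /point /sqr /=; ring.
by rewrite pos_le /sqr ?subr_le0 ?ltW //; ring.
Qed.

Lemma mg_upto E x : mg (upto x E) x = evh id E x.
Proof.
elim: E => [|e E IH]; first by rewrite /evh big_nil /mg /=; ring.
rewrite upto_cons evh_cons -IH; case: leP => h.
  by rewrite mgD pos_ge ?subr_ge0 // /mg /point /=; ring.
by rewrite pos_le ?subr_le0 ?ltW //; ring.
Qed.

(** The base [b] and the events [E] represent the function [s.1], whose
    derivative is [2 s.2]. *)
Definition represents (b : mom) (E : seq (R * R)) (s : (R -> R) * (R -> R)) :=
  (forall x, mf b x + evh sqr E x = s.1 x) /\
  (forall x, mg b x + evh id E x = s.2 x).

Lemma evh_scale h z E x : evh h (scale z E) x = z * evh h E x.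
Proof.
by rewrite /evh /scale big_map mulr_sumr; apply: eq_bigr => e _; rewrite /= mulrA.
Qed.

(** Stated for any [h] with [h 0 = 0], so that [sqr] yields the values and [id] the half
    derivatives. *)
Lemma evh_after h m E x : h 0 = 0 -> m <= x ->
  evh h E x = \sum_(e <- E | e.1 <= m) e.2 * h (x - e.1)
            + \sum_(e <- E | m < e.1) e.2 * h (pos (x - e.1)).
Proof.
move=> h0 mx; rewrite /evh (bigID (fun e : R * R => e.1 <= m)) /=; congr (_ + _).
  by apply: eq_bigr => e em; rewrite pos_ge // subr_ge0 (le_trans em).
by apply: eq_bigl => e; rewrite -ltNge.
Qed.

Lemma evh_move h m E x : h 0 = 0 -> m <= x ->
  evh h (map (move_gt m gamma) E) x =
      \sum_(e <- E | e.1 <= m) e.2 * h (x - e.1)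
    + \sum_(e <- E | m < e.1) e.2 * h (pos (x - gamma - e.1)).
Proof.
move=> h0 mx; rewrite /evh big_map (bigID (fun e : R * R => e.1 <= m)) /=.
congr (_ + _).
  apply: eq_bigr => e em; rewrite /move_gt (le_gtF em).
  by rewrite pos_ge // subr_ge0 (le_trans em).
rewrite (eq_bigl (fun e : R * R => m < e.1)); last by move=> e; rewrite -ltNge.
apply: eq_bigr => e em; rewrite /move_gt em /=.
by rewrite opprD addrA addrAC.
Qed.

Lemma evh_move_le h m E x : h 0 = 0 -> x <= m ->
  evh h (map (move_gt m gamma) E) x = evh h E x.
Proof.
have g0 := gamma_ge0.
move=> h0 xm; rewrite /evh big_map; apply: eq_bigr => e _; rewrite /move_gt.
by case: (ltP m e.1) => //= me; rewrite !pos_le //; lra.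
Qed.

Lemma sum_far (h : R -> R) m (E : seq (R * R)) x : h 0 = 0 -> x <= m ->
  \sum_(e <- E | m < e.1) e.2 * h (pos (x - e.1)) = 0.
Proof.
move=> h0 xm; rewrite big1 // => e em.
by rewrite pos_le ?h0 ?mulr0 // subr_le0 (le_trans xm) // ltW.
Qed.

Lemma mom_after m E x :
  mf (upto m E) x = \sum_(e <- E | e.1 <= m) e.2 * sqr (x - e.1) /\
  mg (upto m E) x = \sum_(e <- E | e.1 <= m) e.2 * (x - e.1).
Proof.
elim: E => [|e E [IHf IHg]].
  by rewrite !big_nil /mf /mg /=; split; ring.
rewrite upto_cons !big_cons; case: leP => _ //.
by rewrite mfD mgD IHf IHg /mf /mg /point /sqr /=; split; ring.
Qed.

(** The slope of the half derivative immediately right of [m]: events at [m] itself already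
    count. *)
Definition slope_at b E m : R := (madd b (upto m E)).1.1.

(** Clamping inserts a plateau of value 0 on [[m, m + gamma]]: the slope is cancelled at [m] and
    restored at [m + gamma]. The half derivative is 0 at [m], so no jump arises; left of [m] nothing
    changes, hence the same base. *)
Definition propagated b E m : seq (R * R) :=
  (m + gamma, slope_at b E m) :: (m, - slope_at b E m) ::
    map (move_gt m gamma) E.

Lemma propagate b E s m : represents b E s -> s.2 m = 0 ->
  represents b (propagated b E m)
    (fun x => s.1 (clamp m x), fun x => s.2 (clamp m x)).
Proof.
have g0 := gamma_ge0; rewrite /propagated /slope_at.
move=> [Hf Hg] gm; set a := madd b (upto m E); set sl := a.1.1.
have af x : mf a x = mf b x + \sum_(e <- E | e.1 <= m) e.2 * sqr (x - e.1).
  by rewrite mfD (mom_after m E x).1.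
have ag x : mg a x = mg b x + \sum_(e <- E | e.1 <= m) e.2 * (x - e.1).
  by rewrite mgD (mom_after m E x).2.
(* A vanishing half derivative at [m] says that the quadratic valid just right of [m] has its vertex
   there. *)
have a1 : a.1.2 = sl * m.
  have : mg a m = 0 by rewrite mgD mg_upto Hg.
  by rewrite /mg -/sl; lra.
have s0 : sqr 0 = 0 by rewrite /sqr expr0n.
split=> x /=; rewrite !evh_cons /=.
- rewrite -Hf; case: (clampP g0 m x) => [h|h1 h2|h].
  + rewrite evh_move_le // !pos_le; [|lra|lra].
    by rewrite s0; ring.
  + rewrite evh_move // (pos_le (x := x - (m + gamma))); last by lra.
    rewrite (pos_ge (x := x - m)); last by lra.
    rewrite (sum_far _ s0); last by lra.
    have := af x; have := mfD b (upto m E) m; rewrite -/a mf_upto => E1 E2.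
    rewrite -E1.
    suff -> : mf a m = mf a x - sl * sqr (x - m) by rewrite E2 s0; ring.
    by rewrite /mf a1 -/sl /sqr; ring.
  + rewrite evh_move //; last by lra.
    rewrite (evh_after (m := m) _ s0); last by lra.
    rewrite !pos_ge; [|lra|lra].
    have := af x; have := af (x - gamma).
    set S1 := \sum_(e <- E | e.1 <= m) _; set S2 := \sum_(e <- E | e.1 <= m) _.
    set S3 := \sum_(e <- E | m < e.1) _ => E1 E2.
    suff : mf a (x - gamma) = mf a x - sl * sqr (x - m) + sl * sqr (x - (m + gamma)).
      by rewrite E1 E2; lra.
    by rewrite /mf a1 -/sl /sqr; ring.
- rewrite -Hg; case: (clampP g0 m x) => [h|h1 h2|h].
  + rewrite evh_move_le // !pos_le; [|lra|lra].
    by ring.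
  + rewrite evh_move // (pos_le (x := x - (m + gamma))); last by lra.
    rewrite (pos_ge (x := x - m)); last by lra.
    rewrite (sum_far (h := id)) //; last by lra.
    have := ag x; have := mgD b (upto m E) m; rewrite -/a mg_upto => E1 E2.
    rewrite -E1.
    suff -> : mg a m = mg a x - sl * (x - m) by rewrite E2; ring.
    by rewrite /mg a1 -/sl; ring.
  + rewrite evh_move //; last by lra.
    rewrite (evh_after (h := id) (m := m)) //; last by lra.
    rewrite !pos_ge; [|lra|lra].
    have := ag x; have := ag (x - gamma).
    set S1 := \sum_(e <- E | e.1 <= m) _; set S2 := \sum_(e <- E | e.1 <= m) _.
    set S3 := \sum_(e <- E | m < e.1) _ => E1 E2.
    suff : mg a (x - gamma) = mg a x - sl * (x - m) + sl * (x - (m + gamma)).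
      by rewrite E1 E2; lra.
    by rewrite /mg a1 -/sl; ring.
Qed.

Lemma gap_after m (E : seq (R * R)) : exists2 d, 0 < d &
  forall e, e \in E -> m < e.1 -> m + d <= e.1.
Proof.
elim: E => [|e E [d d0 IH]]; first by exists 1.
case: (ltP m e.1) => h.
  exists (Num.min d (e.1 - m)); first by rewrite lt_min d0 subr_gt0.
  move=> x; rewrite inE => /predU1P[->|xE] mx.
    by have := ge_min (e.1 - m) d (e.1 - m); rewrite lexx orbT => h'; lra.
  have := IH x xE mx; have := ge_min d d (e.1 - m); rewrite lexx => h'; lra.
exists d => // x; rewrite inE => /predU1P[->|xE]; last exact: IH.
by rewrite ltNge h.
Qed.

(** Right of [m] there is a gap without events, where the half derivative is affine with slope
    [slope_at]; growth at rate at least 1 makes this slope positive, so the division that yields [m]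
    is sound. *)
Lemma slope_gt0 b E s m :
    represents b E s -> s.2 m = 0 ->
    (forall x y, x <= y -> y - x <= s.2 y - s.2 x) ->
  0 < slope_at b E m /\ m = (madd b (upto m E)).1.2 / slope_at b E m.
Proof.
rewrite /slope_at.
move=> [_ Hg] gm inc; set a := madd b (upto m E); set sl := a.1.1.
have a1 : a.1.2 = sl * m.
  have : mg a m = 0 by rewrite mgD mg_upto Hg.
  by rewrite /mg -/sl; lra.
suff sl0 : 0 < sl by split=> //; rewrite a1 mulrC mulKf // gt_eqF.
have [d d0 gap] := gap_after m E.
have md : m <= m + d by lra.
have := inc m (m + d) md; rewrite gm -Hg (evh_after (h := id) (m := m)) //=.
have -> : \sum_(e <- E | m < e.1) e.2 * pos (m + d - e.1) = 0.
  rewrite big1_seq // => e /andP[em eE].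
  by rewrite pos_le ?mulr0 //; have := gap e eE em; lra.
rewrite addr0 -(mom_after m E (m + d)).2 -mgD -/a /mg a1 -/sl.
move=> h; have {}h : d <= sl * d by lra.
have : 0 < sl * d by lra.
by rewrite pmulr_lgt0.
Qed.

End Events.

(** * Search of the minimizer *)

Definition fsum_b : ex := ltac:(code_of (fn (fun x =>
  LET q := x.f IN LET acc := x.s.f IN LET ts := x.s.s IN
  IF ts THEN
    self << q, call madd_b << acc, call tsum_b << q, ts.f >> >>, ts.s >>
  ELSE acc)%bex)).

Definition wsum_b : ex := ltac:(code_of (fn (fun x =>
  LET q := x.f IN LET ts := x.s.f IN LET acc := x.s.s IN
  IF ts THEN
    LET t := ts.f IN
    IF t THEN
      LET k := t.s.s.s.f IN
      self << q, ts.s, << acc.f [+] (IF k [<] q THEN t.f ELSE #0),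
                          acc.s.f [+] (IF q [<] k THEN t.f ELSE #0),
                          acc.s.s [+] t.f >> >>
    ELSE self << q, ts.s, acc >>
  ELSE acc)%bex)).

(** A median of the root keys for the weights [t.f]; comparing it with the zero
    of [g] replaces roots of at least half the total weight by their children,
    which weigh at most half as much: a quarter of the weight is lost. *)
Definition pick_b : ex := ltac:(code_of (fn (fun x =>
  LET ts := x.f IN LET all := x.s IN
  IF ts THEN
    LET t := ts.f IN
    IF t THEN
      LET q := t.s.s.s.f IN
      LET s := call wsum_b << q, all, << #0, #0, #0 >> >> IN
      IF s.s.s [<] #2 [*] s.f THEN self << ts.s, all >>
      ELSE IF s.s.s [<] #2 [*] s.s.f THEN self << ts.s, all >>
      ELSE << q, cst 0 >>
    ELSE self << ts.s, all >>
  ELSE cst 0)%bex)).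

Definition cutl_b : ex := ltac:(code_of (fn (fun x =>
  LET p := x.f IN LET ts := x.s IN
  IF ts THEN
    LET t := ts.f IN
    << IF t THEN
         IF t.s.s.s.f [<] p THEN t
         ELSE call sh_b << t.s.s.f, t.s.s.s.s.s.f >>
       ELSE t,
       self << p, ts.s >> >>
  ELSE cst 0)%bex)).

Definition cutr_b : ex := ltac:(code_of (fn (fun x =>
  LET p := x.f IN LET ts := x.s.f IN LET acc := x.s.s IN
  IF ts THEN
    LET t := ts.f IN
    IF t THEN
      LET n := t.s.s.s IN
      IF p [<] n.f THEN
        LET r := self << p, ts.s, acc >> IN << << t, r.f >>, r.s >>
      ELSE
        LET l := call sh_b << t.s.s.f, n.s.s.f >> IN
        LET a := call madd_b << acc, call madd_b << call tot_b l,
                   call point_b << n.f, n.s.f >> >> >> IN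
        LET r := self << p, ts.s, a >> IN
        << << call sh_b << t.s.s.f, n.s.s.s >>, r.f >>, r.s >>
    ELSE
      LET r := self << p, ts.s, acc >> IN << << t, r.f >>, r.s >>
  ELSE << cst 0, acc >>)%bex)).

Definition search_b : ex := ltac:(code_of (fn (fun x =>
  LET F := x.f IN LET rem := x.s.f IN LET acc := x.s.s IN
  LET pv := call pick_b << rem, rem >> IN
  IF pv THEN
    LET s := call fsum_b << pv.f, F >> IN
    IF #0 [<] s.f [*] pv.f [-] s.s.f THEN
      self << F, call cutl_b << pv.f, rem >>, acc >>
    ELSE
      LET r := call cutr_b << pv.f, rem, acc >> IN
      self << F, r.f, r.s >>
  ELSE acc)%bex)).

Definition zero_b : ex := ltac:(code_of (fn (fun F =>
  LET a := call search_b << F, F.s, F.f >> IN << a.s.f [/] a.f, a >>)%bex)).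

Ltac wpm := cbn [encm fst snd]; wps; cbn [fst snd].

Section Zero.
Variable R : realType.
Local Open Scope ring_scope.
Variables (iw : nat -> nat -> nat) (ir : nat -> nat -> R).
Local Notation val := (val R).
Local Notation runs := (runs iw ir).
Local Notation tr := (tr R).
Local Notation mom := (mom R).
Local Notation madd_run := (madd_run iw ir).
Local Notation point_run := (point_run iw ir).
Local Notation tot_run := (tot_run iw ir).
Local Notation sh_run := (sh_run iw ir).

Fixpoint enctl (ts : seq tr) : val :=
  if ts is t :: s then P (enct t) (enctl s) else W 0.

Fixpoint gts (H : nat) (ts : seq tr) : Prop :=
  if ts is t :: s then
    [/\ ok t, srt (evs t), (hg t <= H)%N & gts H s]
  else True.

Fixpoint allE (ts : seq tr) : seq (R * R) :=
  if ts is t :: s then evs t ++ allE s else [::].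

Lemma maddA (a b c : mom) : madd a (madd b c) = madd (madd a b) c.
Proof. by apply: momP; rewrite /= addrA. Qed.

Lemma maddCA (a b c : mom) : madd a (madd b c) = madd b (madd a c).
Proof. by apply: momP; rewrite /= addrCA. Qed.

Lemma fsum_run H x a ts : gts H ts ->
  runs fsum_b (P (X x) (P (encm a) (enctl ts)))
    (encm (madd a (upto x (allE ts)))) ((10 * H.+1 + 5) * size ts).
Proof.
elim: ts a => [|t ts IH] a.
  move=> _; apply: runsI; rewrite /fsum_b; cbn [enctl]; wps.
  by split; [rewrite madd0r|lia].
case=> kt st ht gt; have [E rt] := tsum_ok iw ir x kt st.
apply: runsI; rewrite /fsum_b; cbn [enctl]; wps.
wpcall rt; wpcall (madd_run a (tsum x t)).
wpcall (IH (madd a (tsum x t)) gt); split.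
  by rewrite E [allE _]/= upto_cat maddA.
have -> : size (t :: ts) = (size ts).+1 by [].
have : (10 * (hg t).+1 <= 10 * H.+1)%N by rewrite leq_mul2l ltnS ht.
by lia.
Qed.

Fixpoint roots (ts : seq tr) : seq (R * R) :=
  match ts with
  | Nd w _ _ k _ _ _ :: s => (k, w) :: roots s
  | Lf :: s => roots s
  | [::] => [::]
  end.

Definition wlt q (l : seq (R * R)) : R := \sum_(e <- l | e.1 < q) e.2.
Definition wgt q (l : seq (R * R)) : R := \sum_(e <- l | q < e.1) e.2.
Definition wall (l : seq (R * R)) : R := \sum_(e <- l) e.2.

Lemma wsum_run q ts a :
  runs wsum_b (P (X q) (P (enctl ts) (encm a)))
    (encm (madd a (wlt q (roots ts), wgt q (roots ts), wall (roots ts))))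
    (size ts).
Proof.
elim: ts a => [|[|w a0 o k c l r] ts IH] a.
- apply: runsI; rewrite /wsum_b; cbn [enctl]; wps.
  by split; [rewrite /wlt /wgt /wall /= !big_nil madd0r|].
- apply: runsI; rewrite /wsum_b; cbn [enctl enct]; wps.
  by wpcall (IH a); split=> //=; lia.
- apply: runsI; rewrite /wsum_b; cbn [enctl enct]; wps.
  have E b1 b2 : b1 = (if k < q then w else 0) ->
      b2 = (if q < k then w else 0) ->
      madd (madd a (b1, b2, w)) (wlt q (roots ts), wgt q (roots ts), wall (roots ts)) =
      madd a (wlt q (roots (Nd w a0 o k c l r :: ts)),
        wgt q (roots (Nd w a0 o k c l r :: ts)), wall (roots (Nd w a0 o k c l r :: ts))).
    move=> -> ->; rewrite -maddA; congr madd; rewrite /wlt /wgt /wall /= !big_cons /=.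
    by apply: momP => //=; case: ifP; rewrite ?add0r.
  case E1 : (k < q); case E2 : (q < k); wps.
  + by wpcall (IH (madd a (w, w, w))); split; [rewrite E ?E1 ?E2|rewrite /=; lia].
  + by wpcall (IH (madd a (w, 0, w))); split; [rewrite E ?E1 ?E2|rewrite /=; lia].
  + by wpcall (IH (madd a (0, w, w))); split; [rewrite E ?E1 ?E2|rewrite /=; lia].
  + by wpcall (IH (madd a (0, 0, w))); split; [rewrite E ?E1 ?E2|rewrite /=; lia].
Qed.

Definition median q l := (2 * wlt q l <= wall l) && (2 * wgt q l <= wall l).

(** Comparing each root with all roots is quadratic in the number of trees; evaluating [g] costs up
    to a height per tree, so with logarithmically many trees the two are of the same order. *)
Lemma pick_run ts all : exists v,
  runs pick_b (P (enctl ts) (enctl all)) v ((size all + 2) * size ts) /\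
  (v = W 0 /\ (forall e, e \in roots ts -> ~~ median e.1 (roots all)) \/
   exists q, [/\ v = P (X q) (W 0), median q (roots all) & roots ts != [::]]).
Proof.
elim: ts => [|[|w a0 o k c l r] ts [v [IH H]]].
- exists (W 0); split; last by left.
  by apply: runsI; rewrite /pick_b; cbn [enctl]; wps; fin.
- exists v; split; last exact: H.
  apply: runsI; rewrite /pick_b; cbn [enctl enct]; wps.
  by wpcall IH; split=> //=; lia.
have W0 := wsum_run k all (0, 0, 0); rewrite madd0 in W0.
case M : (median k (roots all)).
  exists (P (X k) (W 0)); split; last by right; exists k; split.
  move/andP: M => [M1 M2].
  apply: runsI; rewrite /pick_b; cbn [enctl enct]; wps.
  wpcall W0; wpm; rewrite (le_gtF M1) (le_gtF M2); wps.
  by split=> //=; lia.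
exists v; split; last first.
  case: H => [[-> H]|[q [-> Mq _]]]; last by right; exists q.
  by left; split=> // e; rewrite inE => /predU1P[->|/H //]; rewrite M.
apply: runsI; rewrite /pick_b; cbn [enctl enct]; wps.
wpcall W0; wpm.
have : (wall (roots all) < 2 * wlt k (roots all)) ||
       (wall (roots all) < 2 * wgt k (roots all)).
  by move: M; rewrite /median !leNgt -negb_or => /negbFE.
case E1 : (wall _ < 2 * wlt _ _); rewrite /= => E2; rewrite ?E2; wps.
  by wpcall IH; split=> //=; lia.
by wpcall IH; split=> //=; lia.
Qed.

Lemma max_key (l : seq (R * R)) : l != [::] ->
  exists2 e, e \in l & forall x, x \in l -> x.1 <= e.1.
Proof.
elim: l => // a l IH _; case: (eqVneq l [::]) => [->|/IH [e el le]].
  by exists a; rewrite ?inE // => x; rewrite inE => /eqP ->.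
case: (leP e.1 a.1) => h.
  exists a; first by rewrite inE eqxx.
  by move=> x; rewrite inE => /predU1P[->//|/le xe]; exact: le_trans h.
exists e; first by rewrite inE el orbT.
by move=> x; rewrite inE => /predU1P[->|/le //]; exact: ltW.
Qed.

Lemma min_key (l : seq (R * R)) : l != [::] ->
  exists2 e, e \in l & forall x, x \in l -> e.1 <= x.1.
Proof.
move=> l0; have [|e /mapP[y yl ->] le] := @max_key [seq (- x.1, x.2) | x <- l].
  by case: l l0.
exists y => // x xl; have := le (- x.1, x.2) (map_f _ xl).
by rewrite /= lerN2.
Qed.

Lemma median_ex (l : seq (R * R)) : l != [::] -> all (fun e => 0 <= e.2) l ->
  exists2 e, e \in l & median e.1 l.
Proof.
move=> l0 /allP wpos.
have W0 (p : pred (R * R)) : 0 <= \sum_(e <- l | p e) e.2.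
  by rewrite big_seq_cond sumr_ge0 // => e /andP[/wpos].
pose S := [seq e <- l | 2 * wgt e.1 l <= wall l].
have S0 : S != [::].
  have [e el le] := max_key l0; rewrite -has_filter; apply/hasP; exists e => //.
  rewrite /wgt big1_seq ?mulr0 ?W0 //.
  by move=> x /andP[ex /le]; rewrite leNgt ex.
have [e] := min_key S0; rewrite mem_filter => /andP[e2 el] le.
exists e => //; rewrite /median e2 andbT.
pose L := [seq x <- l | x.1 < e.1].
case: (eqVneq L [::]) => [L0|/max_key [d]].
  rewrite /wlt -big_filter -/L L0 big_nil mulr0; exact: W0.
rewrite mem_filter => /andP[de dl] led.
have dS : wall l < 2 * wgt d.1 l.
  rewrite ltNge; apply/negP => h; have := le d.
  by rewrite mem_filter h dl leNgt de => /(_ isT).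
suff : wall l = wlt e.1 l + wgt d.1 l by lra.
rewrite /wall (bigID (fun x : R * R => x.1 < e.1)) /=; congr (_ + _).
rewrite big_seq_cond [RHS]big_seq_cond; apply: eq_bigl => x.
case xl : (x \in l) => //=; rewrite -leNgt; apply/idP/idP.
  exact: lt_le_trans.
move=> dx; rewrite leNgt; apply/negP => xe.
by have := led x; rewrite mem_filter xe xl => /(_ isT); rewrite leNgt dx.
Qed.

(** When [m < p], a root with key at least [p] and its right subtree contribute nothing at [m].
    [cutr] serves for [p <= m], where a root with key at most [p] and its left subtree contribute in
    full and pass to the accumulator. *)
Definition cutl (p : R) (t : tr) : tr :=
  if t is Nd _ _ o k _ l _ then if k < p then t else sh o l else t.

Definition cutr (p : R) (t : tr) : tr :=
  if t is Nd _ _ o k _ _ r then if p < k then t else sh o r else t.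

Lemma cutl_run p ts :
  runs cutl_b (P (X p) (enctl ts)) (enctl (map (cutl p) ts)) (4 * size ts).
Proof.
elim: ts => [|[|w a0 o k c l r] ts IH].
- by apply: runsI; rewrite /cutl_b; cbn [enctl]; wps; fin.
- apply: runsI; rewrite /cutl_b; cbn [enctl enct]; wps.
  by wpcall IH; split=> //=; lia.
- apply: runsI; rewrite /cutl_b; cbn [enctl enct map cutl]; wps.
  case: (k < p); wps.
    by wpcall IH; split=> //=; lia.
  wpcall (sh_run o l); wpcall IH; split=> //=; lia.
Qed.

Lemma gts_cutl H p ts : gts H ts -> gts H (map (cutl p) ts).
Proof.
elim: ts => //= -[|w a0 o k c l r] ts IH [kt st ht /IH g].
  by split.
rewrite /cutl; case: ifP => _; split=> //.
- by case: kt => _ _ _ kl _; exact: ok_sh.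
- by move: st; rewrite [evs _]/= srt_node evs_sh => /and4P[].
- by move: ht; rewrite hg_sh /=; lia.
Qed.

Lemma gts_cutr H p ts : gts H ts -> gts H (map (cutr p) ts).
Proof.
elim: ts => //= -[|w a0 o k c l r] ts IH [kt st ht /IH g].
  by split.
rewrite /cutr; case: ifP => _; split=> //.
- by case: kt => _ _ _ _ kr; exact: ok_sh.
- by move: st; rewrite [evs _]/= srt_node evs_sh => /and4P[].
- by move: ht; rewrite hg_sh /=; lia.
Qed.

Lemma upto_cutl H p m ts : gts H ts -> m < p ->
  upto m (allE (map (cutl p) ts)) = upto m (allE ts).
Proof.
move=> g mp; elim: ts g => // t ts IH [kt st _ g].
rewrite /= !upto_cat IH //; congr madd.
case: t kt st => // w a o k c l r kt; rewrite /cutl [evs (Nd _ _ _ _ _ _ _)]/=.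
rewrite srt_node => /and4P[_ ar _ _]; case: ifP => // /negbT; rewrite -leNgt => pk.
rewrite upto_cat upto_cons /= (lt_geF (lt_le_trans mp pk)) (upto_none (s := shl o (evs r))).
  by rewrite madd0r evs_sh.
by apply: sub_all ar => e /=; apply: lt_le_trans; exact: lt_le_trans mp pk.
Qed.

Lemma cutr_run H p m ts a : gts H ts -> p <= m -> exists a',
  runs cutr_b (P (X p) (P (enctl ts) (encm a)))
    (P (enctl (map (cutr p) ts)) (encm a')) (12 * size ts) /\
  madd a' (upto m (allE (map (cutr p) ts))) = madd a (upto m (allE ts)).
Proof.
move=> g pm; elim: ts a g => [|[|w a0 o k c l r] ts IH] a.
- by exists a; split=> //; apply: runsI; rewrite /cutr_b; cbn [enctl]; wps; fin.
- case=> _ _ _ /(IH a) [a' [r' E']]; exists a'; split=> //.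
  apply: runsI; rewrite /cutr_b; cbn [enctl enct]; wps.
  by wpcall r'; split=> //=; lia.
case=> kt st _ g; case pk: (p < k).
  have [a' [r' E']] := IH a g; exists a'; split.
    apply: runsI; rewrite /cutr_b; cbn [enctl enct map cutr]; wps.
    by rewrite pk; wpcall r'; split=> //=; lia.
  rewrite [map _ _]/= pk /= !upto_cat.
  by rewrite maddCA E' maddCA.
pose b := madd (tot (sh o l)) (point k c).
have [a' [r' E']] := IH (madd a b) g; exists a'; split.
  apply: runsI; rewrite /cutr_b; cbn [enctl enct map cutr]; wps.
  rewrite pk; wpcall (sh_run o l); wpcall (tot_run (sh o l)).
  wpcall (point_run k c); wpcall (madd_run (tot (sh o l)) (point k c)).
  wpcall (madd_run a b); wpcall r'; wpcall (sh_run o r).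
  by split=> //=; lia.
rewrite [map _ _]/= pk /= !upto_cat.
move/negbT: pk; rewrite -leNgt => kp.
have km := le_trans kp pm.
rewrite upto_cons /= km (upto_all (s := shl o (evs l))); last first.
  move: st; rewrite [evs _]/= srt_node => /and4P[al _ _ _].
  by apply: sub_all al => e /= h; exact: le_trans h km.
have [_ _ _ kl _] := kt.
rewrite maddCA E' /b tot_ok; last exact: ok_sh.
rewrite !evs_sh; move: (msum _) (upto m _) (upto m _) => x y z.
by apply: momP; rewrite /=; ring.
Qed.

(** A child weighs at most half of its parent, and an empty tree is no root at all. For a median [p]
    at most half of the weight is kept whole, so at most three quarters of the total remain. *)
Lemma wall_cut H p ts : gts H ts ->
  2 * wall (roots (map (cutl p) ts)) <= wall (roots ts) + wlt p (roots ts) /\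
  2 * wall (roots (map (cutr p) ts)) <= wall (roots ts) + wgt p (roots ts).
Proof.
rewrite /wall /wlt /wgt; elim: ts => [|[|w a0 o k c l r] ts IH] /=.
- by rewrite !big_nil; lra.
- by case=> _ _ _ /IH.
case=> kt st _ /IH [h1 h2]; rewrite !big_cons.
have [Ew _ _ kl kr] := kt.
have half t s : ok t -> (hg t < hg (Nd w a0 o k c l r))%N ->
    2 * (\sum_(e <- roots (sh o t :: s)) e.2) <= w + 2 * \sum_(e <- roots s) e.2.
  case: t => [|w' a' o' k' c' l' r'] kt' lt.
    rewrite /=; have : 0 <= w by rewrite Ew exprn_ge0.
    by lra.
  rewrite /sh /= big_cons /=; case: kt' => -> _ _ _ _.
  rewrite mulrDr -exprS lerD2r Ew ler_eXn2l ?ltr1n //.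
have hl := half l (map (cutl p) ts) kl.
have hr := half r (map (cutr p) ts) kr.
split.
  case: (ltP k p) => kp; first by rewrite /= big_cons /=; lra.
  by have := hl _; rewrite /= => /(_ _) h; have := h ltac:(lia); lra.
case: (ltP p k) => kp; first by rewrite /= big_cons /=; lra.
by have := hr _; rewrite /= => /(_ _) h; have := h ltac:(lia); lra.
Qed.

End Zero.

(** * Clamping on lists of trees, and the search loop *)

Definition sgts_b : ex := ltac:(code_of (fn (fun x =>
  LET m := x.f IN LET g := x.s.f IN LET ts := x.s.s IN
  IF ts THEN << call sgt_b << m, g, ts.f >>, self << m, g, ts.s >> >>
  ELSE cst 0)%bex)).

(** Expects [m] with the quadratic returned by [zero_b], whose leading coefficient is the slope
    [sl]. All trees are translated, and the first receives both new events. *)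
Definition prop_b : ex := ltac:(code_of (fn (fun x =>
  LET F := x.f IN LET m := x.s.f IN LET sl := x.s.s.f IN
  LET g := ap1 (GetR 0) (cst 0) IN
  LET ts := call sgts_b << m, g, F.s >> IN
  << F.f, << call ins_b << m [+] g, sl, call ins_b << m, #0 [-] sl, ts.f >> >>,
             ts.s >> >>)%bex)).

Section Search.
Variable R : realType.
Local Open Scope ring_scope.
Variables (iw : nat -> nat -> nat) (ir : nat -> nat -> R).
Local Notation runs := (runs iw ir).
Local Notation tr := (tr R).

Lemma roots_pos H (ts : seq tr) : gts H ts ->
  all (fun e => 2 <= e.2) (roots ts).
Proof.
elim: ts => //= -[|w a o k c l r] ts IH [kt _ _ /IH h] //=.
rewrite h andbT; case: kt => -> _ _ _ _.
by rewrite /= exprS ler_peMr // exprn_ege1 // ler1n.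
Qed.

Lemma roots_nil (ts : seq tr) : roots ts = [::] -> allE ts = [::].
Proof. by elim: ts => //= -[|w a o k c l r] ts IH //= /IH. Qed.

Lemma wall_roots H (ts : seq tr) : gts H ts ->
  wall (roots ts) <= (size ts)%:R * 2 ^+ H.
Proof.
rewrite /wall; elim: ts => [|[|w a o k c l r] ts IH] /=.
- by rewrite big_nil mul0r.
- case=> _ _ _ /IH h; apply: le_trans h _.
  by rewrite ler_wpM2r ?exprn_ge0 // ler_nat.
case=> -[-> _ _ _ _] _ lt /IH h; rewrite big_cons -(natr1 (size ts)) mulrDl mul1r addrC.
by apply: lerD h _; rewrite /= ler_eXn2l ?ltr1n.
Qed.

(** The accumulator and the events up to [m] in [rem] always add up to the quadratic at [m], and [g]
    is always evaluated on the full list [ts]. A nonempty tree weighs at least 2, so the weight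
    bound at [r = 0] leaves no root. *)
Lemma search_run H b (ts : seq tr) m r rem acc :
    gts H ts -> gts H rem ->
    (forall x, (0 < mg (madd b (upto x (allE ts))) x) = (m < x)) ->
    madd acc (upto m (allE rem)) = madd b (upto m (allE ts)) ->
    wall (roots rem) < 2 * (4 / 3) ^+ r ->
  runs search_b (P (P (encm b) (enctl ts)) (P (enctl rem) (encm acc)))
    (encm (madd b (upto m (allE ts))))
    (r.+1 * ((size rem + 2) * size rem + (10 * H.+1 + 5) * size ts +
             12 * size rem + 5)).
Proof.
move=> gT; elim: r rem acc => [|r IH] rem acc gR sgn E hw;
  have rp := roots_pos gR; have [v [rv Hv]] := pick_run iw ir rem rem.
- have r0 : roots rem = [::].
    move: hw rp; rewrite expr0 mulr1 /wall; case: (roots rem) => // e l.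
    rewrite big_cons /= => hw /andP[e2 /allP l2].
    have : 0 <= \sum_(x <- l) x.2.
      by rewrite big_seq sumr_ge0 // => x /l2; apply: le_trans.
    by move=> h; have := lerD e2 h; rewrite addr0 leNgt hw.
  case: Hv => [[Ev _]|[q [_ _]]]; last by rewrite r0.
  rewrite Ev in rv.
  apply: runsI; rewrite /search_b; wps.
  wpcall rv; split; last by lia.
  by move: E; rewrite (roots_nil r0) /upto /= madd0r => ->.
- case: Hv => [[Ev nm]|[q [Ev /andP[md1 md2] _]]]; rewrite Ev in rv.
    have r0 : roots rem = [::].
      apply/eqP; apply: contraT => ne.
      have [|e el] := median_ex ne; last by rewrite (negPf (nm e el)).
      by apply: sub_all rp => e; apply: le_trans.
    apply: runsI; rewrite /search_b; wps.
    wpcall rv; split; last by rewrite mulSn; lia.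
    by move: E; rewrite (roots_nil r0) /upto /= madd0r => ->.
  have fs := fsum_run iw ir q b gT.
  have [W1 W2] := wall_cut q gR.
  have Er : 2 * (4 / 3) ^+ r.+1 = (4 / 3) * (2 * (4 / 3) ^+ r) :> R.
    by rewrite exprS; ring.
  have sz p : size (map p rem) = size rem by rewrite size_map.
  apply: runsI; rewrite /search_b; wps.
  wpcall rv; wpcall fs; wpm; rewrite -/(mg _ q) sgn; case: (ltP m q) => mq; wps.
    wpcall (cutl_run iw ir q rem).
    have e1 : madd acc (upto m (allE (map (cutl q) rem))) =
        madd b (upto m (allE ts)) by rewrite (upto_cutl gR).
    have e2 : wall (roots (map (cutl q) rem)) < 2 * (4 / 3) ^+ r.
      by move: hw; rewrite Er; lra.
    have rI := IH _ _ (gts_cutl q gR) sgn e1 e2.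
    wpcall rI; split=> //; rewrite !size_map; move: (size rem) (size ts) => x y.
    by rewrite [(r.+2 * _)%N]mulSn; lia.
  have [a' [ra Ea]] := cutr_run iw ir acc gR mq.
  have e1 : madd a' (upto m (allE (map (cutr q) rem))) =
      madd b (upto m (allE ts)) by rewrite Ea.
  have e2 : wall (roots (map (cutr q) rem)) < 2 * (4 / 3) ^+ r.
    by move: hw; rewrite Er; lra.
  have rI := IH _ _ (gts_cutr q gR) sgn e1 e2.
  wpcall ra; wpcall rI; split=> //; rewrite !size_map.
  move: (size rem) (size ts) => x y.
  by rewrite [(r.+2 * _)%N]mulSn; lia.
Qed.

Lemma zero_run K b (ts : seq tr) s m :
    gts K ts -> (size ts <= K)%N -> represents b (allE ts) s -> s.2 m = 0 ->
    (forall x y, x <= y -> y - x <= s.2 y - s.2 x) ->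
  runs zero_b (P (encm b) (enctl ts))
    (P (X m) (encm (madd b (upto m (allE ts))))) (300 * K.+1 ^ 3).
Proof.
move=> g sK rep gm inc.
have [s0 Em] := slope_gt0 rep gm inc.
have sgn x : (0 < mg (madd b (upto x (allE ts))) x) = (m < x).
  rewrite mgD mg_upto rep.2; apply/idP/idP => h.
    by case: (leP x m) => // xm; have := inc _ _ xm; rewrite gm; lra.
  by have := inc m x (ltW h); rewrite gm; lra.
(* At most [K] trees of weight at most [2^K] weigh at most [4^K] together, and [(4 / 3)^6 > 4]; so
   [6 K] rounds suffice. *)
have W0 : wall (roots ts) < 2 * (4 / 3) ^+ (6 * K).
  apply: le_lt_trans (wall_roots g) _.
  apply: (@le_lt_trans _ _ (4 ^+ K)).
    apply: le_trans (_ : 2 ^+ K * 2 ^+ K <= _).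
      rewrite ler_wpM2r ?exprn_ge0 // -natrX ler_nat.
      by apply: leq_trans sK (ltnW (ltn_expl _ _)).
    by rewrite -exprMn_comm ?le_eqVlt; [rewrite -natrM eqxx|exact: mulrC].
  rewrite exprM; apply: (@le_lt_trans _ _ (((4 / 3) ^+ 6) ^+ K)).
    by apply: lerXn2r; rewrite ?nnegrE; lra.
  have : 0 < ((4 / 3 : R) ^+ 6) ^+ K by rewrite !exprn_gt0 //; lra.
  by lra.
have sr := search_run g g sgn erefl W0.
apply: runsI; rewrite /zero_b; wps.
wpcall sr; rewrite -/(slope_at _ _ _); split.
  by congr (P (X _) _); exact: esym Em.
move: (size ts) sK => x xK.
have : ((x + 2) * x + (10 * K.+1 + 5) * x + 12 * x + 5 <= 40 * (K.+1 * K.+1))%N.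
  have : (x * x <= K * K)%N by exact: leq_mul.
  have : (K * x <= K * K)%N by rewrite leq_mul2l xK orbT.
  by nia.
move: (_ + 5)%N => y hy.
have : ((6 * K).+1 * y <= (7 * K.+1) * (40 * (K.+1 * K.+1)))%N.
  by apply: leq_mul => //; lia.
by rewrite !expnS expn0; nia.
Qed.

End Search.

(** Each vertex adds 1 to the leading coefficient of the base and two breakpoints to the tree, so
    comparing the bases compares the sizes. *)
Definition merge_b : ex := ltac:(code_of (fn (fun x =>
  LET a := x.f IN LET b := x.s IN
  << call madd_b << a.f, b.f >>,
     IF b.f.f [<] a.f.f THEN call addall_b << #1, #0, b.s, a.s >>
     ELSE call addall_b << #1, #0, a.s, b.s >> >>)%bex)).

(** * Messages towards the root *)

(** A vertex keeps its breakpoints from before the clamping ([rk.s.s]) and from after it ([mt]): the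
    second pass needs both, and merging leaves them intact. *)
Definition down_b : ex := ltac:(code_of (fn (fun F =>
  IF F THEN
    LET v := F.f IN
    LET rk := self F.s.f IN
    LET rs := self F.s.s IN
    LET b := call madd_b << call point_b << ap1 (GetR 1) v, #1 >>, rk.s.f >> IN
    LET G := << b, rk.s.s, cst 0 >> IN
    LET z := call zero_b G IN
    LET mt := (call prop_b << G, z >>).s.f IN
    << << v, z.f, b, rk.s.s, mt, rk.f, rs.f >>,
       call merge_b << << b, mt >>, rs.s >> >>
  ELSE << cst 0, << #0, #0, #0 >>, cst 0 >>)%bex)).

Definition lam (x : nat) : nat := x * trunc_log 2 x.

Lemma tl_double a b : 0 < a -> 2 * a <= b -> (trunc_log 2 a).+1 <= trunc_log 2 b.
Proof.
move=> a0 ab; apply: trunc_log_max => //; rewrite expnS.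
by apply: leq_trans ab; rewrite leq_mul2l trunc_logP.
Qed.

Lemma lam_mono a b : a <= b -> lam a <= lam b.
Proof. by move=> ab; apply: leq_mul => //; exact: leq_trunc_log. Qed.

Lemma lam_merge a b : minn a b + lam a + lam b <= lam (a + b).
Proof.
wlog ab : a b / a <= b.
  move=> H; case/orP: (leq_total a b) => [/H //|/H].
  by rewrite minnC [b + a]addnC -!addnA [lam b + _]addnC.
rewrite (minn_idPl ab); case: a ab => [|a] ab.
  by rewrite /lam mul0n !add0n.
rewrite /lam mulnDl; apply: leq_add.
  by rewrite -mulnS leq_mul2l tl_double //; lia.
by rewrite leq_mul2l; apply/orP; right; apply: leq_trunc_log; exact: leq_addl.
Qed.

Section Down.
Variable R : realType.
Local Open Scope ring_scope.
Variables (iw : nat -> nat -> nat) (ir : nat -> nat -> R).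
Local Notation gamma := (ir 0 0).
Local Notation t := (ir 1).
Hypothesis gamma_ge0 : 0 <= gamma.
Local Notation val := (val R).
Local Notation runs := (runs iw ir).
Local Notation tr := (tr R).
Local Notation mom := (mom R).
Local Notation madd_run := (madd_run iw ir).
Local Notation point_run := (point_run iw ir).

(** Sizes are bounded rather than heights because they add up exactly under insertion; [wfs_gts]
    converts. *)
Fixpoint wfs (N : nat) (ts : seq tr) : Prop :=
  if ts is t :: s then
    [/\ ok t, srt (evs t), (nodes t <= N)%N & wfs N s]
  else True.

Lemma wfs_gts N K ts : (N.+1 ^ 2 <= 2 ^ K)%N -> wfs N ts -> gts K ts.
Proof.
move=> NK; elim: ts => //= u s IH [ku su nu /IH g]; split=> //.
rewrite -(leq_exp2l (m := 2)) //.
apply: leq_trans (hg_bound ku) _; apply: leq_trans NK.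
by rewrite leq_exp2r.
Qed.

Lemma wfs_le N N' ts : (N <= N')%N -> wfs N ts -> wfs N' ts.
Proof.
move=> le; elim: ts => //= u s IH [ku su nu /IH g]; split=> //.
exact: leq_trans nu le.
Qed.

Lemma sgts_run K N m ts : gts K ts -> wfs N ts ->
  [/\ runs sgts_b (P (X m) (P (X gamma) (enctl ts)))
        (enctl (map (sgt m gamma) ts)) ((20 * K.+1 + 2) * size ts),
      wfs N (map (sgt m gamma) ts) &
      allE (map (sgt m gamma) ts) = map (move_gt m gamma) (allE ts)].
Proof.
elim: ts => [|u s IH] /=.
  by split=> //; apply: runsI; rewrite /sgts_b; cbn [enctl]; wps; fin.
move=> [ku su hu gs] [_ _ nu /(IH gs) [rs ws es]].
have [k' e' s' h' r'] := sgt_ok iw ir m gamma_ge0 ku su.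
split.
- apply: runsI; rewrite /sgts_b; cbn [enctl]; wps.
  wpcall r'; wpcall rs; split=> //.
  have : (20 * (hg u).+1 <= 20 * K.+1)%N by rewrite leq_mul2l ltnS hu.
  by lia.
- by split=> //; rewrite -size_evs e' size_map size_evs.
- by rewrite map_cat e' es.
Qed.

Lemma prop_run K N b u s m (a : mom) :
    wfs N (u :: s) -> (N.+1 ^ 2 <= 2 ^ K)%N -> (size (u :: s) <= K)%N ->
    a.1.1 = slope_at b (allE (u :: s)) m ->
  exists u' s',
    [/\ runs prop_b (P (P (encm b) (enctl (u :: s))) (P (X m) (encm a)))
          (P (encm b) (enctl (u' :: s'))) (400 * K.+1 ^ 2),
        wfs N.+2 (u' :: s'), nodes u' = (nodes u).+2, size s' = size s &
        perm_eq (allE (u' :: s')) (propagated gamma b (allE (u :: s)) m)].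
Proof.
move=> w NK sK Ea; have g := wfs_gts NK w.
have [rs ws es] := sgts_run m g w.
have [ku su nu wss] := ws.
have [_ _ hu _] := g.
set sl := slope_at _ _ _ in Ea *.
have [k1 p1 s1 /andP[_ h1] r1] := ins_ok iw ir m (- sl) ku su.
have [k2 p2 s2 _ r2] := ins_ok iw ir (m + gamma) sl k1 s1.
have hs : hg (sgt m gamma u) = hg u.
  by case: w => ku' su' _ _; have [] := sgt_ok iw ir m gamma_ge0 ku' su'.
have ns : nodes (sgt m gamma u) = nodes u.
  case: w => ku' su' _ _; have [_ e _ _ _] := sgt_ok iw ir m gamma_ge0 ku' su'.
  by rewrite -!size_evs e size_map.
exists (ins (m + gamma) sl (ins m (- sl) (sgt m gamma u))), (map (sgt m gamma) s).
have n2 : nodes (ins (m + gamma) sl (ins m (- sl) (sgt m gamma u))) = (nodes u).+2.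
  by rewrite -size_evs (perm_size p2) /= (perm_size p1) /= size_evs ns.
split=> //.
- apply: runsI; rewrite /prop_b; cbn [enctl]; wpm.
  wpcall rs; rewrite sub0r Ea; wpcall r1; wpcall r2; split=> //.
  move: sK; rewrite /= => sK; move: (size s) sK => y sK.
  have : ((20 * K.+1 + 2) * y.+1 <= (20 * K.+1 + 2) * K.+1)%N.
    by apply: leq_mul => //; lia.
  rewrite hs in h1 *.
  have q1 : (70 * (hg u).+1 <= 70 * K.+1)%N by rewrite leq_mul2l ltnS hu.
  have q2 : (70 * (hg (ins m (- sl) (sgt m gamma u))).+1 <= 70 * K.+2)%N.
    by rewrite leq_mul2l !ltnS; lia.
  by rewrite !expnS expn0; nia.
- by split=> //; [rewrite n2 !ltnS; case: w|exact: (wfs_le (leqW (leqnSn N)) wss)].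
- by rewrite size_map.
- rewrite [allE _]/= /propagated -/sl.
  apply: perm_trans (_ : perm_eq _ (((m + gamma, sl) :: (m, - sl) ::
    evs (sgt m gamma u)) ++ allE (map (sgt m gamma) s))) _.
    rewrite perm_cat2r; apply: perm_trans p2 _.
    by rewrite perm_cons; exact: p1.
  by rewrite /= -es /= !perm_cons.
Qed.

Lemma evs_nodes (u v : tr) E : perm_eq (evs u) (E ++ evs v) ->
  nodes u = (size E + nodes v)%N.
Proof. by move=> p; rewrite -!size_evs (perm_size p) size_cat. Qed.

Lemma scale1 (E : seq (R * R)) : scale 1 E = E.
Proof.
by rewrite /scale -[RHS]map_id; apply: eq_map => -[k c]; rewrite /= mul1r.
Qed.

Lemma hg_nodes K (u : tr) : ok u -> ((nodes u).+1 ^ 2 <= 2 ^ K)%N -> (hg u <= K)%N.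
Proof.
move=> ku nK; rewrite -(leq_exp2l (m := 2)) //.
exact: leq_trans (hg_bound ku) nK.
Qed.

Lemma addall_events K z (t1 t2 : tr) : ok t2 -> srt (evs t2) ->
    ((nodes t1 + nodes t2).+1 ^ 2 <= 2 ^ K)%N ->
  exists u,
    [/\ runs addall_b (P (X z) (P (X 0) (P (enct t1) (enct t2)))) (enct u)
          (80 * K.+1 * nodes t1),
        ok u, srt (evs u), nodes u = (nodes t1 + nodes t2)%N &
        perm_eq (evs u) (scale z (evs t1) ++ evs t2)].
Proof.
move=> k2 s2 nK; have [ku pu su _] := addall_ok iw ir z 0 t1 k2 s2.
rewrite shl0 in pu; have nu := evs_nodes pu.
rewrite size_map size_evs in nu.
exists (addall z 0 t1 t2); split=> //; apply: addall_run => //.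
by apply: hg_nodes; rewrite ?nu.
Qed.

Lemma merge_run K n1 b1 t1 n2 b2 t2 :
    ok t1 -> ok t2 -> srt (evs t1) -> srt (evs t2) ->
    nodes t1 = (2 * n1)%N -> nodes t2 = (2 * n2)%N ->
    b1.1.1 = n1%:R -> b2.1.1 = n2%:R ->
    ((2 * (n1 + n2)).+1 ^ 2 <= 2 ^ K)%N ->
  exists u,
    [/\ runs merge_b (P (P (encm b1) (enct t1)) (P (encm b2) (enct t2)))
          (P (encm (madd b1 b2)) (enct u)) (160 * K.+1 * minn n1 n2 + 2),
        ok u, srt (evs u), nodes u = (2 * (n1 + n2))%N &
        perm_eq (evs u) (evs t1 ++ evs t2)].
Proof.
move=> k1 k2 s1 s2 e1 e2 B1 B2 nK.
have nK1 : ((nodes t1 + nodes t2).+1 ^ 2 <= 2 ^ K)%N by rewrite e1 e2 -mulnDr.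
have nK2 : ((nodes t2 + nodes t1).+1 ^ 2 <= 2 ^ K)%N by rewrite addnC.
have L : (b2.1.1 < b1.1.1) = (n2 < n1)%N by rewrite B1 B2 ltr_nat.
case: (ltnP n2 n1) => h.
  have [u [ru ku su nu pu]] := addall_events 1 k1 s1 nK2.
  exists u; split=> //.
  - apply: runsI; rewrite /merge_b; wpm.
    wpcall (madd_run b1 b2); wpm; rewrite L h; wps; wpcall ru.
    by split=> //; rewrite e2; lia.
  - by rewrite nu e1 e2; lia.
  - by apply: perm_trans pu _; rewrite scale1 perm_catC.
have [u [ru ku su nu pu]] := addall_events 1 k2 s2 nK1.
exists u; split=> //.
- apply: runsI; rewrite /merge_b; wpm.
  wpcall (madd_run b1 b2); wpm; rewrite L ltnNge h; wps; wpcall ru.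
  by split=> //; rewrite e1; lia.
- by rewrite nu e1 e2; lia.
- by rewrite scale1 in pu.
Qed.

Inductive aforest :=
| AE | AN of nat & R & mom & tr & tr & aforest & aforest.

Fixpoint encf (F : forest) : val :=
  if F is FN v K Z then P (W v) (P (encf K) (encf Z)) else W 0.

Fixpoint encaf (F : aforest) : val :=
  if F is AN v m b dt mt K Z then
    P (W v) (P (X m) (P (encm b) (P (enct dt) (P (enct mt)
      (P (encaf K) (encaf Z))))))
  else W 0.

Definition fsize (F : forest) : nat := size (verts F).

Definition solo (v : nat) (K : forest) : forest := FN v K FE.

Fixpoint bsum (A : aforest) : mom :=
  if A is AN _ _ b _ _ _ Z then madd b (bsum Z) else (0, 0, 0).

(** [dt] describes the branch of [v] as a function of the value at [v], and [mt] as a function of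
    the value at the parent; both go with the same base [b]. *)
Fixpoint ann (F : forest) (A : aforest) : Prop :=
  match F, A with
  | FE, AE => True
  | FN v K Z, AN v' m b dt mt AK AZ =>
      [/\ [/\ v' = v, m = ropt gamma t v K, b.1.1 = (fsize K).+1%:R &
              b = madd (point (t v) 1) (bsum AK)],
          [/\ ok dt, srt (evs dt), nodes dt = (2 * fsize K)%N &
              represents b (evs dt) (rnode gamma t v K)],
          [/\ ok mt, srt (evs mt), nodes mt = (2 * (fsize K).+1)%N &
              represents b (evs mt) (sem gamma t (solo v K))],
          ann K AK & ann Z AZ]
  | _, _ => False
  end.

Lemma representsD (b1 : mom) E1 s1 (b2 : mom) E2 s2 s :
    represents b1 E1 s1 -> represents b2 E2 s2 ->
    (forall x, s.1 x = s1.1 x + s2.1 x) -> (forall x, s.2 x = s1.2 x + s2.2 x) ->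
  represents (madd b1 b2) (E1 ++ E2) s.
Proof.
move=> [f1 g1] [f2 g2] hf hg'; split=> x.
  by rewrite mfD evh_cat hf -f1 -f2; ring.
by rewrite mgD evh_cat hg' -g1 -g2; ring.
Qed.

Lemma represents_perm b E E' (s : (R -> R) * (R -> R)) :
  perm_eq E E' -> represents b E s -> represents b E' s.
Proof. by move=> p [f g]; split=> x; rewrite -(evh_perm _ _ p). Qed.

Lemma represents_node b E s v : represents b E s ->
  represents (madd (point (t v) 1) b) E (node (t v) s).
Proof.
move=> [f g]; split=> x.
  by rewrite mfD -addrA f /mf /point /node /=; ring.
by rewrite mgD -addrA g /mg /point /node /=; ring.
Qed.

Lemma rnode_incr v K x y : x <= y ->
  y - x <= (rnode gamma t v K).2 y - (rnode gamma t v K).2 x.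
Proof. exact/node_incr/message_sem. Qed.

Lemma sem_solo v K s : s = sem gamma t (solo v K) ->
  (forall x, s.1 x = (rnode gamma t v K).1 (clamp gamma (ropt gamma t v K) x)) /\
  (forall x, s.2 x = (rnode gamma t v K).2 (clamp gamma (ropt gamma t v K) x)).
Proof. by move=> ->; split=> x /=; rewrite addr0. Qed.

Lemma represents_ext b E (s s' : (R -> R) * (R -> R)) :
  s.1 =1 s'.1 -> s.2 =1 s'.2 -> represents b E s -> represents b E s'.
Proof. by move=> e1 e2 [f g]; split=> x; rewrite ?f ?g. Qed.

Lemma down_run K n F : (fsize F <= n)%N -> ((2 * n).+3 ^ 2 <= 2 ^ K)%N -> (0 < K)%N ->
  exists AF b u,
    [/\ runs down_b (encf F) (P (encaf AF) (P (encm b) (enct u)))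
          (800 * K.+1 ^ 3 * fsize F + 160 * K.+1 * lam (fsize F)),
        ann F AF,
        b = bsum AF /\ b.1.1 = (fsize F)%:R,
        [/\ ok u, srt (evs u) & nodes u = (2 * fsize F)%N] &
        represents b (evs u) (sem gamma t F)].
Proof.
move=> Fn nK K0; elim: F Fn => [|v Kd IHK Z IHZ] Fn.
  exists AE, (0, 0, 0), Lf; split=> //.
  - by apply: runsI; rewrite /down_b; cbn [encf]; wps; fin.
  - by split=> x; rewrite /evh big_nil /mf /mg /=; ring.
have fE : fsize (FN v Kd Z) = (fsize Kd).+1 + fsize Z :> nat.
  by rewrite /fsize /= size_cat.
rewrite fE in Fn *.
have [|AK [bk [tk [rk ak [Ek Bk] [kk sk nk] pk]]]] := IHK; first by lia.
have [|AZ [bz [tz [rz az [Ez Bz] [kz sz nz] pz]]]] := IHZ; first by lia.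
pose b := madd (point (t v) 1) bk.
have rn : represents b (evs tk) (rnode gamma t v Kd) := represents_node v pk.
have rn' : represents b (allE [:: tk]) (rnode gamma t v Kd).
  by rewrite /= cats0.
have w : wfs (2 * n) [:: tk] by split=> //; rewrite nk leq_mul2l; lia.
have nK' : ((2 * n).+1 ^ 2 <= 2 ^ K)%N.
  by apply: leq_trans nK; rewrite leq_exp2r //; lia.
set m := ropt gamma t v Kd.
have zr := zero_run iw ir (wfs_gts nK' w) K0 rn' (ropt_zero gamma_ge0 t v Kd)
  (@rnode_incr v Kd).
set a := madd b _ in zr.
have Ea : a.1.1 = slope_at b (allE [:: tk]) m by [].
have [mt [s' [pr w' nm s0 pe]]] := prop_run w nK' K0 Ea.
have {}s0 : s' = [::] := size0nil s0.
rewrite {}s0 in w' pr pe.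
have [km sm _ _] := w'.
have rm : represents b (evs mt) (sem gamma t (solo v Kd)).
  have [e1 e2] := sem_solo (erefl (sem gamma t (solo v Kd))).
  have := propagate gamma_ge0 rn' (ropt_zero gamma_ge0 t v Kd).
  rewrite -/m => H; rewrite perm_sym in pe.
  have := represents_perm pe H; rewrite /= cats0.
  by apply: represents_ext => x; [exact: esym (e1 x)|exact: esym (e2 x)].
have nm' : nodes mt = (2 * (fsize Kd).+1)%N by rewrite nm nk mulnS.
have bE : b.1.1 = (fsize Kd).+1%:R by rewrite /= Bk -natr1 addrC.
have [|u [ru ku su nu pu]] := merge_run (K := K) km kz sm sz nm' nz bE Bz.
  by apply: leq_trans nK; rewrite leq_exp2r //; lia.
exists (AN v m b tk mt AK AZ), (madd b bz), u; split.
- apply: runsI; rewrite /down_b; cbn [encf]; wps.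
  wpcall rk; wpcall rz; wpcall (point_run (t v) 1).
  wpcall (madd_run (point (t v) 1) bk).
  wpcall zr; wpcall pr; wpcall ru; split=> //.
  have lm := lam_merge (fsize Kd).+1 (fsize Z).
  have lk : (lam (fsize Kd) <= lam (fsize Kd).+1)%N by exact: lam_mono.
  have : (160 * K.+1 * (minn (fsize Kd).+1 (fsize Z) + lam (fsize Kd) + lam (fsize Z))
     <= 160 * K.+1 * lam ((fsize Kd).+1 + fsize Z))%N.
    by rewrite leq_mul2l; apply/orP; right; lia.
  have : (400 * K.+1 ^ 2 <= 400 * K.+1 ^ 3)%N.
    by rewrite leq_mul2l; apply/orP; right; rewrite leq_exp2l.
  have : (0 < K.+1 ^ 3)%N by rewrite expn_gt0.
  move: (K.+1 ^ 3)%N (K.+1 ^ 2)%N (K.+1) => x y z.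
  move: (lam _) (lam _) (lam _) (minn _ _) => l1 l2 l3 l4.
  by move: (fsize Kd) (fsize Z) => q1 q2; nia.
- by split=> //; split=> //; rewrite /b Ek.
- split; first by rewrite /= Ez.
  have -> : (madd b bz).1.1 = b.1.1 + bz.1.1 by [].
  by rewrite bE Bz -natrD.
- by split=> //; rewrite nu.
- rewrite perm_sym in pu; apply: represents_perm pu _.
  by apply: representsD rm pz _ _ => x /=; rewrite addr0.
Qed.

End Down.

(** * Costs of the other roots *)

Definition msub_b : ex := ltac:(code_of (fn (fun x =>
  LET a := x.f IN LET b := x.s IN
  << (a.f [-] b.f), (a.s.f [-] b.s.f), (a.s.s [-] b.s.s) >>)%bex)).

Definition heavy_b : ex := ltac:(code_of (fn (fun F =>
  IF F THEN
    LET r := self F.s.s.s.s.s.s IN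
    IF r.s.f [<] F.s.s.f.f THEN << F.f, F.s.s.f >> ELSE r
  ELSE << cst 0, #0, #0, #0 >>)%bex)).

Definition lights_b : ex := ltac:(code_of (fn (fun x =>
  LET h := x.f IN LET F := x.s.f IN LET u := x.s.s IN
  IF F THEN
    LET Z := F.s.s.s.s.s.s IN
    IF F.f [=] h THEN self << h, Z, u >>
    ELSE self << h, Z, call addall_b << #1, #0, F.s.s.s.s.f, u >> >>
  ELSE u)%bex)).

(** [c] is the list prepared for the largest child, or [W 0] for any other child. *)
Definition rest_b : ex := ltac:(code_of (fn (fun x =>
  LET c := x.f IN LET X := x.s.f IN LET d := x.s.s.f IN
  LET b := x.s.s.s.f IN LET mt := x.s.s.s.s IN
  IF c THEN c
  ELSE << call msub_b << call madd_b << X.f, d.f >>, b >>,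
          call addall_b << #0 [-] #1, #0, mt, d.s >>, X.s >>)%bex)).

Definition step_b : ex := ltac:(code_of (fn (fun x =>
  LET G := x.f IN LET b := x.s.f IN LET dt := x.s.s IN
  LET X := call prop_b << G, call zero_b G >> IN
  LET z := call zero_b << call madd_b << X.f, b >>, dt, X.s >> IN
  LET m := z.f IN LET a := z.s IN
  << X, (a.f [*] m [*] m [-] #2 [*] a.s.f [*] m) [+] a.s.s >>)%bex)).

(** Run once per vertex, for its largest child. The siblings go into the first tree of the list, so
    the list does not get longer. *)
Definition ctx_b : ex := ltac:(code_of (fn (fun x =>
  LET K := x.f IN LET X := x.s.f IN LET b := x.s.s IN
  LET h := call heavy_b K IN
  << h.f, call msub_b << call madd_b << X.f, b >>, h.s >>,
     call lights_b << h.f, K, X.s.f >>, X.s.s >>)%bex)).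

Definition min_b : ex := ltac:(code_of (fn (fun x =>
  IF x.f [<] x.s.s.f THEN << x.f, x.s.f >> ELSE x.s.s)%bex)).

Section Helpers.
Variable R : realType.
Local Open Scope ring_scope.
Variables (iw : nat -> nat -> nat) (ir : nat -> nat -> R).
Local Notation gamma := (ir 0 0).
Local Notation t := (ir 1).
Hypothesis gamma_ge0 : 0 <= gamma.
Local Notation val := (val R).
Local Notation runs := (runs iw ir).
Local Notation tr := (tr R).
Local Notation mom := (mom R).
Local Notation madd_run := (madd_run iw ir).
Local Notation ann := (ann ir).
Local Notation sem := (sem gamma t).
Local Notation rnode := (rnode gamma t).

Definition msub (a b : mom) : mom := (a.1.1 - b.1.1, a.1.2 - b.1.2, a.2 - b.2).

Lemma msub_run a b : runs msub_b (P (encm a) (encm b)) (encm (msub a b)) 0.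
Proof. by apply: runsI; rewrite /msub_b /encm; wps; fin. Qed.

Lemma min_run x v y (w : val) :
  runs min_b (P (X x) (P (W v) (P (X y) w)))
    (if x < y then P (X x) (W v) else P (X y) w) 0.
Proof. by apply: runsI; rewrite /min_b; wps; case: (x < y); fin. Qed.

Fixpoint nch (F : forest) : nat := if F is FN _ _ Z then (nch Z).+1 else 0.

Fixpoint child_at (F : forest) (A : aforest R) v K b mt : Prop :=
  match F, A with
  | FN v' K' Z, AN _ _ b' _ mt' _ AZ =>
      [/\ v' = v, K' = K, b' = b & mt' = mt] \/ child_at Z AZ v K b mt
  | _, _ => False
  end.

Lemma child_at_ann F A v K b mt : ann F A -> child_at F A v K b mt ->
  b.1.1 = (fsize K).+1%:R /\
  [/\ ok mt, srt (evs mt), nodes mt = (2 * (fsize K).+1)%N &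
      represents b (evs mt) (sem (solo v K))].
Proof.
elim: F A => // v' K' _ Z IHZ [//|v'' m b' dt mt' AK AZ] /=.
move=> [[_ _ Eb _] _ H _ aZ] [[<- <- <- <-]|/(IHZ _ aZ) //].
by split.
Qed.

Lemma child_at_vert F A v K b mt : child_at F A v K b mt ->
  v \in verts F /\ (fsize K < fsize F)%N.
Proof.
elim: F A => // v' K' _ Z IHZ [//|v'' m b' dt mt' AK AZ] /=.
rewrite /fsize /= size_cat => -[[<- <- _ _]|/IHZ [vZ h]].
  by rewrite inE eqxx; split=> //; rewrite ltnS leq_addr.
by rewrite inE mem_cat vZ !orbT; split=> //; rewrite /fsize in h; lia.
Qed.

Lemma child_at_light F A v K b mt v' K' b' mt' : v != v' ->
    child_at F A v K b mt -> child_at F A v' K' b' mt' ->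
  ((fsize K).+1 + (fsize K').+1 <= fsize F)%N.
Proof.
move=> ne; elim: F A => // w L _ Z IHZ [//|w' m b0 dt mt0 AK AZ] /=.
have fE : fsize (FN w L Z) = ((fsize L).+1 + fsize Z)%N.
  by rewrite /fsize /= size_cat.
rewrite fE => -[[e1 <- _ _]|h1] -[[e2 <- _ _]|h2].
- by rewrite -e1 -e2 eqxx in ne.
- by have [_ h] := child_at_vert h2; lia.
- by have [_ h] := child_at_vert h1; lia.
- by have := IHZ _ h1 h2; lia.
Qed.

Lemma heavy_run F A : ann F A -> exists h bh,
  runs heavy_b (encaf A) (P (W h) (encm bh)) (nch F) /\
  (F = FE /\ bh = (0, 0, 0) \/
   exists Kh mh, child_at F A h Kh bh mh /\
     forall v K b mt, child_at F A v K b mt -> (fsize K <= fsize Kh)%N).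
Proof.
elim: F A => [|v K _ Z IHZ] [|v' m b dt mt AK AZ] //=.
  move=> _; exists 0%N, (0, 0, 0); split; last by left.
  by apply: runsI; rewrite /heavy_b; cbn [encaf]; wps; fin.
move=> [[-> _ Eb _] _ _ _ aZ]; have [h [bh [rh H]]] := IHZ _ aZ.
case L: (bh.1.1 < b.1.1).
  exists v, b; split.
    apply: runsI; rewrite /heavy_b; cbn [encaf]; wps.
    by wpcall rh; wpm; rewrite L; wps; split=> //; lia.
  right; exists K, mt; split; first by left.
  move=> v2 K2 b2 mt2 [[_ <- _ _]//|c2].
  case: H => [[ZE _]|[Kh [mh [ch le]]]]; first by rewrite ZE in c2.
  have := le _ _ _ _ c2; have [Ebh _] := child_at_ann aZ ch.
  by move: L; rewrite Ebh Eb ltr_nat; lia.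
exists h, bh; split.
  apply: runsI; rewrite /heavy_b; cbn [encaf]; wps.
  by wpcall rh; wpm; rewrite L; wps; split=> //; lia.
right; case: H => [[ZE bE]|[Kh [mh [ch le]]]].
  by move: L; rewrite bE Eb /= ltr0n.
exists Kh, mh; split; first by right.
move=> v2 K2 b2 mt2 [[_ <- _ _]|/le //].
have [Ebh _] := child_at_ann aZ ch.
by move: L; rewrite Ebh Eb ltr_nat; lia.
Qed.

Fixpoint light_size (h : nat) (F : forest) : nat :=
  if F is FN v K Z then
    (if v == h then 0 else (fsize K).+1) + light_size h Z
  else 0.

Fixpoint light_evs (h : nat) (A : aforest R) : seq (R * R) :=
  if A is AN v _ _ _ mt _ Z then
    (if v == h then [::] else evs mt) ++ light_evs h Z
  else [::].

Fixpoint heavy_evs (h : nat) (A : aforest R) : seq (R * R) :=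
  if A is AN v _ _ _ mt _ Z then
    (if v == h then evs mt else [::]) ++ heavy_evs h Z
  else [::].

Lemma light_size_le h F : (light_size h F <= fsize F)%N.
Proof.
elim: F => // v K _ Z IH; rewrite /fsize /= size_cat -/(fsize _) -/(fsize _).
by case: eqP => _; rewrite /fsize in IH *; lia.
Qed.

Lemma lights_run k h F A (u : tr) : ann F A -> ok u -> srt (evs u) ->
    ((2 * light_size h F + nodes u).+1 ^ 2 <= 2 ^ k)%N ->
  exists u',
    [/\ runs lights_b (P (W h) (P (encaf A) (enct u))) (enct u')
          (160 * k.+1 * light_size h F + 2 * nch F),
        ok u', srt (evs u'), nodes u' = (2 * light_size h F + nodes u)%N &
        perm_eq (evs u') (light_evs h A ++ evs u)].
Proof.
elim: F A u => [|v K _ Z IHZ] [|v' m b dt mt AK AZ] u //=.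
  move=> _ ku su _; exists u; split=> //.
  by apply: runsI; rewrite /lights_b; cbn [encaf]; wps; fin.
move=> [[-> _ _ _] _ [km sm nm _] _ aZ] ku su nk.
case E: (v == h); rewrite E in nk *.
  have [u' [ru ku' su' nu' pu']] := IHZ AZ u aZ ku su nk.
  exists u'; split=> //.
  apply: runsI; rewrite /lights_b; cbn [encaf]; wps.
  rewrite E; wps; wpcall ru; split=> //; lia.
have [|u1 [r1 k1 s1 n1 p1]] := addall_events iw ir (K := k) 1 ku su (t1 := mt).
  by apply: leq_trans nk; rewrite leq_exp2r // nm; lia.
have [|u' [ru ku' su' nu' pu']] := IHZ AZ u1 aZ k1 s1.
  by apply: leq_trans nk; rewrite leq_exp2r // n1 nm; lia.
exists u'; split=> //.
- apply: runsI; rewrite /lights_b; cbn [encaf]; wps.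
  by rewrite E; wps; wpcall r1; wpcall ru; split=> //; rewrite nm; nia.
- by rewrite nu' n1 nm; lia.
- apply: perm_trans pu' _; rewrite scale1 in p1.
  apply: perm_trans (_ : perm_eq _ (light_evs h AZ ++ evs mt ++ evs u)) _.
    by rewrite perm_cat2l.
  by rewrite perm_catCA catA.
Qed.

Lemma represents_split h F A : ann F A ->
  represents (bsum A) (light_evs h A ++ heavy_evs h A) (sem F).
Proof.
elim: F A => [|v K _ Z IHZ] [|v' m b dt mt AK AZ] //=.
  by move=> _; split=> x; rewrite /evh big_nil /mf /mg /=; ring.
move=> [[-> _ _ _] _ [_ _ _ rm] _ aZ].
have H := representsD rm (IHZ _ aZ) (s := sem (FN v K Z)).
have {}H := H ltac:(by move=> x; rewrite /= addr0) ltac:(by move=> x; rewrite /= addr0).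
apply: represents_perm H; case: (v == h) => /=.
  by rewrite perm_catCA.
by rewrite catA.
Qed.

Lemma heavy_evs_out h F A : ann F A -> h \notin verts F -> heavy_evs h A = [::].
Proof.
elim: F A => [|v K _ Z IHZ] [|v' m b dt mt AK AZ] //= [[-> _ _ _] _ _ _ aZ].
rewrite inE mem_cat !negb_or => /and3P[hv _ hZ].
by rewrite eq_sym (negPf hv) /= IHZ.
Qed.

Lemma heavy_evs_at F A h K b mt : ann F A -> uniq (verts F) ->
  child_at F A h K b mt -> heavy_evs h A = evs mt.
Proof.
elim: F A => [|v K' _ Z IHZ] [|v' m b' dt mt' AK AZ] //= [[-> _ _ _] _ _ _ aZ].
rewrite mem_cat negb_or cat_uniq => /andP[/andP[_ vZ] /and3P[_ _ uZ]].
case=> [[<- _ _ <-]|c].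
  by rewrite eqxx (heavy_evs_out aZ vZ) cats0.
have [hZ _] := child_at_vert c.
case: eqP => [e|_]; first by rewrite e hZ in vZ.
exact: IHZ.
Qed.

Lemma child_at_uniq F A v K b mt K' b' mt' : ann F A -> uniq (verts F) ->
  child_at F A v K b mt -> child_at F A v K' b' mt' ->
  [/\ K = K', b = b' & mt = mt'].
Proof.
elim: F A => [|w L _ Z IHZ] [|w' m b0 dt mt0 AK AZ] //= [_ _ _ _ aZ].
rewrite mem_cat negb_or cat_uniq => /andP[/andP[_ wZ] /and3P[_ _ uZ]].
have out K0 b1 m1 : w = v -> child_at Z AZ v K0 b1 m1 -> False.
  by move=> <- /child_at_vert [h _]; rewrite h in wZ.
case=> [[e1 <- <- <-]|h1] [[e2 <- <- <-]|h2] //.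
- by case: (out _ _ _ e1 h2).
- by case: (out _ _ _ e2 h1).
- exact: IHZ h1 h2.
Qed.

(** What the parent [u] sends to its child [v], before clamping; [C] is the
    branch of [u] leading to the root. *)
Definition others u L C v K : (R -> R) * (R -> R) :=
  (fun x => (rnode u L).1 x + (sem C).1 x - (sem (solo v K)).1 x,
   fun x => (rnode u L).2 x + (sem C).2 x - (sem (solo v K)).2 x).

(** Negated events subtract without locating what is to be removed. In contrast, [represents_cancel]
    drops events that already form a separate part of the list. *)
Lemma represents_sub b1 E1 s1 b2 E2 s2 s :
    represents b1 E1 s1 -> represents b2 E2 s2 ->
    (forall x, s.1 x = s1.1 x - s2.1 x) -> (forall x, s.2 x = s1.2 x - s2.2 x) ->
  represents (msub b1 b2) (scale (-1) E2 ++ E1) s.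
Proof.
move=> [f1 g1] [f2 g2] hf hg'; split=> x.
  by rewrite evh_cat evh_scale hf -f1 -f2 /mf /=; ring.
by rewrite evh_cat evh_scale hg' -g1 -g2 /mg /=; ring.
Qed.

Lemma represents_cancel b1 E s1 b2 E2 s2 s :
    represents b1 (E ++ E2) s1 -> represents b2 E2 s2 ->
    (forall x, s.1 x = s1.1 x - s2.1 x) -> (forall x, s.2 x = s1.2 x - s2.2 x) ->
  represents (msub b1 b2) E s.
Proof.
move=> [f1 g1] [f2 g2] hf hg'; split=> x.
  by rewrite hf -f1 -f2 evh_cat /mf /=; ring.
by rewrite hg' -g1 -g2 evh_cat /mg /=; ring.
Qed.

Lemma rest_run k N u L C v K b mt du bu Xb Xts :
    represents bu (evs du) (rnode u L) -> ok du -> srt (evs du) ->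
    represents Xb (allE Xts) (sem C) -> wfs N Xts ->
    represents b (evs mt) (sem (solo v K)) ->
    (nodes mt + nodes du <= N)%N -> (N.+1 ^ 2 <= 2 ^ k)%N ->
  exists Gb Gts,
    [/\ runs rest_b (P (W 0) (P (P (encm Xb) (enctl Xts))
          (P (P (encm bu) (enct du)) (P (encm b) (enct mt)))))
          (P (encm Gb) (enctl Gts)) (80 * k.+1 * nodes mt + 3),
        represents Gb (allE Gts) (others u L C v K),
        wfs N Gts & size Gts = (size Xts).+1].
Proof.
move=> ru ku su rX wX rm nN nk.
have [|w [rw kw sw nw pw]] := addall_events iw ir (K := k) (-1) ku su (t1 := mt).
  by apply: leq_trans nk; rewrite leq_exp2r.
exists (msub (madd Xb bu) b), (w :: Xts); split=> //.
- apply: runsI; rewrite /rest_b; wps.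
  wpcall (madd_run Xb bu); wpcall (msub_run (madd Xb bu) b).
  by rewrite sub0r; wpcall rw; split=> //; lia.
- have H : represents (madd Xb bu) (allE Xts ++ evs du)
      (fun x => (rnode u L).1 x + (sem C).1 x, fun x => (rnode u L).2 x + (sem C).2 x).
    by apply: representsD rX ru _ _ => x /=; rewrite addrC.
  have H2 := represents_sub H rm (s := others u L C v K) (fun=> erefl) (fun=> erefl).
  apply: represents_perm H2; rewrite /=.
  apply: perm_trans (_ : perm_eq _ ((scale (-1) (evs mt) ++ evs du) ++ allE Xts)) _.
    by rewrite -catA perm_cat2l perm_catC.
  by rewrite perm_cat2r perm_sym.
- by split=> //; rewrite nw.
Qed.

(** The breakpoints of the largest child are omitted rather than cancelled, so that apart from a
    scan of the children only the light branches enter the cost. *)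
Lemma ctx_run k N v L C b AK Xb x0 Xts :
    ann L AK -> uniq (verts L) -> b = madd (point (t v) 1) (bsum AK) ->
    represents Xb (allE (x0 :: Xts)) (sem C) -> wfs N (x0 :: Xts) ->
    ((N + 2 * fsize L).+1 ^ 2 <= 2 ^ k)%N ->
  exists h Yb Yts,
    [/\ runs ctx_b (P (encaf AK) (P (P (encm Xb) (enctl (x0 :: Xts))) (encm b)))
          (P (W h) (P (encm Yb) (enctl Yts)))
          (160 * k.+1 * light_size h L + 3 * nch L + 4),
        forall w K bw mt, child_at L AK w K bw mt -> w != h ->
          (2 * (fsize K).+1 <= fsize L)%N,
        forall w K bw mt, child_at L AK w K bw mt -> w = h ->
          represents Yb (allE Yts) (others v L C w K),
        wfs (N + 2 * fsize L) Yts & size Yts = (size Xts).+1].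
Proof.
move=> aL uL bE rX [kx sx nx wX] nk.
have [h [bh [rh H]]] := heavy_run aL.
have ls := light_size_le h L.
have [|w [rw kw sw nw pw]] := lights_run (k := k) (h := h) aL kx sx.
  by apply: leq_trans nk; rewrite leq_exp2r //; lia.
exists h, (msub (madd Xb b) bh), (w :: Xts); split=> //.
- apply: runsI; rewrite /ctx_b; cbn [enctl]; wps.
  wpcall rh; wpcall (madd_run Xb b); wpcall (msub_run (madd Xb b) bh).
  by wpcall rw; split=> //; lia.
- move=> w' K bw mt c ne; case: H => [[LE _]|[Kh [mh [ch le]]]].
    by rewrite LE in c.
  by have := child_at_light ne c ch; have := le _ _ _ _ c; lia.
- move=> w' K bw mt c e; case: H => [[LE _]|[Kh [mh [ch le]]]].
    by rewrite LE in c.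
  rewrite e in c *; have [-> _ _] := child_at_uniq aL uL c ch.
  have [_ [_ _ _ rmh]] := child_at_ann aL ch.
  have rs := represents_split h aL.
  rewrite (heavy_evs_at aL uL ch) in rs.
  have rn := represents_node ir v rs; rewrite -bE in rn.
  have Q := representsD rX rn (s := (fun x => (rnode v L).1 x + (sem C).1 x,
    fun x => (rnode v L).2 x + (sem C).2 x)).
  have {}Q := Q ltac:(by move=> x; rewrite /= addrC) ltac:(by move=> x; rewrite /= addrC).
  rewrite catA in Q.
  have Q2 := represents_cancel Q rmh (s := others v L C h Kh) (fun=> erefl) (fun=> erefl).
  apply: represents_perm Q2; rewrite /=.
  apply: perm_trans (_ : perm_eq _ ((light_evs h AK ++ evs x0) ++ allE Xts)) _.
    by rewrite perm_catC catA.
  by rewrite perm_cat2r perm_sym.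
- split=> //; first by rewrite nw; lia.
  by apply: wfs_le wX; lia.
Qed.

End Helpers.

(** [d] and [X] belong to the parent of the trees in [A]: what its own children send it, and what it
    receives from above. [h] and [Y] are the label of its largest child and the list prepared for
    that child. *)
Definition up_b : ex := ltac:(code_of (fn (fun x =>
  LET A := x.f IN
  IF A THEN
    LET d := x.s.f IN LET X := x.s.s.f IN LET h := x.s.s.s.f IN
    LET Y := x.s.s.s.s.f IN LET best := x.s.s.s.s.s IN
    LET v := A.f IN LET b := A.s.s.f IN LET dt := A.s.s.s.f IN
    LET mt := A.s.s.s.s.f IN LET K := A.s.s.s.s.s.f IN
    LET G := call rest_b << IF v [=] h THEN Y ELSE cst 0, X, d, b, mt >> IN
    LET st := call step_b << G, b, dt >> IN
    LET cx := call ctx_b << K, st.f, b >> IN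
    LET best1 := call min_b << st.s, v, best >> IN
    LET best2 := self << K, << b, dt >>, st.f, cx.f, cx.s, best1 >> IN
    self << A.s.s.s.s.s.s, d, X, h, Y, best2 >>
  ELSE x.s.s.s.s.s)%bex)).

Fixpoint child_lam (F : forest) : nat :=
  if F is FN v K Z then lam (fsize K).+1 + child_lam Z else 0.

Lemma fsize_FN v K Z : fsize (FN v K Z) = (fsize K).+1 + fsize Z.
Proof. by rewrite /fsize /= size_cat. Qed.

Lemma fsize_fcat F G : fsize (fcat F G) = fsize F + fsize G.
Proof. by rewrite /fsize verts_fcat size_cat. Qed.

Lemma fcatA F G H : fcat (fcat F G) H = fcat F (fcat G H).
Proof. by elim: F => //= v K _ Z ->. Qed.

Lemma fcatF0 F : fcat F FE = F.
Proof. by elim: F => //= v K _ Z ->. Qed.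

Section Up.
Variable R : realType.
Local Open Scope ring_scope.
Variables (iw : nat -> nat -> nat) (ir : nat -> nat -> R).
Local Notation gamma := (ir 0 0).
Local Notation t := (ir 1).
Hypothesis gamma_ge0 : 0 <= gamma.
Local Notation runs := (runs iw ir).
Local Notation madd_run := (madd_run iw ir).
Local Notation ann := (ann ir).
Local Notation sem := (sem gamma t).
Local Notation rnode := (rnode gamma t).
Local Notation ropt := (ropt gamma t).
Local Notation rval := (rval gamma t).
Local Notation others := (others ir).

(** A light child has at most half of [S] vertices; replacing its logarithm by that of [S] gains one
    unit per vertex, which pays for inserting its breakpoints once. *)
Lemma light_lam h F A (S : nat) : ann F A -> (fsize F <= S)%N ->
    (forall v K b mt, child_at F A v K b mt -> v != h ->
       (2 * (fsize K).+1 <= S)%N) ->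
  (light_size h F + child_lam F <= fsize F * trunc_log 2 S)%N.
Proof.
elim: F A => [|v K _ Z IHZ] [|v' m b dt mt AK AZ] //=.
move=> [_ _ _ _ aZ]; rewrite fsize_FN => FS H.
have IH : (light_size h Z + child_lam Z <= fsize Z * trunc_log 2 S)%N.
  apply: IHZ aZ _ _; first by lia.
  by move=> w L b' mt' c; apply: H; right; exact: c.
suff : ((if v == h then 0 else (fsize K).+1) + lam (fsize K).+1 <=
        (fsize K).+1 * trunc_log 2 S)%N.
  by move=> le; rewrite mulnDl addnACA; apply: leq_add.
case: (v =P h) => [_|/eqP ne].
  by rewrite add0n /lam leq_mul2l /=; apply: leq_trunc_log; lia.
rewrite /lam -mulnS leq_mul2l /=; apply: tl_double => //.
by apply: H ne; left.
Qed.

(** With [v] as root, the former parent [u] with its remaining branches [C] is one more child of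
    [v]. The second search minimizes for [v], and its quadratic evaluated there is [rval]. *)
Lemma step_run k N u C Gb Gts v K b dt :
    represents Gb (allE Gts) (rnode u C) -> wfs N Gts ->
    (0 < size Gts)%N -> (size Gts < k)%N -> (N.+3 ^ 2 <= 2 ^ k)%N ->
    represents b (evs dt) (rnode v K) -> ok dt -> srt (evs dt) ->
    (nodes dt <= N)%N ->
  exists x0 xs,
    [/\ runs step_b (P (P (encm Gb) (enctl Gts)) (P (encm b) (enct dt)))
          (P (P (encm Gb) (enctl (x0 :: xs))) (X (rval v (fcat K (solo u C)))))
          (600 * k.+1 ^ 3 + 400 * k.+1 ^ 2 + 5),
        represents Gb (allE (x0 :: xs)) (sem (solo u C)),
        wfs N.+2 (x0 :: xs) & (size xs).+1 = size Gts].
Proof.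
move=> rG wG s0 sk Nk rn kd sd nd.
have Nk1 : (N.+1 ^ 2 <= 2 ^ k)%N by apply: leq_trans Nk; rewrite leq_exp2r //; lia.
have zr := zero_run iw ir (wfs_gts Nk1 wG) (ltnW sk) rG (ropt_zero gamma_ge0 t u C)
  (@rnode_incr R ir gamma_ge0 u C).
set m := ropt u C in zr; set a := madd Gb _ in zr.
case: Gts rG wG s0 sk @a zr => // g0 gs rG wG _ sk a zr.
have Ea : a.1.1 = slope_at Gb (allE (g0 :: gs)) m by [].
have [x0 [xs [pr w' _ sx pe]]] := prop_run iw gamma_ge0 wG Nk1 (ltnW sk) Ea.
have rX : represents Gb (allE (x0 :: xs)) (sem (solo u C)).
  have [e1 e2] := sem_solo (erefl (sem (solo u C))).
  have := propagate gamma_ge0 rG (ropt_zero gamma_ge0 t u C).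
  rewrite -/m => H; rewrite perm_sym in pe.
  have := represents_perm pe H.
  by apply: represents_ext => x; [exact: esym (e1 x)|exact: esym (e2 x)].
exists x0, xs; split=> //; last by rewrite /= sx.
pose T := fcat K (solo u C).
have rT : represents (madd Gb b) (allE (dt :: x0 :: xs)) (rnode v T).
  have Q := representsD rX rn (s := rnode v T).
  have {}Q := Q ltac:(by move=> x; rewrite /rnode /node /= sem_fcat1 /=; ring)
    ltac:(by move=> x; rewrite /rnode /node /= sem_fcat2 /=; ring).
  by apply: represents_perm Q; rewrite [allE (dt :: _)]/= perm_catC.
have wT : wfs N.+2 (dt :: x0 :: xs) by split=> //; lia.
have sT : (size (dt :: x0 :: xs) <= k)%N by rewrite /= sx.
have zT := zero_run iw ir (wfs_gts Nk wT) sT rT (ropt_zero gamma_ge0 t v T)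
  (@rnode_incr R ir gamma_ge0 v T).
apply: runsI; rewrite /step_b; cbn [enctl]; wps.
wpcall zr; wpcall pr; wpcall (madd_run Gb b); wpcall zT; wpm; split; last by lia.
congr (P _ (X _)); rewrite -/T /rval -rT.1 -mf_upto -mfD.
by [].
Qed.

Variables (n : nat) (en : rel nat).
Hypothesis en_irr : irreflexive en.

Definition attained (x : R) (r : nat) :=
  exists2 K, rooted n en r K & x = rval r K.

Definition improves (x : R) (r : nat) :=
  exists2 K, rooted n en r K & x <= rval r K.

(** [L] lists all children of [u], [F] those still to be visited, and [C] is the branch above [u].
    [NB] bounds the tree sizes, whose bound grows by [2 n + 2] per level; [J] bounds the length of
    the list, as a step that lengthens it halves the subtree. The factor 2 of [child_lam] arises
    because light branches are inserted twice: for their largest sibling and for their own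
    cancellation. The term [10 * nch F] pays for scanning siblings. *)
Lemma up_run k NB J : ((NB + 6 * n + 10) ^ 2 <= 2 ^ k)%N -> (J + 2 <= k)%N ->
  forall F A pre u L C bu du Xb x0 Xts h Yb Yts x r N,
    L = fcat pre F -> ann F A -> rooted n en u (fcat L C) ->
    [/\ represents bu (evs du) (rnode u L), ok du, srt (evs du) &
        (nodes du <= 2 * n)%N] ->
    represents Xb (allE (x0 :: Xts)) (sem C) -> wfs N (x0 :: Xts) ->
    [/\ (4 * n <= N)%N, (N + (2 * n + 2) * (fsize L).+1 <= NB)%N &
        ((size Xts).+1 + trunc_log 2 (fsize L).+1 <= J)%N] ->
    (forall v K b mt, child_at F A v K b mt -> v != h ->
       (2 * (fsize K).+1 <= fsize L)%N) ->
    (forall v K b mt, child_at F A v K b mt -> v = h ->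
       [/\ represents Yb (allE Yts) (others u L C v K), wfs (N + 2 * n) Yts &
           size Yts = (size Xts).+1]) ->
    attained x r ->
  exists x' r' c,
    [/\ runs up_b (P (encaf A) (P (P (encm bu) (enct du))
          (P (P (encm Xb) (enctl (x0 :: Xts))) (P (W h)
          (P (P (encm Yb) (enctl Yts)) (P (X x) (W r))))))) (P (X x') (W r')) c,
        (c + 10 * nch F <= 1100 * k.+1 ^ 3 * fsize F +
           160 * k.+1 * (light_size h F + 2 * child_lam F))%N,
        attained x' r', x' <= x &
        forall v, v \in verts F -> improves x' v].
Proof.
move=> NBk Jk; elim=> [|v K IHK Z IHZ] A pre u L C bu du Xb x0 Xts h Yb Yts x r N.
  case: A => // _ _ _ _ _ _ _ _ _ ax; exists x, r, 0%N; split=> //.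
  by apply: runsI; rewrite /up_b; cbn [encaf]; wps; fin.
case: A => // v' m b dt mt AK AZ EL aF rL [ru kd sd nd] rX wX [nN NL JL] Hl Hh ax.
have [[Ev Em Eb EbK] [kt st nt rt] [km sm nm rm] aK aZ] := aF.
rewrite {v'}Ev in Hl Hh aF *.
have ch0 : child_at (FN v K Z) (AN v m b dt mt AK AZ) v K b mt by left.
have sizeL : fsize L = (fsize pre + ((fsize K).+1 + fsize Z))%N.
  by rewrite EL fsize_fcat fsize_FN.
have Ln : (fsize L < n)%N.
  have := perm_size rL.1; rewrite size_iota /= -/(fsize _) fsize_fcat; lia.
have en_le q : (q <= NB + 6 * n + 10)%N -> (q ^ 2 <= 2 ^ k)%N.
  by move=> le; apply: leq_trans NBk; rewrite leq_exp2r.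
have NNB : (N + 2 * n + 2 <= NB)%N by rewrite mulnS in NL; lia.
pose C' := fcat pre (fcat Z C).
have rep Gb Gts : represents Gb (allE Gts) (others u L C v K) ->
    represents Gb (allE Gts) (rnode u C').
  apply: represents_ext => y; rewrite /others /rnode /node /= EL.
    by rewrite !sem_fcat1 /=; ring.
  by rewrite !sem_fcat2 /=; ring.
have [Gb [Gts [cg [rG cgl rpG wG [sG sGJ]]]]] : exists Gb Gts cg,
    [/\ runs rest_b (P (if v == h then P (encm Yb) (enctl Yts) else W 0)
          (P (P (encm Xb) (enctl (x0 :: Xts)))
          (P (P (encm bu) (enct du)) (P (encm b) (enct mt)))))
          (P (encm Gb) (enctl Gts)) cg,
        (cg <= 160 * k.+1 * (if v == h then 0 else (fsize K).+1) + 3)%N,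
        represents Gb (allE Gts) (rnode u C'), wfs (N + 2 * n) Gts &
        (0 < size Gts)%N /\ (size Gts + trunc_log 2 (fsize K).+1 <= J)%N].
  have tlm S : (S.+1 <= fsize L)%N ->
      (trunc_log 2 S.+1 <= trunc_log 2 (fsize L).+1)%N.
    by move=> le; apply: leq_trunc_log; lia.
  case: (v =P h) => [vh|/eqP ne].
    have [rY wY sY] := Hh _ _ _ _ ch0 vh.
    exists Yb, Yts, 0%N; split.
    - by apply: runsI; rewrite /rest_b; wps; fin.
    - by lia.
    - exact: rep.
    - exact: wY.
    - rewrite sY; split=> //; have := tlm (fsize K); lia.
  have [|||Gb [Gts [rg rpG wG sG]]] := rest_run (k := k) (N := N + 2 * n)
    (v := v) (K := K) (b := b) (mt := mt) iw gamma_ge0 ru kd sd rX _ rm.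
  - by apply: wfs_le wX; lia.
  - by rewrite nm; lia.
  - by apply: en_le; lia.
  exists Gb, Gts; eexists; split; first exact: rg.
  - by rewrite nm; lia.
  - exact: rep.
  - exact: wG.
  - have := tl_double _ (Hl _ _ _ _ ch0 ne).
    have := tlm (fsize K); rewrite sG /=.
    have : (trunc_log 2 (fsize L) <= trunc_log 2 (fsize L).+1)%N.
      exact: leq_trunc_log.
    by move=> a b' c; have := c isT; lia.
have rv : rooted n en v (fcat K (solo u C')).
  by apply: reroot; rewrite -fcatA -EL.
have [|||x1 [xs [rst rX' wX' sxs]]] := step_run (k := k) (K := K) rpG wG sG _ _ rt kt st.
- by lia.
- by apply: en_le; lia.
- by rewrite nt; lia.
have uK : uniq (verts K).
  by have /= := rooted_uniq rv; rewrite verts_fcat cat_uniq => /andP[_ /andP[]].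
have [|h' [Yb' [Yts' [rcx HlK HhK wY' sY']]]] :=
    ctx_run (k := k) iw gamma_ge0 aK uK EbK rX' wX'.
  by apply: en_le; lia.
pose x2 := rval v (fcat K (solo u C')).
pose xm := if x2 < x then x2 else x; pose rm' := if x2 < x then v else r.
have rmin : runs min_b (P (X x2) (P (W v) (P (X x) (W r)))) (P (X xm) (W rm')) 0.
  by have := min_run iw gamma_ge0 x2 v x (W r); rewrite /xm /rm'; case: (x2 < x).
have am : attained xm rm'.
  by rewrite /xm /rm'; case: (x2 < x) => //; exists (fcat K (solo u C')).
have xm2 : xm <= x2 by rewrite /xm; case: ltP.
have xmx : xm <= x by rewrite /xm; case: ltP => // /ltW.
have [|||xK [rK [cK [rupK cKl aK' xKm impK]]]] :=
    IHK AK FE v K (solo u C') b dt Gb x1 xs h' Yb' Yts' xm rm' (N + 2 * n).+2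
    erefl aK rv _ rX' wX' _ HlK _ am.
- by split=> //; rewrite nt; clear -sizeL Ln; lia.
(* The subtree below [v] has at least one vertex less, which frees [2 n + 2] in the budget for
   [N]. *)
- have KL : ((2 * n + 2) * (fsize K).+2 <= (2 * n + 2) * (fsize L).+1)%N.
    by rewrite leq_mul2l; clear -sizeL; lia.
  rewrite mulnS in KL; clear -KL NL NNB nN sxs sGJ; split; lia.
- move=> w K2 b2 mt2 c e; split; first exact: HhK c e.
    by apply: wfs_le wY'; clear -sizeL Ln; lia.
  by rewrite sY'.
have [|||||xZ [rZ [cZ [rupZ cZl aZ' xZK impZ]]]] :=
    IHZ AZ (fcat pre (FN v K FE)) u L C bu du Xb x0 Xts h Yb Yts xK rK N
    _ aZ rL _ rX wX _ _ _ aK'.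
- by rewrite fcatA.
- by [].
- by [].
- by move=> w K2 b2 mt2 c; apply: Hl; right; exact: c.
- by move=> w K2 b2 mt2 c; apply: Hh; right; exact: c.
pose c := (cg + (600 * k.+1 ^ 3 + 400 * k.+1 ^ 2 + 5) +
  (160 * k.+1 * light_size h' K + 3 * nch K + 4) + cK + cZ + 6)%N.
exists xZ, rZ, c; split=> //.
- apply: runsI; rewrite /up_b; cbn [encaf]; wps.
  case E: (v == h) in rG *; rewrite ?E; wps; wpcall rG; wpcall rst; wpcall rcx;
  wpcall rmin; wpcall rupK; wpcall rupZ; split=> //;
  rewrite /c; clear; lia.
- have LK : (light_size h' K + child_lam K <= lam (fsize K).+1)%N.
    apply: leq_trans (light_lam aK (leqnn _) HlK) _.
    by apply: leq_mul => //; apply: leq_trunc_log.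
  have {}LK : (160 * k.+1 * light_size h' K + 160 * k.+1 * child_lam K <=
               160 * k.+1 * lam (fsize K).+1)%N by rewrite -mulnDr leq_mul2l LK orbT.
  have k3 : (400 * k.+1 ^ 2 + 28 <= 500 * k.+1 ^ 3)%N.
    by rewrite (expnS _ 2); have := expn_gt0 k.+1 2; move: (k.+1 ^ 2)%N; clear; nia.
  rewrite fsize_FN /c /=; move: cKl cZl cgl LK k3; clear.
  set q := (if _ then _ else _); move: q => q.
  move: (k.+1 ^ 3)%N (k.+1 ^ 2)%N => a3 a2.
  move: (nch K) (nch Z) (lam _) (light_size h' K) => nK nZ l s.
  move: (child_lam K) (light_size h Z) (child_lam Z) => p s' p'.
  move: (fsize K) (fsize Z) (160 * k.+1)%N => fK fZ d.
  lia.
- exact: le_trans xZK (le_trans xKm xmx).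
- move=> w; rewrite /= inE mem_cat => /or3P[/eqP ->|/impK [T rT ?]|/impZ //].
    by exists (fcat K (solo u C')) => //; apply: le_trans xZK (le_trans xKm _).
  by exists T => //; apply: le_trans xZK _.
Qed.

End Up.

(** * The algorithm *)

Definition asg_b : ex := ltac:(code_of (fn (fun x =>
  LET A := x.f IN LET p := x.s.f IN LET out := x.s.s IN
  IF A THEN
    LET m := A.s.f IN
    LET q := IF m [<] p THEN m ELSE p IN
    LET o := p [-] ap1 (GetR 0) (cst 0) IN
    LET y := IF o [<] q THEN q ELSE o IN
    self << A.s.s.s.s.s.s, p,
            self << A.s.s.s.s.s.f, y, << << A.f, y >>, out >> >> >>
  ELSE out)%bex)).

(** The language has no writable arrays, so the adjacency lists are kept in a binary trie at
    logarithmic cost; the parity of an index comes from [Half] and subtraction. *)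
Definition get_b : ex := ltac:(code_of (fn (fun x =>
  LET i := x.f IN LET t := x.s IN
  IF t THEN
    IF i THEN
      LET p := ap2 SubW i (cst 1) IN LET j := ap1 Half p IN
      IF ap2 SubW (ap2 SubW p j) j THEN self << j, t.s.s >>
      ELSE self << j, t.s.f >>
    ELSE t.f
  ELSE cst 0)%bex)).

Definition add_b : ex := ltac:(code_of (fn (fun x =>
  LET i := x.f IN LET w := x.s.f IN LET t := x.s.s IN
  LET c := IF t THEN t ELSE << cst 0, cst 0, cst 0 >> IN
  IF i THEN
    LET p := ap2 SubW i (cst 1) IN LET j := ap1 Half p IN
    IF ap2 SubW (ap2 SubW p j) j THEN << c.f, c.s.f, self << j, w, c.s.s >> >>
    ELSE << c.f, self << j, w, c.s.f >>, c.s.s >>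
  ELSE << << w, c.f >>, c.s >>)%bex)).

(** A slot without an edge holds two zeros and is recognized by its equal endpoints, so the number
    of edges need not be known. *)
Definition adj_b : ex := ltac:(code_of (fn (fun x =>
  LET i := x.f IN LET t := x.s IN
  IF i THEN
    LET j := ap2 SubW i (cst 1) IN
    LET u := ap1 (GetW 1) j IN LET v := ap1 (GetW 2) j IN
    IF u [=] v THEN self << j, t >>
    ELSE self << j, call add_b << u, v, call add_b << v, u, t >> >> >>
  ELSE t)%bex)).

Definition build_b : ex := ltac:(code_of (fn (fun x =>
  LET t := x.f IN LET ns := x.s.f IN LET v := x.s.s.f IN LET g := x.s.s.s IN
  IF ns THEN
    LET w := ns.f IN LET Z := self << t, ns.s, v, g >> IN
    IF w [=] g THEN Z
    ELSE << w, self << t, call get_b << w, t >>, w, v >>, Z >>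
  ELSE cst 0)%bex)).

(** The list above the first root consists of one empty tree rather than being empty, so that
    [ctx_b] has a first tree to insert into. *)
Definition main_b : ex := ltac:(code_of (fn (fun x =>
  LET t := call adj_b << ap1 (GetW 0) (cst 0), cst 0 >> IN
  LET a := (call down_b
    << cst 0, call build_b << t, call get_b << cst 0, t >>, cst 0, cst 0 >>,
       cst 0 >>).f IN
  LET b := a.s.s.f IN LET d := << b, a.s.s.s.f >> IN
  LET K := a.s.s.s.s.s.f IN
  LET z := call zero_b << b, a.s.s.s.f, cst 0 >> IN
  LET X := << << #0, #0, #0 >>, cst 0, cst 0 >> IN
  LET cx := call ctx_b << K, X, b >> IN
  LET y := (z.s.f [*] z.f [*] z.f [-] #2 [*] z.s.s.f [*] z.f) [+] z.s.s.s IN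
  LET r := (call up_b << K, d, X, cx.f, cx.s, y, cst 0 >>).s IN
  LET a2 := (call down_b
    << r, call build_b << t, call get_b << r, t >>, r, r >>, cst 0 >>).f IN
  call asg_b << a2.s.s.s.s.s.f, a2.s.f, << r, a2.s.f >>, cst 0 >>)%bex)).

Fixpoint adjl (A : seq (nat * nat)) (u : nat) : seq nat :=
  if A is x :: A' then
    (if u == x.1 then [:: x.2] else [::]) ++ (if u == x.2 then [:: x.1] else [::])
      ++ adjl A' u
  else [::].

Lemma adjl_cat A B u : adjl (A ++ B) u = adjl A u ++ adjl B u.
Proof. by elim: A => //= x A ->; rewrite !catA. Qed.

Lemma mem_adjl A u v : (v \in adjl A u) = ((u, v) \in A) || ((v, u) \in A).
Proof.
elim: A => //= -[a b] A IH; rewrite !mem_cat IH !inE !xpair_eqE /=.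
by case: (u == a); case: (u == b); rewrite ?inE /= ?andbF ?andbT ?orbF; btauto.
Qed.

Lemma adjl_uniq A u : uniq A -> (forall x, x \in A -> x.1 != x.2) ->
    (forall u v, (u, v) \in A -> (v, u) \notin A) -> uniq (adjl A u).
Proof.
elim: A => //= -[a b] A IH /andP[nA uA] irr asym /=.
have nab : a != b by apply: irr (mem_head _ _).
have nA' : (b, a) \notin A.
  by have := asym a b (mem_head _ _); rewrite inE negb_or => /andP[].
have {}IH : uniq (adjl A u).
  apply: IH => // [x xA|v w vw]; first by apply: irr; rewrite inE xA orbT.
  by have := asym v w; rewrite !inE vw orbT negb_or => /(_ isT) /andP[].
case: (u =P a) => [ua|_]; case: (u =P b) => [ub|_] //=.
- by rewrite -ua -ub eqxx in nab.
- by rewrite IH mem_adjl ua (negPf nA) (negPf nA').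
- by rewrite IH mem_adjl ub (negPf nA) (negPf nA').
Qed.

Section Main.
Variable R : realType.
Local Open Scope ring_scope.
Variables (iw : nat -> nat -> nat) (ir : nat -> nat -> R).
Local Notation gamma := (ir 0 0).
Local Notation t := (ir 1).
Hypothesis gamma_ge0 : 0 <= gamma.
Local Notation val := (val R).
Local Notation runs := (runs iw ir).
Local Notation assign := (assign gamma t).
Local Notation encf := (@encf R).

Lemma asg_run F A x out : ann ir F A ->
  exists l, runs asg_b (P (encaf A) (P (X x) (out_val out))) (out_val l)
      (2 * fsize F) /\ perm_eq l (assign F x ++ out).
Proof.
elim: F A x out => [|v K IHK Z IHZ] [|v' m b dt mt AK AZ] //= x out.
  move=> _; exists out; split=> //.
  by apply: runsI; rewrite /asg_b; cbn [encaf]; wps; fin.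
move=> [[-> Em _ _] _ _ aK aZ].
set y := clamp gamma _ x; rewrite -/(ropt gamma t v K) -Em in y *.
have [l1 [r1 p1]] := IHK AK y ((v, y) :: out) aK.
have [l2 [r2 p2]] := IHZ AZ x l1 aZ.
exists l2; split.
  have yE : y = if x - gamma < (if m < x then m else x)
      then (if m < x then m else x) else x - gamma.
    by rewrite /y /clamp /Num.max /Num.min.
  rewrite fsize_FN; apply: runsI; rewrite /asg_b; cbn [encaf]; wps.
  change (0 < 2)%N with true; cbn iota.
  case E1: (m < x) in yE *; wps.
    case E2: (x - gamma < m) in yE *; wps; rewrite yE in r1;
    by wpcall r1; wpcall r2; split=> //; lia.
  case E2: (x - gamma < x) in yE *; wps; rewrite yE in r1;
  by wpcall r1; wpcall r2; split=> //; lia.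
apply: perm_trans p2 _.
apply: perm_trans (_ : perm_eq _ (assign Z x ++ assign K y ++ (v, y) :: out)) _.
  by rewrite perm_cat2l.
apply/permP => a; rewrite /= !count_cat /= ?count_cat; lia.
Qed.

(** The list of index [i > 0] is that of index [(i - 1) / 2] in the left subtree
    for odd [i], in the right one for even [i]. *)
Inductive trie := TE | TN of seq nat & trie & trie.

Fixpoint encl (s : seq nat) : val := if s is x :: s' then P (W x) (encl s') else W 0.

Fixpoint enctrie (T : trie) : val :=
  if T is TN s l r then P (encl s) (P (enctrie l) (enctrie r)) else W 0.

Fixpoint lookup (T : trie) (i : nat) : seq nat :=
  if T is TN s l r then
    if i == 0%N then s
    else let j := ((i - 1) %/ 2)%N in
      if (i - 1 - j - j != 0)%N then lookup r j else lookup l j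
  else [::].

Lemma get_run c i T : (i < 2 ^ c)%N ->
  runs get_b (P (W i) (enctrie T)) (encl (lookup T i)) c.
Proof.
elim: c i T => [|c IH] i T ic; apply: runsI; rewrite /get_b; wps.
  have -> : i = 0%N by lia.
  by case: T => [|s l r]; cbn [enctrie]; wps; fin.
case: T => [|s l r]; cbn [enctrie]; wps; first by fin.
cbn [lookup]; case: (posnP i) => [->|i0]; wps; first by fin.
set j := ((i - 1) %/ 2)%N; have jc : (j < 2 ^ c)%N.
  by move: ic; rewrite /j expnS; lia.
case: (i - 1 - j - j != 0)%N; wps.
  by wpcall (IH j r jc); fin.
by wpcall (IH j l jc); fin.
Qed.

Lemma add_run c i w T : (i < 2 ^ c)%N ->
  exists T', runs add_b (P (W i) (P (W w) (enctrie T))) (enctrie T') c /\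
    forall k, lookup T' k = (if k == i then [:: w] else [::]) ++ lookup T k.
Proof.
elim: c i T => [|c IH] i T ic.
  have -> : i = 0%N by lia.
  case: T => [|s l r].
    exists (TN [:: w] TE TE); split.
      by apply: runsI; rewrite /add_b; cbn [enctrie]; wps; fin.
    by move=> k /=; case: (k == 0)%N => //; case: ifP.
  exists (TN (w :: s) l r); split.
    by apply: runsI; rewrite /add_b; cbn [enctrie]; wps; fin.
  by move=> k /=; case: (k == 0)%N.
case: (posnP i) => [->|i0].
  case: T => [|s l r].
    exists (TN [:: w] TE TE); split.
      by apply: runsI; rewrite /add_b; cbn [enctrie]; wps; fin.
    by move=> k /=; case: (k == 0)%N => //; case: ifP.
  exists (TN (w :: s) l r); split.
    by apply: runsI; rewrite /add_b; cbn [enctrie]; wps; fin.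
  by move=> k /=; case: (k == 0)%N.
set j := ((i - 1) %/ 2)%N; have jc : (j < 2 ^ c)%N.
  by move: ic; rewrite /j expnS; lia.
have in0 : (i != 0)%N by lia.
suff H s l r : [/\ T = TE, s = [::], l = TE & r = TE] \/ T = TN s l r ->
    exists T', runs add_b (P (W i) (P (W w) (enctrie T))) (enctrie T') c.+1 /\
      forall k, lookup T' k = (if k == i then [:: w] else [::]) ++ lookup T k.
  by case: T H => [|s l r] H; [apply: (H [::] TE TE); left|apply: (H s l r); right].
move=> hT; have lT k : lookup T k = lookup (TN s l r) k.
  by case: hT => [[-> -> -> ->]|-> //] /=; case: (k == 0)%N => //; case: ifP.
case D: (i - 1 - j - j != 0)%N.
  have [r' [rr Er]] := IH j r jc.
  exists (TN s l r'); split.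
    apply: runsI; rewrite /add_b; move: rr; case: hT => [[-> -> -> ->]|->] rr;
    by cbn [enctrie]; wps; rewrite in0; wps; rewrite -/j D; wps; wpcall rr; fin.
  move=> k; rewrite lT /= Er.
  case: (k =P i) => [->|ki]; first by rewrite (negPf in0) -/j D eqxx.
  case: (k =P 0)%N => // k0; case: ifP => // Dk.
  (* A positive index is determined by its [j] and its parity. *)
  by case: eqP => // kj; exfalso; move: Dk D kj; rewrite /j; lia.
have [l' [rl El]] := IH j l jc.
exists (TN s l' r); split.
  apply: runsI; rewrite /add_b; move: rl; case: hT => [[-> -> -> ->]|->] rl;
  by cbn [enctrie]; wps; rewrite in0; wps; rewrite -/j D; wps; wpcall rl; fin.
move=> k; rewrite lT /= El.
case: (k =P i) => [->|ki]; first by rewrite (negPf in0) -/j D eqxx.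
case: (k =P 0)%N => // k0; case: ifP => // Dk.
by case: eqP => // kj; exfalso; move: Dk D kj; rewrite /j; lia.
Qed.

Lemma adj_run c n (A : seq (nat * nat)) T i :
    (forall j, iw 1 j = (nth (0, 0) A j).1 /\ iw 2 j = (nth (0, 0) A j).2)%N ->
    (forall x, x \in A -> [/\ x.1 < n, x.2 < n & x.1 != x.2])%N ->
    (n <= 2 ^ c)%N ->
  exists T', runs adj_b (P (W i) (enctrie T)) (enctrie T') (i * (2 * c + 3)) /\
    forall k, lookup T' k = adjl (take i A) k ++ lookup T k.
Proof.
move=> iwA An nc; elim: i T => [|i IH] T.
  exists T; split; last by rewrite take0.
  by apply: runsI; rewrite /adj_b; wps; fin.
have [E1 E2] := iwA i.
have sE : (i.+1 - 1 = i)%N by lia.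
have [iA|Ai] := ltnP i (size A).
  have xA := mem_nth (0, 0)%N iA.
  have [un vn uv] := An _ xA.
  have [T1 [r1 L1]] := add_run (nth (0, 0)%N A i).1 T (leq_trans vn nc).
  have [T2 [r2 L2]] := add_run (nth (0, 0)%N A i).2 T1 (leq_trans un nc).
  have [T3 [r3 L3]] := IH T2.
  exists T3; split.
    apply: runsI; rewrite /adj_b; wps; rewrite sE.
    change (1 < 3)%N with true; change (2 < 3)%N with true; cbn iota; wps.
    rewrite E1 E2 (negPf uv); wps.
    by wpcall r1; wpcall r2; wpcall r3; split=> //; lia.
  move=> k; rewrite L3 L2 L1 (take_nth (0, 0)%N iA) -cats1 adjl_cat /= cats0.
  by rewrite -!catA.
have [T3 [r3 L3]] := IH T.
exists T3; split; last by move=> k; rewrite L3 !take_oversize //; exact: leqW.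
apply: runsI; rewrite /adj_b; wps; rewrite sE.
change (1 < 3)%N with true; change (2 < 3)%N with true; cbn iota; wps.
rewrite E1 E2 nth_default //=; wps.
by wpcall r3; split=> //; lia.
Qed.

(** A call that merely skips the parent [g] builds no vertex; [count_mem g ns] accounts for it, and
    is at most 1 on an adjacency list. *)
Lemma build_run c T adj ns v g F :
    (forall k, lookup T k = adj k) -> (forall k, uniq (adj k)) ->
    (forall k x, x \in adj k -> x < 2 ^ c)%N ->
    built adj ns v g F -> (forall x, x \in ns -> x < 2 ^ c)%N ->
  runs build_b (P (enctrie T) (P (encl ns) (P (W v) (W g)))) (encf F)
    ((c + 4) * fsize F + count_mem g ns).
Proof.
move=> LT U ac; elim=> {ns v g F} [v g|ns v g F b IH|w ns v g K Z wg bK IHK bZ IHZ] nc.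
- by apply: runsI; rewrite /build_b; cbn [encl]; wps; fin.
- apply: runsI; rewrite /build_b; cbn [encl]; wps.
  wpcall (IH (fun x h => nc x (mem_behead (h : x \in behead (g :: ns))))).
  by rewrite eqxx; wps; split=> //=; rewrite eqxx; lia.
- apply: runsI; rewrite /build_b; cbn [encl]; wps.
  wpcall (IHZ (fun x h => nc x (mem_behead (h : x \in behead (w :: ns))))).
  rewrite (negPf wg); wps.
  have rg := get_run T (nc w (mem_head _ _)); rewrite LT in rg.
  wpcall rg; wpcall (IHK (ac w)); split=> //.
  rewrite fsize_FN /= (negPf wg) add0n.
  have : (count_mem v (adj w) <= 1)%N by rewrite count_uniq_mem // leq_b1.
  clear; rewrite -[nat_of_bool false]/0%N.
  by move: (count_mem _ _) (count_mem _ _) => p q; nia.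
Qed.

End Main.

(** * Correctness and cost of the whole program *)

Section Algorithm.
Variable R : realType.
Local Open Scope ring_scope.
Variables (iw : nat -> nat -> nat) (ir : nat -> nat -> R).
Local Notation gamma := (ir 0 0).
Local Notation t := (ir 1).
Hypothesis gamma_ge0 : 0 <= gamma.
Local Notation val := (val R).
Local Notation runs := (runs iw ir).
Local Notation sem := (sem gamma t).
Local Notation rnode := (rnode gamma t).
Local Notation ropt := (ropt gamma t).
Local Notation rval := (rval gamma t).
Local Notation rassign := (rassign gamma t).
Local Notation encf := (@encf R).

Variables (n : nat) (A : seq (nat * nat)).
Let en u v := ((u, v) \in A) || ((v, u) \in A).
Hypothesis n_gt0 : (0 < n)%N.
Hypothesis iw0 : iw 0 0 = n.
Hypothesis iw12 :
  forall j, iw 1 j = (nth (0, 0) A j).1%N /\ iw 2 j = (nth (0, 0) A j).2%N.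
Hypothesis uniqA : uniq A.
Hypothesis asymA : forall u v, (u, v) \in A -> (v, u) \notin A.
Hypothesis en_lt : forall u v, en u v -> (u < n)%N /\ (v < n)%N.
Hypothesis en_irr : irreflexive en.
Hypothesis en_acyclic :
  forall c : seq nat, (2 < size c)%N -> cycle en c -> uniq c -> False.
Hypothesis en_connected : forall u v, (u < n)%N -> (v < n)%N ->
  exists2 q, path en u q & uniq (u :: q) /\ last u q = v.

(** The tree rebuilt at the best root may be another forest than the one met in the second pass;
    this transfers the optimality. *)
Hypothesis rval_root : forall r K K',
  rooted n en r K -> rooted n en r K' -> rval r K = rval r K'.

Let en_sym : symmetric en.
Proof. by move=> u v; rewrite /en orbC. Qed.

Let adj := adjl A.

Let adjP u v : (v \in adj u) = en u v.
Proof. by rewrite /adj mem_adjl. Qed.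

Let adj_uniq u : uniq (adj u).
Proof.
apply: adjl_uniq => // -[v w] vw; apply/eqP => /= e.
by have := en_irr v; rewrite /en; move: vw; rewrite e => ->.
Qed.

Lemma nch_le F : (nch F <= fsize F)%N.
Proof. by elim: F => // v K _ Z IH; rewrite fsize_FN /=; lia. Qed.

Lemma rooted_size r K : rooted n en r K -> (fsize K).+1 = n.
Proof. by case=> /perm_size; rewrite size_iota. Qed.

Lemma adjacency_run k : (n <= 2 ^ k)%N ->
  exists T, runs adj_b (P (W n) (W 0)) (enctrie R T) (n * (2 * k + 3)) /\
    forall u, lookup T u = adj u.
Proof.
move=> nk; have [|T [rT LT]] := adj_run gamma_ge0 TE n iw12 _ nk.
  move=> [u v] uv; have e : en u v by rewrite /en uv.
  have [un vn] := en_lt e; split=> //; apply/eqP => /= uv'.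
  by have := en_irr u; move: e; rewrite uv' => ->.
exists T; split=> // u; rewrite LT cats0 take_oversize //.
have [K _ rK] := rooted_ex en_lt en_sym en_irr en_acyclic en_connected adjP
  adj_uniq n_gt0.
by apply: size_edges rK uniqA asymA _ => v w vw; rewrite /en vw.
Qed.

Lemma tree_run k T r : (n <= 2 ^ k)%N -> ((2 * n).+3 ^ 2 <= 2 ^ k)%N -> (0 < k)%N ->
    (forall u, lookup T u = adj u) -> (r < n)%N ->
  exists K AK b dt mt cg cb cd,
    [/\ runs get_b (P (W r) (enctrie R T)) (encl R (adj r)) cg,
        runs build_b (P (enctrie R T) (P (encl R (adj r)) (P (W r) (W r))))
          (encf K) cb,
        exists w, runs down_b (P (W r) (P (encf K) (W 0)))
          (P (encaf (AN r (ropt r K) b dt mt AK (@AE R))) w) cd,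
        rooted n en r K /\ ann ir (solo r K) (AN r (ropt r K) b dt mt AK (@AE R)) &
        (cg + cb + cd <= 970 * (k.+1 ^ 3 * n.+1))%N].
Proof.
move=> nk n2k k0 LT rn.
have [K bK rK] := rooted_ex en_lt en_sym en_irr en_acyclic en_connected adjP
  adj_uniq rn.
have sK := rooted_size rK.
have ac u x : x \in adj u -> (x < 2 ^ k)%N.
  by rewrite adjP => /en_lt [_ xn]; exact: leq_trans xn nk.
have rg := get_run iw gamma_ge0 T (leq_trans rn nk); rewrite LT in rg.
have rb := build_run iw gamma_ge0 LT adj_uniq ac bK (ac r).
have Fn : (fsize (solo r K) <= n)%N by rewrite fsize_FN sK addn0.
have [F' [b' [u [rd aK _ _ _]]]] := down_run iw gamma_ge0 Fn n2k k0.
case: F' rd aK => [//|v m b dt mt AK [|? ? ? ? ? ? ?]] rd aK; last by case: aK.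
case: (aK) => -[Ev Em _ _] _ _ _ _; rewrite Ev Em in rd aK.
exists K, AK, b, dt, mt; do 3 eexists; split; [exact: rg|exact: rb| |by []|].
  by exists (P (encm b') (enct u)); exact: rd.
rewrite fsize_FN sK addn0 /lam.
have cnt : (count_mem r (adj r) <= 1)%N by rewrite count_uniq_mem // leq_b1.
have tl : (trunc_log 2 n <= k)%N.
  by rewrite -(leq_exp2l (m := 2)) //; apply: leq_trans nk; exact: trunc_logP.
have h2 : (k.+1 * (n * trunc_log 2 n) <= k.+1 ^ 3 * n.+1)%N.
  rewrite (expnS _ 2) -mulnA leq_mul2l /= mulnC leq_mul //.
  by apply: leq_trans tl _; rewrite expnS; nia.
have h1 : (k.+1 * n.+1 <= k.+1 ^ 3 * n.+1)%N.
  by rewrite leq_mul2r (expnS _ 2); apply/orP; right; nia.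
have h3 : ((k + 4) * fsize K <= 4 * (k.+1 * n.+1))%N by nia.
have h4 : (k.+1 <= k.+1 * n.+1)%N by rewrite leq_pmulr.
move: (k.+1 ^ 3)%N (trunc_log 2 n) (count_mem _ _) (fsize K) h1 h2 h3 h4 cnt.
by move=> a l q f; clear; nia.
Qed.

Lemma main_run k :
    ((4 * n + (2 * n + 2) * n + 6 * n + 10) ^ 2 <= 2 ^ k)%N ->
    (trunc_log 2 n + 3 <= k)%N ->
  exists r K l c,
    [/\ runs main_b (W 0) (out_val l) c,
        (c <= 5000 * (k.+1 ^ 3 * n.+1))%N,
        rooted n en r K, perm_eq l (rassign r K) &
        forall r', (r' < n)%N ->
          exists2 K', rooted n en r' K' & rval r K <= rval r' K'].
Proof.
move=> NBk Jk.
(* There are at most [n] levels, and each adds [2 n + 2] to the initial bound [4 n]. *)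
pose NB := (4 * n + (2 * n + 2) * n)%N.
have en_le q : (q <= NB + 6 * n + 10)%N -> (q ^ 2 <= 2 ^ k)%N.
  by move=> le; apply: leq_trans NBk; rewrite leq_exp2r.
have nk : (n <= 2 ^ k)%N.
  by apply: leq_trans (en_le n _); [rewrite expnS expn1; nia|lia].
have n2k : ((2 * n).+3 ^ 2 <= 2 ^ k)%N by apply: en_le; lia.
have k0 : (0 < k)%N by lia.
have [T [rT LT]] := adjacency_run nk.
have [K [AK [b [dt [mt [cg [cb [cd [rg rb [w rd] [rK aK] cl]]]]]]]]] :=
  tree_run nk n2k k0 LT n_gt0.
have [[_ _ _ Eb] [kt st nt rt] _ a0 _] := aK.
have sK := rooted_size rK.
pose m := ropt 0 K.
have wt : wfs (2 * n) [:: dt] by split=> //; rewrite nt leq_mul2l; lia.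
have rt1 : represents b (allE [:: dt]) (rnode 0 K) by rewrite /= cats0.
have n2k' : ((2 * n).+1 ^ 2 <= 2 ^ k)%N by apply: en_le; lia.
have rz := zero_run iw ir (wfs_gts n2k' wt) k0 rt1 (ropt_zero gamma_ge0 t 0 K)
  (@rnode_incr R ir gamma_ge0 0 K).
have r0 : represents ((0, 0, 0) : mom R) (allE [:: @Lf R]) (sem FE).
  by split=> x; rewrite /evh big_nil /mf /mg /=; ring.
have w0 : wfs (4 * n) [:: @Lf R] by [].
have uK : uniq (verts K) by have /andP[] := rooted_uniq rK.
have [|h [Yb [Yts [rc Hl Hh wY sY]]]] :=
    ctx_run (k := k) iw gamma_ge0 a0 uK Eb r0 w0.
  by apply: en_le; lia.
pose x0 := rval 0 K.
have [|||||||x [r [cu [ru cul [K' rK' Ex] xx0 imp]]]] := up_run iw gamma_ge0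
    (n := n) (en := en) (k := k) (NB := NB) (J := (trunc_log 2 n).+1) NBk _
    (F := K) (A := AK) (pre := FE) (u := 0%N) (L := K) (C := FE) (bu := b) (du := dt)
    (Xts := [::]) (h := h) (Yb := Yb) (Yts := Yts) (x := x0) (r := 0%N) (N := (4 * n)%N)
    erefl a0 _ _ r0 w0.
- by lia.
- by rewrite fcatF0.
- by split=> //; rewrite nt leq_mul2l; lia.
- by rewrite sK /= add1n.
- exact: Hl.
- move=> v L bv mv c e; split; [exact: Hh c e| |by rewrite sY].
  by apply: wfs_le wY; lia.
- by exists K.
have rn : (r < n)%N by apply: (rooted_lt rK'); rewrite inE eqxx.
have [K2 [AK2 [b2 [dt2 [mt2 [cg2 [cb2 [cd2 [rg2 rb2 [w2 rd2] [rK2 aK2] cl2]]]]]]]]] :=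
  tree_run nk n2k k0 LT rn.
have [_ _ _ a2 _] := aK2.
have sK2 := rooted_size rK2.
have [l [ra pl]] := asg_run iw gamma_ge0 (ropt r K2) [:: (r, ropt r K2)] a2.
pose c := (n * (2 * k + 3) + (cg + cb + cd) + 300 * k.+1 ^ 3 +
  (160 * k.+1 * light_size h K + 3 * nch K + 4) + cu + (cg2 + cb2 + cd2) +
  2 * fsize K2 + 11)%N.
exists r, K2, l, c; split=> //.
- apply: runsI; rewrite /main_b; wps; change (0 < 3)%N with true; cbn iota.
  rewrite iw0; wps; wpcall rT; wpcall rg; wpcall rb; wpcall rd.
  cbn [encaf]; wps; wpcall rz; wpm; wpcall rc.
  have -> : X ((madd b (upto m (allE [:: dt]))).1.1 * m * m -
      2%:R * (madd b (upto m (allE [:: dt]))).1.2 * m +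
      (madd b (upto m (allE [:: dt]))).2) = X x0 :> val.
    by congr X; rewrite /x0 /rval -rt.1 -[evs dt]cats0 -mf_upto -mfD.
  wpcall ru; wpcall rg2; wpcall rb2; wpcall rd2; cbn [encaf]; wps; wpcall ra.
  by split=> //; rewrite /c; clear; lia.
- have LK := light_lam gamma_ge0 a0 (leqnn _) Hl.
  have tl : (trunc_log 2 (fsize K) <= k)%N.
    by apply: leq_trans (_ : (trunc_log 2 n <= k)%N); [apply: leq_trunc_log|]; lia.
  have Ka : (fsize K * trunc_log 2 (fsize K) <= n.+1 * k.+1 ^ 2)%N.
    apply: leq_mul; first by clear -sK; lia.
    by apply: leq_trans tl _; rewrite expnS expn1; clear; nia.
  have {}LK : (k.+1 * (light_size h K + child_lam K) <= k.+1 ^ 3 * n.+1)%N.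
    by rewrite (expnS _ 2) -mulnA leq_mul2l /= mulnC (leq_trans LK).
  have k1 : (k.+1 * n.+1 <= k.+1 ^ 3 * n.+1)%N.
    by rewrite leq_mul2r (expnS _ 2) leq_pmulr ?orbT.
  have k3 : (k.+1 ^ 3 <= k.+1 ^ 3 * n.+1)%N by rewrite leq_pmulr.
  have kK : (k.+1 ^ 3 * fsize K <= k.+1 ^ 3 * n.+1)%N by rewrite leq_mul2l; clear -sK; lia.
  have k4 : (n * (2 * k + 3) <= 3 * (k.+1 * n.+1))%N by clear; nia.
  have k5 : (n.+1 <= k.+1 * n.+1)%N by rewrite leq_pmull.
  have := nch_le K; move: cl cl2 cul LK k1 k3 kK k4 k5 sK2 sK; rewrite /c; clear.
  rewrite -[(1100 * _ * _)%N]mulnA -[(160 * _ * (_ + _))%N]mulnA mulnDr.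
  rewrite -[(160 * k.+1 * light_size _ _)%N]mulnA [(k.+1 * (_ + _))%N]mulnDr.
  rewrite [(k.+1 * (2 * _))%N]mulnCA.
  move: (k.+1 ^ 3 * n.+1)%N (k.+1 ^ 3 * fsize K)%N (k.+1 * n.+1)%N => q1 q2 q3.
  move: (k.+1 ^ 3)%N (k.+1 * light_size h K)%N (k.+1 * child_lam K)%N => q4 q5 q6.
  move: (n * (2 * k + 3))%N (nch K) (fsize K) (fsize K2) => q7 q8 q9 q10; lia.
- by rewrite /rassign -cat1s perm_sym perm_catC perm_sym.
move=> r' r'n; rewrite (rval_root rK2 rK') -Ex.
have := perm_mem rK.1 r'; rewrite mem_iota r'n inE => /predU1P[->|/imp //].
by exists K.
Qed.

End Algorithm.

(** * Time and word bounds *)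

Definition steps (n : nat) : nat :=
  5000 * ((4 * trunc_log 2 n + 12).+1 ^ 3 * n.+1).

(** The time of the RAM on a program of [a] instructions, [b] being the cost of
    one round of its main loop. *)
Definition ram_time (a b n : nat) : nat :=
  (a * (steps n).+1).+1 * b + 20 * n + 30.

Lemma steps_bound :
  exists D, forall n, 2 <= n -> steps n <= D * (n * trunc_log 2 n ^ 3).
Proof.
exists (5000 * (17 ^ 3 * 2)) => n n2.
have q0 : 0 < trunc_log 2 n by rewrite trunc_log_gt0.
rewrite /steps; move: (trunc_log 2 n) q0 => q q0.
have le3 : (4 * q + 12).+1 ^ 3 <= (17 * q) ^ 3 by rewrite leq_exp2r //; lia.
have le1 : n.+1 <= 2 * n by lia.
have := leq_mul le3 le1; rewrite expnMn mulnACA (mulnC _ n) => H.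
by rewrite -mulnA leq_mul2l H orbT.
Qed.

Lemma ram_time_bound a b :
  exists D, forall n, 2 <= n -> ram_time a b n <= D * (n * trunc_log 2 n ^ 3).
Proof.
have [d H] := steps_bound; exists ((a * d.+1).+1 * b + 50) => n n2.
have m1 : n <= n * trunc_log 2 n ^ 3.
  by rewrite leq_pmulr // expn_gt0 trunc_log_gt0 n2.
rewrite /ram_time; move: (steps n) (H n n2) => s sn.
move: (n * _) m1 sn => m m1 sn.
have h : (a * s.+1).+1 <= (a * d.+1).+1 * m by nia.
by have := leq_mul h (leqnn b); nia.
Qed.

Lemma steps_poly : exists D, forall n, steps n <= D * n.+2 ^ 4.
Proof.
exists (5000 * 13 ^ 3) => n.
have tl : trunc_log 2 n <= n.
  case: n => // n.
  by apply: leq_trans (trunc_logP (isT : 1 < 2) (ltn0Sn n)); exact/ltnW/ltn_expl.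
have le3 : (4 * trunc_log 2 n + 12).+1 ^ 3 <= (13 * n.+2) ^ 3.
  by rewrite leq_exp2r //; move: (trunc_log 2 n) tl => q; lia.
rewrite /steps -mulnA leq_mul2l [n.+2 ^ 4]expnSr mulnA -expnMn.
by rewrite (leq_mul le3 (leqnSn _)) orbT.
Qed.

(** The base is at least 2, so [w] further powers of it absorb the constant factor, uniformly in
    [n]. *)
Lemma const_lt_word D n w : D < w -> D * n.+2 ^ 4 < n.+2 ^ (w + 4).
Proof.
move=> Dw; rewrite expnD ltn_pmul2r ?expn_gt0 //.
apply: ltn_trans Dw _; apply: leq_trans (ltn_expl w (isT : 1 < 2)) _.
by case: w => // w; rewrite leq_exp2r.
Qed.

Lemma all_max (T : Type) (f : T -> nat) s m :
  \max_(i <- s) f i < m -> all (fun i => f i < m) s.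
Proof.
elim: s => //= x s IH; rewrite big_cons gtn_max => /andP[-> fs].
exact: IH.
Qed.

Section Final.
Variable R : realType.
Local Open Scope ring_scope.

Lemma main_correct (p : ex) (B n : nat) (e : rel 'I_n) (A : seq ('I_n * 'I_n)) (t : 'I_n -> R)
    (gamma : R) :
    p = main_b -> is_tree e -> edge_list e A -> 0 <= gamma ->
    (n < B)%N -> all (fun i => imax i < B)%N (program p) ->
    (size (program p) < B)%N ->
    (2 * ((esz p).+3 * (steps n).+1) + 7 < B)%N ->
  exists k st,
    [/\ exec B (input A gamma t) (ram p) k st,
        (k <= ram_time (esz p).+3 (ccost (disp 0 (program p)) + 5) n)%N &
        lipschitz_unimodal_regression e gamma t (output st)].
Proof.
move=> pE eT eA g0 nB cB sB kB.
set st0 := input A gamma t.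
have n0 : (0 < n)%N by case: eT => h _ _ _; rewrite card_ord in h.
have iw12 j : words st0 1 j = (nth (0, 0) (natA A) j).1%N /\
    words st0 2 j = (nth (0, 0) (natA A) j).2%N.
  have [jA|Aj] := ltnP j (size A).
    have [x0 _] : exists x : 'I_n * 'I_n, x \in A.
      by exists (nth (Ordinal n0, Ordinal n0) A j); rewrite mem_nth.
    by rewrite /= !(nth_map x0).
  by rewrite /= !nth_default // size_map.
have k1 : ((4 * n + (2 * n + 2) * n + 6 * n + 10) ^ 2 <=
    2 ^ (4 * trunc_log 2 n + 12))%N.
  (* With [q = 2 ^ (trunc_log 2 n + 1) > n], the sizes are at most [16 q^2], whose square is
     [2 ^ (4 * trunc_log 2 n + 12)]; this is the origin of the height bound in [steps]. *)
  have -> : (4 * trunc_log 2 n + 12 = (2 * (trunc_log 2 n).+1 + 4) * 2)%N by lia.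
  rewrite expnM leq_exp2r // expnD (mulnC 2 _.+1) expnM.
  have := trunc_log_ltn n (isT : (1 < 2)%N); move: (2 ^ _.+1)%N => q np.
  by rewrite -[(q ^ 2)%N]/(q * q)%N -[(2 ^ 4)%N]/16%N; have := leq_mul np np; nia.
have k2 : (trunc_log 2 n + 3 <= 4 * trunc_log 2 n + 12)%N by lia.
have uA : uniq (natA A).
  by case: eA => _ uA _; rewrite map_inj_uniq // => -[a b] [c d] [/val_inj -> /val_inj ->].
have asA u v : (u, v) \in natA A -> (v, u) \notin natA A.
  case: eA => _ _ asym /mapP[[a b] ab [-> ->]].
  by rewrite mem_natA; exact: asym.
have rr r K K' : rooted n (enA A) r K -> rooted n (enA A) r K' ->
    rval gamma (extend t) r K = rval gamma (extend t) r K'.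
  move=> rK rK'; have rn : (r < n)%N by apply: (rooted_lt rK); rewrite inE eqxx.
  have [s Hs] := regression_ex eT eA g0 t (Ordinal rn).
  rewrite (rval_regression (r' := Ordinal rn) eA g0 rK (erefl r) Hs).
  by rewrite (rval_regression (r' := Ordinal rn) eA g0 rK' (erefl r) Hs).
have [r [K [l [c [rc lc rK pl best]]]]] := main_run (iw := words st0) (ir := reals st0)
  g0 n0 erefl iw12 uA asA (@enA_lt n A) (enA_irr eT eA)
  (enA_acyclic eT eA) (enA_connected eT eA) rr k1 k2.
have ur : perm_eq (unzip1 l) (r :: verts K).
  rewrite -(unzip1_assign gamma (extend t) K (ropt gamma (extend t) r K)).
  exact: (perm_map fst pl).
have sl : size l = n.
  by rewrite -(size_map fst) (perm_size ur) (perm_size rK.1) size_iota.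
have ul : uniq (unzip1 l) by rewrite (perm_uniq ur); exact: rooted_uniq rK.
have iB a i : (a < 3)%N -> (words st0 a i < B)%N.
  have ltB (f : 'I_n * 'I_n -> 'I_n) : (nth 0 [seq nat_of_ord (f q) | q <- A] i < B)%N.
    have [jA|Aj] := ltnP i (size A); last by rewrite nth_default ?size_map //; lia.
    apply: leq_trans nB.
    have /mapP : nth 0%N [seq nat_of_ord (f q) | q <- A] i \in
        [seq nat_of_ord (f q) | q <- A] by rewrite mem_nth // size_map.
    by case => q _ ->; apply/ltnW; exact: ltn_ord.
  by case: a => [|[|[|//]]] _ /=; [case: eqP => _; lia| |].
rewrite -pE -/(steps n) in rc lc; have rc' := runsW lc rc.
have [k' [st [x le o]]] := ram_correct iB (fun=> erefl) cB sB kB rc' ul.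
rewrite sl in le; exists k', st; split; [exact: x|exact: le|].
apply: (rassign_unimodal eT eA g0 rK) => [q qK|].
  by apply: o; rewrite (perm_mem pl).
exact: best.
Qed.

End Final.
Local Open Scope classical_set_scope.
Local Open Scope ring_scope.

Theorem theorem5 (R : realType) :
  exists (c : cmd) (T : nat -> nat),
    finds_lipschitz_unimodal_regression R c T /\
    (fun n : nat => (T n)%:R : R^o)
      =O_\oo (fun n : nat => n%:R * ln n%:R ^+ 3 : R^o).
Proof.
(* The program is hidden behind [p]: its size and its constants occur in the bounds and must not be
   computed. *)
have : exists p, p = main_b by exists main_b.
case=> p pE; pose M := (\max_(i <- program p) imax i + size (program p))%N.
pose a := (esz p).+3; pose b := (ccost (disp 0 (program p)) + 5)%N.
exists (ram p), (ram_time a b); split.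
  have [D steps_le] := steps_poly.
  (* Words have to hold two cells per machine step, the constants and addresses of the program ([M])
     and the input; the final 4 is the degree of the bound on [steps]. *)
  exists (2 * (a * D.+1) + M + 8 + 4)%N => n e A t gamma eT eA g0.
  have W : ((2 * (a * D.+1) + M + 7) * n.+2 ^ 4 <
      n.+2 ^ (2 * (a * D.+1) + M + 8 + 4))%N.
    by apply: const_lt_word; lia.
  have n4 : (n.+2 <= n.+2 ^ 4)%N by rewrite -{1}[n.+2]expn1 leq_exp2l.
  have {}W : (2 * (a * (steps n).+1) + M + 7 + n < n.+2 ^ (2 * (a * D.+1) + M + 8 + 4))%N.
    apply: leq_ltn_trans W; have := steps_le n.
    move: (steps n) (n.+2 ^ 4)%N n4 => s q n4 sq.
    have : (a * s.+1 <= a * D.+1 * q)%N by rewrite -mulnA leq_mul2l; nia.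
    by move: (a * s.+1)%N (a * D.+1)%N M n4 => x y m n4; clear -n4; nia.
  apply: (main_correct t pE eT eA g0).
  - by move: W; clear; lia.
  - by apply: all_max; apply: leq_ltn_trans W; rewrite /M; clear; lia.
  - by apply: leq_ltn_trans W; rewrite /M; clear; lia.
  - by apply: leq_ltn_trans W; clear; lia.
have [D H] := ram_time_bound a b.
have l2 : 0 < ln 2 :> R by rewrite ln_gt0 // ltr1n.
apply/eqO_exP; exists (D.+1%:R / ln 2 ^+ 3); first by rewrite divr_gt0 ?ltr0n ?exprn_gt0.
exists 2 => // n /= n2.
(* From [2 ^ trunc_log 2 n <= n]; the change of base explains the divisor [ln 2 ^+ 3] in the
   constant. *)
have lgn : (trunc_log 2 n)%:R * ln 2 <= ln n%:R :> R.
  rewrite mulr_natl -lnXn // ler_ln ?posrE ?exprn_gt0 ?ltr0n //; last by lia.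
  by rewrite -natrX ler_nat trunc_logP //; lia.
have ln0 : 0 <= ln n%:R :> R by rewrite ln_ge0 // ler1n; lia.
rewrite ger0_norm ?ler0n // ger0_norm ?mulr_ge0 ?exprn_ge0 ?ler0n //.
apply: (@le_trans _ _ (D.+1 * (n * trunc_log 2 n ^ 3))%:R).
  by rewrite ler_nat; apply: leq_trans (H n n2) _; rewrite leq_mul2r leqnSn orbT.
rewrite natrM (natrM _ n) natrX.
rewrite -[_ / _ * _]mulrA ler_wpM2l ?ler0n //.
rewrite [leRHS]mulrCA ler_wpM2l ?ler0n // [leRHS]mulrC ler_pdivlMr ?exprn_gt0 //.
by rewrite -exprMn lerXn2r ?nnegrE ?mulr_ge0 ?ler0n // ltW.
Qed.
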